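(* Any infinite-dimensional irreducible completely pointed $U_q(\mathfrak{sl}_{n+1})$-module is isomorphic (as a $U_q(\mathfrak{sl}_{n+1})$-module) to a direct summand of $\pi^*W$ for some irreducible completely pointed $A_{n+1}^q$-module $W$.
   Context: Let $\mathbb F$ be a field of characteristic $0$ closed under quadratic extensions (every quadratic polynomial over $\mathbb F$ has a root in $\mathbb F$), let $q\in\mathbb F$ be nonzero and not a root of unity, and let $n\ge1$. Write $[2]_q=q+q^{-1}$. $U_q(\mathfrak{gl}_{n+1})$ is the associative unital $\mathbb F$-algebra with generators $E_i,F_i$ ($1\le i\le n$), $\bar K_j^{\pm1}$ ($1\le j\le n+1$) and relations: $\bar K_j\bar K_j^{-1}=\bar K_j^{-1}\bar K_j=1$, $\bar K_i\bar K_j=\bar K_j\bar K_i$; $\bar K_jE_i\bar K_j^{-1}=q^{\delta_{ij}-\delta_{j,i+1}}E_i$, $\bar K_jF_i\bar K_j^{-1}=q^{-(\delta_{ij}-\delta_{j,i+1})}F_i$; $[E_i,F_j]=\delta_{ij}\frac{\bar K_i\bar K_{i+1}^{-1}-\bar K_i^{-1}\bar K_{i+1}}{q-q^{-1}}$; $[E_i,E_j]=[F_i,F_j]=0$ for $|i-j|>1$; $E_i^2E_j-[2]_qE_iE_jE_i+E_jE_i^2=0$ and $F_i^2F_j-[2]_qF_iF_jF_i+F_jF_i^2=0$ for $|i-j|=1$. $U_q(\mathfrak{sl}_{n+1})$ is the subalgebra generated by $E_i,F_i$ and $K_i^{\pm1}$, $K_i:=\bar K_i\bar K_{i+1}^{-1}$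 ($1\le i\le n$). The quantized Weyl algebra $A_{n+1}^q$ is the associative unital $\mathbb F$-algebra with generators $\omega_i^{\pm1},x_i,y_i$ ($1\le i\le n+1$) and relations: $\omega_i\omega_i^{-1}=\omega_i^{-1}\omega_i=1$, $\omega_i\omega_j=\omega_j\omega_i$, $\omega_ix_j\omega_i^{-1}=q^{\delta_{ij}}x_j$, $\omega_iy_j\omega_i^{-1}=q^{-\delta_{ij}}y_j$, $x_ix_j=x_jx_i$, $y_iy_j=y_jy_i$, $y_ix_j=x_jy_i$ for $i\ne j$, $y_ix_i-q^{-1}x_iy_i=\omega_i$, $y_ix_i-qx_iy_i=\omega_i^{-1}$. Put $R=\mathbb F[\omega_1^{\pm1},\dots,\omega_{n+1}^{\pm1}]$. $\pi:U_q(\mathfrak{gl}_{n+1})\to A_{n+1}^q$ is the $\mathbb F$-algebra homomorphism with $E_i\mapsto x_iy_{i+1}$, $F_i\mapsto x_{i+1}y_i$, $\bar K_i\mapsto\omega_i$. The $\pi$-pullback $\pi^*W$ of an $A_{n+1}^q$-module $W$ is the vector space $W$ with $u$ acting as $\pi(u)$; it is a $U_q(\mathfrak{gl}_{n+1})$-module, and by restriction a $U_q(\mathfrak{sl}_{n+1})$-module. An $A_{n+1}^q$-module $W$ is a weight module if $W=\bigoplus_{\mathfrak m}W_{\mathfrak m}$ over maximal ideals $\mathfrak m$ of $R$, with $W_{\mathfrak m}=\{w\in W:\mathfrak mw=0\}$; it is completely pointed if it is a weight module and all its nonzero weight spaces are one-dimensional over $\mathbb F$. For a $U_q(\mathfrak{sl}_{n+1})$-module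 $V$ and $\lambda\in(\mathbb F^\times)^n$, the weight space is $V_\lambda=\{v\in V:K_iv=\lambda_iv\ \forall i\}$; $V$ is completely pointed if it is the direct sum of its weight spaces and all its nonzero weight spaces are one-dimensional. *)

(* Defs.v *)
From HB Require Import structures.
From mathcomp Require Import all_boot all_algebra.
From mathcomp Require Import finmap monalg.
From mathcomp Require Import boolp classical_sets.

Set Implicit Arguments.
Unset Strict Implicit.
Unset Printing Implicit Defensive.

Import GRing.Theory.
Local Open Scope ring_scope.

(* [algType] is only available for rings with 1 != 0, which would have to be
   proved for an algebra given by generators and relations.  Here an F-algebra
   is a possibly trivial ring with a central ring morphism [scal] from F. *)
HB.mixin Record hasScalars (F : pzRingType) A of GRing.PzRing A := {
  scal : F -> A;
  scal_zmod_morphism : zmod_morphism scal;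
  scal_monoid_morphism : monoid_morphism scal;
  scalC : forall (c : F) (u : A), scal c * u = u * scal c
}.

#[short(type="pzAlgType")]
HB.structure Definition PzAlgebra (F : pzRingType) :=
  {A of GRing.PzRing A & hasScalars F A}.

Section Scalars.
Variables (F : pzRingType) (A : pzAlgType F).
Local Notation scalA := (@scal F A).
HB.instance Definition _ :=
  GRing.isZmodMorphism.Build F A scalA scal_zmod_morphism.
HB.instance Definition _ :=
  GRing.isMonoidMorphism.Build F A scalA scal_monoid_morphism.
End Scalars.

Definition free_alg (F : fieldType) (I : choiceType) : Type :=
  {malg F[{fmonom I}]}.

(* The product, scalars and generators are locked for performance only: failing
   unifications would unfold them. *)
HB.lock Definition free_mul (F : fieldType) (I : choiceType)
  (u v : {malg F[{fmonom I}]}) : free_alg F I := u * v.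

HB.lock Definition gen (F : fieldType) (I : choiceType) (i : I) :
  free_alg F I := << fmu i >>.

HB.lock Definition free_scal (F : fieldType) (I : choiceType) (c : F) :
  free_alg F I := c%:MP.

Section FreeAlgebra.
Variables (F : fieldType) (I : choiceType).
Local Notation M := {malg F[{fmonom I}]}.
Local Notation free_alg := (free_alg F I).
Local Notation free_scal := (@free_scal F I).

HB.instance Definition _ := GRing.Zmodule.on free_alg.
HB.instance Definition _ := GRing.Lmodule.on free_alg.

Fact free_mulA : associative (@free_mul F I).
Proof. by rewrite unlock; exact: mulrA. Qed.

Fact free_mul1l : left_id (1 : M) (@free_mul F I).
Proof. by rewrite unlock; exact: mul1r. Qed.

Fact free_mul1r : right_id (1 : M) (@free_mul F I).
Proof. by rewrite unlock; exact: mulr1. Qed.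

Fact free_mulDl : left_distributive (@free_mul F I) +%R.
Proof. by rewrite unlock; exact: mulrDl. Qed.

Fact free_mulDr : right_distributive (@free_mul F I) +%R.
Proof. by rewrite unlock; exact: mulrDr. Qed.

HB.instance Definition _ := GRing.Zmodule_isPzRing.Build free_alg
  free_mulA free_mul1l free_mul1r free_mulDl free_mulDr.

Lemma free_mulE (u v : free_alg) : u * v = ((u : M) * (v : M) : M).
Proof. by rewrite -[LHS]/(free_mul u v) unlock. Qed.

Fact free_scal_zmod_morphism : zmod_morphism free_scal.
Proof. by rewrite unlock; exact: (raddfB (malgC : F -> M)). Qed.

Fact free_scal_monoid_morphism : monoid_morphism free_scal.
Proof.
rewrite unlock; split=> // c d.
by rewrite [RHS]free_mulE (rmorphM (malgC : F -> M)).
Qed.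

Fact free_scalC (c : F) (u : free_alg) : free_scal c * u = u * free_scal c.
Proof.
rewrite unlock [LHS]free_mulE [RHS]free_mulE !malgM_def fgmulUg fgmulgU.
by apply: eq_bigr => k _; rewrite mul1m mulm1 mulrC.
Qed.

HB.instance Definition _ := hasScalars.Build F free_alg
  free_scal_zmod_morphism free_scal_monoid_morphism free_scalC.

Lemma free_scaleE (c : F) (u : free_alg) : c *: u = scal c * u.
Proof.
rewrite [RHS]free_mulE -[scal c]/(free_scal c) unlock.
exact/esym/mul_malgC.
Qed.

End FreeAlgebra.

Section Presentation.
Variables (F : fieldType) (I : choiceType).
Local Notation T := (free_alg F I).
Variable rel : T -> T -> Prop.

(* The two-sided ideal generated by the [l - r] with [rel l r]; it is closed
   under scalars because these are central in the free algebra. *)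
Inductive relideal : T -> Prop :=
| RelIdeal_rel l r : rel l r -> relideal (l - r)
| RelIdeal_0 : relideal 0
| RelIdeal_D x y : relideal x -> relideal y -> relideal (x + y)
| RelIdeal_M a x b : relideal x -> relideal (a * x * b).

Definition relideal_pred : {pred T} := fun x => `[< relideal x >].

Fact relideal_zmod_closed : zmod_closed relideal_pred.
Proof.
split=> [|x y /asboolP Ix /asboolP Iy]; apply/asboolP; first exact: RelIdeal_0.
apply: RelIdeal_D => //.
by rewrite -[y]mulr1 -mulNr -mulN1r; apply: RelIdeal_M.
Qed.

HB.instance Definition _ :=
  GRing.isZmodClosed.Build T relideal_pred relideal_zmod_closed.

Definition presented : Type := {ideal_quot relideal_pred}.
HB.instance Definition _ := GRing.Zmodule.on presented.
HB.instance Definition _ := EqQuotient.on presented.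

End Presentation.

HB.lock Definition presented_proj (F : fieldType) (I : choiceType)
    (rel : free_alg F I -> free_alg F I -> Prop) (x : free_alg F I) :
  presented rel := (\pi_(presented rel) x)%qT.

HB.lock Definition presented_mul (F : fieldType) (I : choiceType)
    (rel : free_alg F I -> free_alg F I -> Prop) (u v : presented rel) :
  presented rel := presented_proj rel (repr u * repr v).

Section PresentedAlgebra.
Variables (F : fieldType) (I : choiceType).
Local Notation T := (free_alg F I).
Variable rel : T -> T -> Prop.
Local Notation presented := (presented rel).
Local Notation presented_proj := (@presented_proj F I rel).
Local Notation presented_mul := (@presented_mul F I rel).
Local Notation relideal := (relideal rel).

Lemma presented_projP x y :
  presented_proj x = presented_proj y <-> relideal (x - y).
Proof.
have -> : relideal (x - y) <-> x - y \in relideal_pred rel.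
  by split=> /asboolP.
rewrite (Quotient.idealrBE (relideal_pred rel)) unlock.
by split=> [->|/eqP].
Qed.

Lemma presented_projK (u : presented) : presented_proj (repr u) = u.
Proof. by rewrite unlock; exact: reprK. Qed.

Lemma presented_rel l r : rel l r -> presented_proj l = presented_proj r.
Proof. by move=> lr; apply/presented_projP; apply: RelIdeal_rel. Qed.

Definition presented_one : presented := presented_proj 1.

Let projD : {morph presented_proj : x y / x + y}.
Proof. by move=> x y; rewrite unlock [LHS]Quotient.pi_add. Qed.

Let projM x y :
  presented_mul (presented_proj x) (presented_proj y) = presented_proj (x * y).
Proof.
rewrite presented_mul.unlock; apply/presented_projP.
set x' := repr (presented_proj x); set y' := repr (presented_proj y).
have Ix : relideal (x' - x) by apply/presented_projP; rewrite presented_projK.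
have Iy : relideal (y' - y) by apply/presented_projP; rewrite presented_projK.
have -> : x' * y' - x * y = 1 * (x' - x) * y' + x * (y' - y) * 1.
  by rewrite mul1r mulr1 mulrBl mulrBr addrA subrK.
by apply: RelIdeal_D; apply: RelIdeal_M.
Qed.

Let projE (u : presented) : exists x, u = presented_proj x.
Proof. by exists (repr u); rewrite presented_projK. Qed.

Fact presented_mulA : associative presented_mul.
Proof.
move=> u v w; have [x ->] := projE u; have [y ->] := projE v.
by have [z ->] := projE w; rewrite !projM mulrA.
Qed.

Fact presented_mul1l : left_id presented_one presented_mul.
Proof. by move=> u; have [x ->] := projE u; rewrite projM mul1r. Qed.

Fact presented_mul1r : right_id presented_one presented_mul.
Proof. by move=> u; have [x ->] := projE u; rewrite projM mulr1. Qed.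

Fact presented_mulDl : left_distributive presented_mul +%R.
Proof.
move=> u v w; have [x ->] := projE u; have [y ->] := projE v.
by have [z ->] := projE w; rewrite -projD !projM mulrDl projD.
Qed.

Fact presented_mulDr : right_distributive presented_mul +%R.
Proof.
move=> u v w; have [x ->] := projE u; have [y ->] := projE v.
by have [z ->] := projE w; rewrite -projD !projM mulrDr projD.
Qed.

HB.instance Definition _ := GRing.Zmodule_isPzRing.Build presented
  presented_mulA presented_mul1l presented_mul1r
  presented_mulDl presented_mulDr.

Fact presented_proj_zmod_morphism : zmod_morphism presented_proj.
Proof.
move=> x y; apply: (addIr (presented_proj y)).
by rewrite subrK -projD subrK.
Qed.

Fact presented_proj_monoid_morphism : monoid_morphism presented_proj.
Proof. by split=> // x y; rewrite -projM. Qed.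

HB.instance Definition _ :=
  GRing.isZmodMorphism.Build T presented presented_proj
    presented_proj_zmod_morphism.
HB.instance Definition _ :=
  GRing.isMonoidMorphism.Build T presented presented_proj
    presented_proj_monoid_morphism.

Definition presented_scal (c : F) : presented := presented_proj (scal c).

Fact presented_scal_zmod_morphism : zmod_morphism presented_scal.
Proof. by move=> c d; rewrite /presented_scal !rmorphB. Qed.

Fact presented_scal_monoid_morphism : monoid_morphism presented_scal.
Proof. by split=> [|c d]; rewrite /presented_scal ?rmorph1 // !rmorphM. Qed.

Fact presented_scalC c u : presented_scal c * u = u * presented_scal c.
Proof. by have [x ->] := projE u; rewrite -!rmorphM scalC. Qed.

HB.instance Definition _ := hasScalars.Build F presented
  presented_scal_zmod_morphism presented_scal_monoid_morphism presented_scalC.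

Definition pgen (i : I) : presented := presented_proj (gen F i).

End PresentedAlgebra.

Section Lift.
Variables (F : fieldType) (I : choiceType) (B : pzAlgType F) (h : I -> B).
Local Notation T := (free_alg F I).

Definition free_eval (p : T) : B :=
  \sum_(k <- msupp p) scal p@_k * \prod_(i <- (k : seq I)) h i.

Lemma free_evalEw (d : {fset {fmonom I}}) (p : T) : fsubset (msupp p) d ->
  free_eval p = \sum_(k <- d) scal p@_k * \prod_(i <- (k : seq I)) h i.
Proof.
move=> le; rewrite [LHS](big_fset_incl _ le) => //= x xd /mcoeff_outdom ->.
by rewrite rmorph0 mul0r.
Qed.

Lemma free_evalU c (k : {fmonom I}) :
  free_eval << c *g k >> = scal c * \prod_(i <- (k : seq I)) h i.
Proof. by rewrite (free_evalEw msuppU_le) big_seq_fset1 mcoeffUU. Qed.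

Lemma free_eval_gen i : free_eval (gen F i) = h i.
Proof. by rewrite unlock free_evalU fmU big_seq1 rmorph1 mul1r. Qed.

Lemma free_eval_scal c : free_eval (scal c) = scal c.
Proof.
by rewrite -[scal c in LHS]/(free_scal I c) unlock free_evalU fm1 big_nil mulr1.
Qed.

Fact free_eval_zmod_morphism : zmod_morphism free_eval.
Proof.
move=> p1 p2; set E := fsetU (msupp p1) (msupp p2).
have le1 : fsubset (msupp p1) E by apply: fsubsetUl.
have le2 : fsubset (msupp p2) E by apply: fsubsetUr.
have le : fsubset (msupp (p1 - p2)) E by apply: msuppB_le.
rewrite (free_evalEw le1) (free_evalEw le2) (free_evalEw le) -sumrB.
by apply: eq_bigr => k _; rewrite mcoeffB rmorphB mulrBl.
Qed.

HB.instance Definition _ :=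
  GRing.isZmodMorphism.Build T B free_eval free_eval_zmod_morphism.

Fact free_eval_monoid_morphism : monoid_morphism free_eval.
Proof.
split=> [|p1 p2].
  by rewrite -(rmorph1 (@scal F T)) free_eval_scal rmorph1.
rewrite free_mulE malgME raddf_sum /free_eval mulr_suml; apply: eq_bigr => k1 _.
rewrite raddf_sum mulr_sumr; apply: eq_bigr => k2 _.
rewrite /= free_evalU fmM big_cat /= rmorphM -!mulrA; congr (_ * _).
by rewrite !mulrA scalC.
Qed.

HB.instance Definition _ :=
  GRing.isMonoidMorphism.Build T B free_eval free_eval_monoid_morphism.

Lemma free_evalZ c p : free_eval (c *: p) = scal c * free_eval p.
Proof. by rewrite free_scaleE rmorphM /= free_eval_scal. Qed.

Variable rel : T -> T -> Prop.
Hypothesis h_rel : forall l r, rel l r -> free_eval l = free_eval r.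

Lemma free_eval_relideal x : relideal rel x -> free_eval x = 0.
Proof.
elim=> {x} [l r /h_rel e||x y _ IHx _ IHy|a x b _ IHx].
- by rewrite rmorphB /= e subrr.
- by rewrite rmorph0.
- by rewrite rmorphD /= IHx IHy addr0.
- by rewrite !rmorphM /= IHx mulr0 mul0r.
Qed.

(* [h_rel] is an argument so that the lift is canonically a ring morphism. *)
Definition presented_lift
    (_ : forall l r, rel l r -> free_eval l = free_eval r)
    (u : presented rel) : B :=
  free_eval (repr u).

Local Notation lift := (presented_lift h_rel).

Lemma presented_lift_proj x : lift (presented_proj rel x) = free_eval x.
Proof.
apply/eqP; rewrite -subr_eq0 -rmorphB; apply/eqP/free_eval_relideal.
by apply/(presented_projP rel); rewrite presented_projK.
Qed.

Lemma presented_lift_gen i : lift (pgen rel i) = h i.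
Proof. by rewrite presented_lift_proj free_eval_gen. Qed.

Lemma presented_lift_scal c : lift (scal c) = scal c.
Proof. by rewrite presented_lift_proj free_eval_scal. Qed.

Fact presented_lift_zmod_morphism : zmod_morphism lift.
Proof.
move=> u v; rewrite -(presented_projK u) -(presented_projK v).
by rewrite -rmorphB !presented_lift_proj rmorphB.
Qed.

Fact presented_lift_monoid_morphism : monoid_morphism lift.
Proof.
split=> [|u v].
  by rewrite -(rmorph1 (presented_proj rel)) presented_lift_proj rmorph1.
rewrite -(presented_projK u) -(presented_projK v).
by rewrite -rmorphM !presented_lift_proj rmorphM.
Qed.

HB.instance Definition _ :=
  GRing.isZmodMorphism.Build (presented rel) B lift
    presented_lift_zmod_morphism.
HB.instance Definition _ :=
  GRing.isMonoidMorphism.Build (presented rel) B lift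
    presented_lift_monoid_morphism.

End Lift.

Section Subalgebra.
Variables (F : pzRingType) (A : pzAlgType F) (X : set A).

Inductive in_subalgebra : A -> Prop :=
| InSubalg_gen x : X x -> in_subalgebra x
| InSubalg_scal (c : F) : in_subalgebra (scal c)
| InSubalg_D x y : in_subalgebra x -> in_subalgebra y -> in_subalgebra (x + y)
| InSubalg_M x y : in_subalgebra x -> in_subalgebra y -> in_subalgebra (x * y).

Definition subalgebra_pred : {pred A} := fun x => `[< in_subalgebra x >].

Fact subalgebra_subring_closed : subring_closed subalgebra_pred.
Proof.
split=> [|x y /asboolP Ax /asboolP Ay|x y /asboolP Ax /asboolP Ay];
  apply/asboolP.
- by rewrite -(rmorph1 (@scal F A)); apply: InSubalg_scal.
- apply: InSubalg_D => //; rewrite -mulN1r -(rmorphN1 (@scal F A)).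
  by apply: InSubalg_M => //; apply: InSubalg_scal.
- exact: InSubalg_M.
Qed.

HB.instance Definition _ :=
  GRing.isSubringClosed.Build A subalgebra_pred subalgebra_subring_closed.

Record subalgebra :=
  Subalg { subalg_val : A; _ : subalg_val \in subalgebra_pred }.

HB.instance Definition _ := [isSub for subalg_val].
HB.instance Definition _ := [Choice of subalgebra by <:].
HB.instance Definition _ :=
  GRing.SubChoice_isSubPzRing.Build A subalgebra_pred subalgebra
    subalgebra_subring_closed.

Fact subalgebra_scal_proof (c : F) : scal c \in subalgebra_pred.
Proof. by apply/asboolP/InSubalg_scal. Qed.

Definition subalgebra_scal (c : F) : subalgebra :=
  Subalg (subalgebra_scal_proof c).

Fact subalgebra_scal_zmod_morphism : zmod_morphism subalgebra_scal.
Proof. by move=> c d; apply: val_inj; rewrite /= rmorphB. Qed.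

Fact subalgebra_scal_monoid_morphism : monoid_morphism subalgebra_scal.
Proof. by split=> [|c d]; apply: val_inj; rewrite /= (rmorph1, rmorphM). Qed.

Fact subalgebra_scalC c u : subalgebra_scal c * u = u * subalgebra_scal c.
Proof. by apply: val_inj; rewrite /= scalC. Qed.

HB.instance Definition _ := hasScalars.Build F subalgebra
  subalgebra_scal_zmod_morphism subalgebra_scal_monoid_morphism
  subalgebra_scalC.

Fact subalg_gen_proof x : X x -> x \in subalgebra_pred.
Proof. by move=> Xx; apply/asboolP/InSubalg_gen. Qed.

Definition subalg_gen x (Xx : X x) : subalgebra := Subalg (subalg_gen_proof Xx).

End Subalgebra.

(* For an F-algebra [A], an [lmodType A] is a left A-module; it is an F-vector
   space through [scal]. *)

Section Modules.
Variables (F : fieldType) (A : pzAlgType F) (V : lmodType A).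

Definition fscale (c : F) (v : V) : V := (scal c : A) *: v.

Definition infinite_dimensional : Prop :=
  ~ exists s : seq V, forall v : V, exists c : 'I_(size s) -> F,
      v = \sum_(i < size s) fscale (c i) s`_i.

Definition one_dimensional (X : set V) : Prop :=
  exists v, [/\ X v, v != 0 & forall w, X w <-> exists c : F, w = fscale c v].

Definition is_submodule (S : set V) : Prop :=
  [/\ S 0, forall u v, S u -> S v -> S (u + v)
    & forall (a : A) v, S v -> S (a *: v)].

Definition irreducible_module : Prop :=
  (exists v : V, v != 0) /\
  forall S : set V, is_submodule S ->
    (forall v, S v -> v = 0) \/ (forall v, S v).

(* V is the internal direct sum of the subspaces X j, for j in P. *)
Definition is_direct_sum (J : eqType) (P : set J) (X : J -> set V) : Prop :=
  (forall v : V, exists (s : seq J) (f : J -> V),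
      [/\ uniq s, forall j, j \in s -> P j /\ X j (f j)
        & v = \sum_(j <- s) f j]) /\
  (forall (s : seq J) (f : J -> V),
      uniq s -> (forall j, j \in s -> P j /\ X j (f j)) ->
      \sum_(j <- s) f j = 0 -> forall j, j \in s -> f j = 0).

(* "Completely pointed" for the weight spaces X j, with weights j in P. *)
Definition pointed_decomposition (J : eqType) (P : set J) (X : J -> set V) :
    Prop :=
  is_direct_sum P X /\
  forall j, P j -> (exists2 v, X j v & v != 0) -> one_dimensional (X j).

Definition is_direct_summand (S : set V) : Prop :=
  is_submodule S /\
  exists S' : set V,
    [/\ is_submodule S',
        forall v, exists u u', [/\ S u, S' u' & v = u + u']
      & forall v, S v -> S' v -> v = 0].

End Modules.

(* [f] is then an isomorphism of V onto the direct summand [range f]. *)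
Definition iso_to_direct_summand (F : fieldType) (A : pzAlgType F)
    (V W : lmodType A) : Prop :=
  exists f : {linear V -> W}, injective f /\ is_direct_summand (range f).

(* [W] with [a : A] acting as [f a]; restriction when [f] is an inclusion. *)
Definition pullback (A B : pzRingType) (f : {rmorphism A -> B})
  (W : lmodType B) : Type := W.

Section Pullback.
Variables (A B : pzRingType) (f : {rmorphism A -> B}) (W : lmodType B).
Local Notation pW := (pullback f W).

HB.instance Definition _ := GRing.Zmodule.on pW.

Definition pullback_scale (a : A) (w : pW) : pW := f a *: (w : W).

Fact pullback_scalerA a b w :
  pullback_scale a (pullback_scale b w) = pullback_scale (a * b) w.
Proof. by rewrite /pullback_scale rmorphM scalerA. Qed.

Fact pullback_scale1r : left_id 1 pullback_scale.
Proof. by move=> w; rewrite /pullback_scale rmorph1 scale1r. Qed.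

Fact pullback_scalerDr : right_distributive pullback_scale +%R.
Proof. by move=> a u v; rewrite /pullback_scale -scalerDr. Qed.

Fact pullback_scalerDl w : {morph pullback_scale^~ w : a b / a + b}.
Proof. by move=> a b; rewrite /pullback_scale rmorphD scalerDl. Qed.

HB.instance Definition _ := GRing.Zmodule_isLmodule.Build A pW
  pullback_scalerA pullback_scale1r pullback_scalerDr pullback_scalerDl.

End Pullback.

Definition not_root_of_unity (F : fieldType) (q : F) : Prop :=
  forall m : nat, (0 < m)%N -> q ^+ m != 1.

Definition qtwo (F : fieldType) (q : F) : F := q + q^-1.

(* [GlKV j] stands for the inverse of [GlK j]. *)
Variant glgen (n : nat) : Type :=
| GlE of 'I_n | GlF of 'I_n | GlK of 'I_n.+1 | GlKV of 'I_n.+1.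

Section GlgenChoice.
Variable n : nat.

Definition glgen_code (g : glgen n) : ('I_n + 'I_n) + ('I_n.+1 + 'I_n.+1) :=
  match g with
  | GlE i => inl (inl i) | GlF i => inl (inr i)
  | GlK j => inr (inl j) | GlKV j => inr (inr j)
  end.

Definition glgen_decode (c : ('I_n + 'I_n) + ('I_n.+1 + 'I_n.+1)) : glgen n :=
  match c with
  | inl (inl i) => GlE i | inl (inr i) => GlF i
  | inr (inl j) => GlK j | inr (inr j) => GlKV j
  end.

Fact glgen_codeK : cancel glgen_code glgen_decode. Proof. by case. Qed.

HB.instance Definition _ := Choice.copy (glgen n) (can_type glgen_codeK).

End GlgenChoice.

(* With indices counted from 0, [lo i] and [hi i] are the indices i and i+1 of
   the n+1 generators K attached to the i-th of the n generators E, F. *)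
Definition lo n (i : 'I_n) : 'I_n.+1 := widen_ord (leqnSn n) i.
Definition hi n (i : 'I_n) : 'I_n.+1 := lift ord0 i.

Definition adjacent n (i j : 'I_n) : bool :=
  (j == i.+1 :> nat) || (i == j.+1 :> nat).
Definition distant n (i j : 'I_n) : bool := (i.+1 < j)%N || (j.+1 < i)%N.

Section Uq.
Variables (F : fieldType) (q : F) (n : nat).

(* delta_(j,i) - delta_(j,i+1) *)
Definition glwt (j : 'I_n.+1) (i : 'I_n) : int :=
  (j == lo i)%:Z - (j == hi i)%:Z.

Local Notation E i := (gen F (GlE i)).
Local Notation F_ i := (gen F (GlF i)).
Local Notation K j := (gen F (GlK j)).
Local Notation KV j := (gen F (GlKV j)).

Inductive gl_rel : free_alg F (glgen n) -> free_alg F (glgen n) -> Prop :=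
| GlRel_KKV j : gl_rel (K j * KV j) 1
| GlRel_KVK j : gl_rel (KV j * K j) 1
| GlRel_KK i j : gl_rel (K i * K j) (K j * K i)
| GlRel_KE i j : gl_rel (K j * E i * KV j) (q ^ glwt j i *: E i)
| GlRel_KF i j : gl_rel (K j * F_ i * KV j) (q ^ (- glwt j i) *: F_ i)
| GlRel_EF i j : gl_rel (E i * F_ j - F_ j * E i)
    (((i == j)%:R / (q - q^-1)) *:
       (K (lo i) * KV (hi i) - KV (lo i) * K (hi i)))
| GlRel_EE i j : distant i j -> gl_rel (E i * E j) (E j * E i)
| GlRel_FF i j : distant i j -> gl_rel (F_ i * F_ j) (F_ j * F_ i)
| GlRel_serreE i j : adjacent i j ->
    gl_rel (E i ^+ 2 * E j - qtwo q *: (E i * E j * E i) + E j * E i ^+ 2) 0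
| GlRel_serreF i j : adjacent i j ->
    gl_rel (F_ i ^+ 2 * F_ j - qtwo q *: (F_ i * F_ j * F_ i)
              + F_ j * F_ i ^+ 2) 0.

Definition Uqgl : Type := presented gl_rel.
HB.instance Definition _ := PzAlgebra.on Uqgl.

Definition glE (i : 'I_n) : Uqgl := pgen gl_rel (GlE i).
Definition glF (i : 'I_n) : Uqgl := pgen gl_rel (GlF i).
Definition glK (j : 'I_n.+1) : Uqgl := pgen gl_rel (GlK j).
Definition glKV (j : 'I_n.+1) : Uqgl := pgen gl_rel (GlKV j).

Variant sl_gen : set Uqgl :=
| SlE i : sl_gen (glE i)
| SlF i : sl_gen (glF i)
| SlK i : sl_gen (glK (lo i) * glKV (hi i))
| SlKV i : sl_gen (glKV (lo i) * glK (hi i)).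

Definition Uqsl : Type := subalgebra sl_gen.
HB.instance Definition _ := PzAlgebra.on Uqsl.

Definition sl_to_gl : {rmorphism Uqsl -> Uqgl} :=
  (val : subalgebra sl_gen -> Uqgl).

(* K_i = Kbar_i Kbar_(i+1)^-1 *)
Definition slK (i : 'I_n) : Uqsl := subalg_gen (SlK i).

Section SlModule.
Variable V : lmodType Uqsl.

Definition is_sl_weight (lam : {ffun 'I_n -> F}) : Prop :=
  forall i, lam i != 0.

Definition sl_weight_space (lam : {ffun 'I_n -> F}) : set V :=
  [set v | forall i, slK i *: v = fscale (lam i) v].

Definition sl_completely_pointed : Prop :=
  pointed_decomposition is_sl_weight sl_weight_space.

End SlModule.
End Uq.

(* [WeylOV i] stands for the inverse of [WeylO i]. *)
Variant weylgen (m : nat) : Type :=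
| WeylO of 'I_m | WeylOV of 'I_m | WeylX of 'I_m | WeylY of 'I_m.

Section WeylgenChoice.
Variable m : nat.

Definition weylgen_code (g : weylgen m) : ('I_m + 'I_m) + ('I_m + 'I_m) :=
  match g with
  | WeylO i => inl (inl i) | WeylOV i => inl (inr i)
  | WeylX i => inr (inl i) | WeylY i => inr (inr i)
  end.

Definition weylgen_decode (c : ('I_m + 'I_m) + ('I_m + 'I_m)) : weylgen m :=
  match c with
  | inl (inl i) => WeylO i | inl (inr i) => WeylOV i
  | inr (inl i) => WeylX i | inr (inr i) => WeylY i
  end.

Fact weylgen_codeK : cancel weylgen_code weylgen_decode. Proof. by case. Qed.

HB.instance Definition _ := Choice.copy (weylgen m) (can_type weylgen_codeK).

End WeylgenChoice.

(* Two-sided ideals; only used for the commutative ring [weyl_torus]. *)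
Definition is_ideal (R : pzRingType) (I : set R) : Prop :=
  [/\ I 0, forall x y, I x -> I y -> I (x + y)
    & forall a x b, I x -> I (a * x * b)].

Definition is_maximal_ideal (R : pzRingType) (I : set R) : Prop :=
  [/\ is_ideal I, ~ I 1
    & forall J : set R, is_ideal J -> ~ J 1 ->
        (forall x, I x -> J x) -> forall x, J x -> I x].

Section Weyl.
Variables (F : fieldType) (q : F) (m : nat).

Local Notation O i := (gen F (WeylO i)).
Local Notation OV i := (gen F (WeylOV i)).
Local Notation X i := (gen F (WeylX i)).
Local Notation Y i := (gen F (WeylY i)).

Inductive weyl_rel :
    free_alg F (weylgen m) -> free_alg F (weylgen m) -> Prop :=
| WeylRel_OOV i : weyl_rel (O i * OV i) 1
| WeylRel_OVO i : weyl_rel (OV i * O i) 1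
| WeylRel_OO i j : weyl_rel (O i * O j) (O j * O i)
| WeylRel_OX i j : weyl_rel (O i * X j * OV i) (q ^+ (i == j) *: X j)
| WeylRel_OY i j : weyl_rel (O i * Y j * OV i) (q ^- (i == j) *: Y j)
| WeylRel_XX i j : weyl_rel (X i * X j) (X j * X i)
| WeylRel_YY i j : weyl_rel (Y i * Y j) (Y j * Y i)
| WeylRel_YX i j : i != j -> weyl_rel (Y i * X j) (X j * Y i)
| WeylRel_YXV i : weyl_rel (Y i * X i - q^-1 *: (X i * Y i)) (O i)
| WeylRel_YXq i : weyl_rel (Y i * X i - q *: (X i * Y i)) (OV i).

Definition qWeyl : Type := presented weyl_rel.
HB.instance Definition _ := PzAlgebra.on qWeyl.

Definition weylO (i : 'I_m) : qWeyl := pgen weyl_rel (WeylO i).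
Definition weylOV (i : 'I_m) : qWeyl := pgen weyl_rel (WeylOV i).
Definition weylX (i : 'I_m) : qWeyl := pgen weyl_rel (WeylX i).
Definition weylY (i : 'I_m) : qWeyl := pgen weyl_rel (WeylY i).

Variant torus_gen : set qWeyl :=
| TorusO i : torus_gen (weylO i)
| TorusOV i : torus_gen (weylOV i).

(* The ring R of Laurent polynomials in the omega_i, realized as the subalgebra
   of the quantized Weyl algebra that they generate. *)
Definition weyl_torus : Type := subalgebra torus_gen.
HB.instance Definition _ := PzAlgebra.on weyl_torus.

Section WeylModule.
Variable W : lmodType qWeyl.

Definition weyl_weight_space (I : set weyl_torus) : set W :=
  [set w | forall r, I r -> (subalg_val r : qWeyl) *: w = 0].

Definition weyl_completely_pointed : Prop :=
  pointed_decomposition (@is_maximal_ideal weyl_torus) weyl_weight_space.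

End WeylModule.
End Weyl.

Section NoncommutativeIdentities.
Variable (B : pzRingType).

Lemma commMl (a b z : B) : a * b = b * a -> a * (b * z) = b * (a * z).
Proof. by move=> e; rewrite !mulrA e. Qed.

Lemma serre_prod (a b c d t : B) :
  a * b = b * a -> a * c = c * a -> d * a = a * d -> d * b = b * d ->
  d * c = c * d ->
  b * b * c - t * (b * c * b) + c * b * b = 0 ->
  (b * a) ^+ 2 * (c * d) - t * (b * a * (c * d) * (b * a))
    + c * d * (b * a) ^+ 2 = 0.
Proof.
move=> ab ac da db dc core.
have R := (ab, ac, da, db, dc, fun z => commMl z ab, fun z => commMl z ac,
  fun z => commMl z da, fun z => commMl z db, fun z => commMl z dc).
rewrite -[RHS](mul0r (a * a * d)) -core !mulrDl mulNr !expr2 -!mulrA.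
by rewrite !R.
Qed.

Lemma serre_coreX (x y w s t : B) :
  s * t = 1 -> x * t = t * x ->
  y * x - t * (x * y) = w -> w * x = s * x * w ->
  x * x * y - (s + t) * (x * y * x) + y * x * x = 0.
Proof.
move=> st xt ew wx.
have -> : x * x * y - (s + t) * (x * y * x) + y * x * x = w * x - s * x * w.
  rewrite -ew mulrBl !mulrBr mulrDl -!mulrA (commMl _ xt).
  rewrite [s * (t * _)]mulrA st mul1r opprD opprB.
  set a := x * (x * y); set b := s * _; set c := t * _; set d := y * _.
  by rewrite [RHS]addrC !addrA [LHS]addrAC.
by rewrite wx subrr.
Qed.

Lemma serre_coreY (x y w s t : B) :
  s * t = 1 -> y * t = t * y ->
  y * x - t * (x * y) = w -> w * y = t * y * w ->
  y * y * x - (s + t) * (y * x * y) + x * y * y = 0.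
Proof.
move=> st yt ew wy.
have wy' : s * (w * y) = y * w by rewrite wy !mulrA st mul1r.
have -> : y * y * x - (s + t) * (y * x * y) + x * y * y = y * w - s * (w * y).
  rewrite -ew mulrBl !mulrBr mulrDl -!mulrA (commMl _ yt).
  rewrite [s * (t * _)]mulrA st mul1r opprD opprB.
  set a := y * (y * x); set b := s * _; set c := t * _; set d := x * _.
  by rewrite !addrA [a - b - c]addrAC [LHS]addrAC.
by rewrite wy' subrr.
Qed.

Lemma EF_core (xa xb ya yb va vb wa wb s p : B) :
  xa * xb = xb * xa -> ya * yb = yb * ya ->
  ya * xb = xb * ya -> yb * xa = xa * yb ->
  ya * xa - s * (xa * ya) = va -> yb * xb - s * (xb * yb) = vb ->
  p * (xa * ya) = wa - va -> p * (xb * yb) = wb - vb ->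
  (forall z, s * z = z * s) -> (forall z, p * z = z * p) ->
  p * (xa * yb * (xb * ya) - xb * ya * (xa * yb)) = wa * vb - va * wb.
Proof.
move=> xx yy ab ba ea eb pa pb sC pC.
have e1 : xa * yb * (xb * ya) = xa * ya * (yb * xb).
  by rewrite -!mulrA -ab !mulrA -[xa * ya * yb]mulrA yy !mulrA.
have e2 : xb * ya * (xa * yb) = ya * xa * (xb * yb).
  by rewrite -ab -!mulrA (commMl _ (esym xx)).
have e3 : xa * yb * (xb * ya) - xb * ya * (xa * yb) =
    xa * ya * vb - va * (xb * yb).
  rewrite e1 e2 -eb -ea mulrBr mulrBl opprB.
  rewrite [xa * ya * (s * _)]mulrA -sC -!mulrA addrA; congr (_ - _).
  by rewrite subrK.
rewrite e3 mulrBr [p * (va * _)]mulrA [p * va]pC -[va * p * _]mulrA pb.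
by rewrite [p * _]mulrA pa mulrBl mulrBr opprB addrA subrK.
Qed.

End NoncommutativeIdentities.

Section WeylToolbox.
Variables (F : fieldType) (q : F) (m : nat).
Hypothesis q_neq0 : q != 0.
Local Notation A := (qWeyl q m).
Local Notation rel := (@weyl_rel F q m).
Local Notation s := (scal q : A).
Local Notation t := (scal q^-1 : A).

Let projZ c x :
  presented_proj rel (c *: x) = scal c * presented_proj rel x.
Proof. by rewrite free_scaleE rmorphM. Qed.

Let projE := (projZ, rmorphB (presented_proj rel), rmorphM (presented_proj rel),
  rmorph1 (presented_proj rel)).

Lemma weylO_V (i : 'I_m) : weylO q i * weylOV q i = 1.
Proof. by have /presented_rel := WeylRel_OOV q i; rewrite !projE. Qed.

Lemma weylO_VO (i : 'I_m) : weylOV q i * weylO q i = 1.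
Proof. by have /presented_rel := WeylRel_OVO q i; rewrite !projE. Qed.

Lemma weylOO (i j : 'I_m) : weylO q i * weylO q j = weylO q j * weylO q i.
Proof. by have /presented_rel := WeylRel_OO q i j; rewrite !projE. Qed.

Lemma weylOX (i j : 'I_m) :
  weylO q i * weylX q j * weylOV q i = scal (q ^+ (i == j)) * weylX q j.
Proof. by have /presented_rel := WeylRel_OX q i j; rewrite !projE. Qed.

Lemma weylOY (i j : 'I_m) :
  weylO q i * weylY q j * weylOV q i = scal (q ^- (i == j)) * weylY q j.
Proof. by have /presented_rel := WeylRel_OY q i j; rewrite !projE. Qed.

Lemma weylXX (i j : 'I_m) : weylX q i * weylX q j = weylX q j * weylX q i.
Proof. by have /presented_rel := WeylRel_XX q i j; rewrite !projE. Qed.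

Lemma weylYY (i j : 'I_m) : weylY q i * weylY q j = weylY q j * weylY q i.
Proof. by have /presented_rel := WeylRel_YY q i j; rewrite !projE. Qed.

Lemma weylYX (i j : 'I_m) :
  i != j -> weylY q i * weylX q j = weylX q j * weylY q i.
Proof. by move=> /(WeylRel_YX q) /presented_rel; rewrite !projE. Qed.

Lemma weylYXV (i : 'I_m) :
  weylY q i * weylX q i - t * (weylX q i * weylY q i) = weylO q i.
Proof.
by have /presented_rel := WeylRel_YXV q i; rewrite rmorphB /= projZ !rmorphM.
Qed.

Lemma weylYXq (i : 'I_m) :
  weylY q i * weylX q i - s * (weylX q i * weylY q i) = weylOV q i.
Proof.
by have /presented_rel := WeylRel_YXq q i; rewrite rmorphB /= projZ !rmorphM.
Qed.

Let st : s * t = 1. Proof. by rewrite -rmorphM divff // rmorph1. Qed.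

Lemma weylO_X (i : 'I_m) : weylO q i * weylX q i = s * weylX q i * weylO q i.
Proof.
have := congr1 ( *%R^~ (weylO q i)) (weylOX i i).
by rewrite -!mulrA weylO_VO mulr1 eqxx expr1 => ->.
Qed.

Lemma weylO_Y (i : 'I_m) : weylO q i * weylY q i = t * weylY q i * weylO q i.
Proof.
have := congr1 ( *%R^~ (weylO q i)) (weylOY i i).
by rewrite -!mulrA weylO_VO mulr1 eqxx expr1 => ->.
Qed.

Let qtwoE : scal (qtwo q) = s + t :> A. Proof. by rewrite rmorphD. Qed.

Lemma weyl_coreX (i : 'I_m) (x := weylX q i) (y := weylY q i) :
  x * x * y - scal (qtwo q) * (x * y * x) + y * x * x = 0.
Proof.
rewrite qtwoE; apply: serre_coreX (weylYXV i) (weylO_X i); first exact: st.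
by rewrite scalC.
Qed.

Lemma weyl_coreY (i : 'I_m) (x := weylX q i) (y := weylY q i) :
  y * y * x - scal (qtwo q) * (y * x * y) + x * y * y = 0.
Proof.
rewrite qtwoE; apply: serre_coreY (weylYXV i) (weylO_Y i); first exact: st.
by rewrite scalC.
Qed.

Lemma weyl_swap (a b c d : 'I_m) : b != c -> d != a ->
  weylX q a * weylY q b * (weylX q c * weylY q d) =
  weylX q c * weylY q d * (weylX q a * weylY q b).
Proof.
move=> bc da; rewrite -!mulrA.
rewrite (commMl _ (weylYX bc)) (commMl _ (weylYX da)).
by rewrite (weylYY d b) (commMl _ (weylXX a c)).
Qed.

Hypothesis q2_neq1 : q ^+ 2 != 1.

Let qqV_neq0 : q - q^-1 != 0.
Proof.
rewrite subr_eq0; apply: contra q2_neq1 => /eqP e.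
by rewrite expr2 {2}e divff.
Qed.

Let weylXY_diff (i : 'I_m) :
  scal (q - q^-1) * (weylX q i * weylY q i) = weylO q i - weylOV q i.
Proof.
by rewrite -weylYXV -weylYXq rmorphB /= mulrBl opprB [RHS]addrC addrA subrK.
Qed.

Lemma weyl_EF (a b : 'I_m) : a != b ->
  weylX q a * weylY q b * (weylX q b * weylY q a)
    - weylX q b * weylY q a * (weylX q a * weylY q b) =
  scal (q - q^-1)^-1 *
    (weylO q a * weylOV q b - weylOV q a * weylO q b).
Proof.
move=> ab; have ba : b != a by rewrite eq_sym.
have e := EF_core (weylXX a b) (weylYY a b) (weylYX ab) (weylYX ba)
  (weylYXq a) (weylYXq b) (weylXY_diff a) (weylXY_diff b)
  (scalC q) (scalC (q - q^-1)).
by rewrite -e [RHS]mulrA -(rmorphM (@scal F A)) mulVf // rmorph1 mul1r.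
Qed.

Let qserre (u v : A) : A :=
  u ^+ 2 * v - scal (qtwo q) * (u * v * u) + v * u ^+ 2.

Lemma weyl_serreY (k a d : 'I_m) : k != a -> k != d -> a != d ->
  qserre (weylX q a * weylY q k) (weylX q k * weylY q d) = 0.
Proof.
move=> ka kd ad; rewrite /qserre -(weylYX ka) [in RHS]/=.
apply: serre_prod; rewrite ?weyl_coreY //; first 1 last.
- exact: weylXX.
- by rewrite weylYX // eq_sym.
- exact: weylYY.
- by rewrite weylYX // eq_sym.
- by rewrite weylYX.
Qed.

Lemma weyl_serreX (k a d : 'I_m) : k != a -> k != d -> a != d ->
  qserre (weylX q k * weylY q a) (weylX q d * weylY q k) = 0.
Proof.
move=> ka kd ad; rewrite /qserre -(weylYX kd).
apply: serre_prod; rewrite ?weyl_coreX //; first 1 last.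
- exact: weylYY.
- by rewrite weylYX.
- exact: weylXX.
- by rewrite weylYX.
- by rewrite weylYX // eq_sym.
Qed.

End WeylToolbox.

Section GlWeyl.
Variables (F : fieldType) (q : F) (n : nat).
Hypotheses (q_neq0 : q != 0) (q_nroot : not_root_of_unity q).
Local Notation A := (qWeyl q n.+1).

Definition gl_weyl_gen (g : glgen n) : A :=
  match g with
  | GlE i => weylX q (lo i) * weylY q (hi i)
  | GlF i => weylX q (hi i) * weylY q (lo i)
  | GlK j => weylO q j
  | GlKV j => weylOV q j
  end.

Lemma lo_neq_hi (i : 'I_n) : lo i != hi i.
Proof. by rewrite -val_eqE /= /bump /= neq_ltn add1n ltnSn. Qed.

Local Notation ev := (free_eval gl_weyl_gen).

Let evE := (free_evalZ gl_weyl_gen, free_eval_gen gl_weyl_gen).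

Let weylO_conjXY (j a b : 'I_n.+1) :
  weylO q j * (weylX q a * weylY q b) * weylOV q j =
  scal (q ^ ((j == a)%:Z - (j == b)%:Z)) * (weylX q a * weylY q b).
Proof.
have -> : weylO q j * (weylX q a * weylY q b) * weylOV q j =
    (weylO q j * weylX q a * weylOV q j) * (weylO q j * weylY q b * weylOV q j).
  by rewrite -!mulrA [weylOV q j * (weylO q j * _)]mulrA weylO_VO mul1r.
rewrite weylOX weylOY mulrA -[_ * weylX q a * _]mulrA -scalC !mulrA -rmorphM.
by rewrite expfzDr // exprnN.
Qed.

Let neqSE (i j : 'I_n) : (hi i == lo j) = (j == i.+1 :> nat).
Proof. by rewrite -val_eqE /= /bump /= add1n eq_sym. Qed.

Let eq_lo (i j : 'I_n) : (lo i == lo j) = (i == j).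
Proof. by rewrite -!val_eqE. Qed.

Let eq_hi (i j : 'I_n) : (hi i == hi j) = (i == j).
Proof. by rewrite -!val_eqE /= /bump /= !add1n. Qed.

Fact gl_weyl_rel l r : gl_rel q l r -> ev l = ev r.
Proof.
case=> {l r}.
- by move=> j; rewrite rmorphM /= rmorph1 !evE /= weylO_V.
- by move=> j; rewrite rmorphM /= rmorph1 !evE /= weylO_VO.
- by move=> i j; rewrite !rmorphM /= !evE /= weylOO.
- by move=> i j; rewrite !rmorphM /= !evE /= weylO_conjXY.
- by move=> i j; rewrite !rmorphM /= !evE /= weylO_conjXY opprB.
- move=> i j; rewrite free_evalZ !rmorphB !rmorphM /= !evE /=.
  case: (eqVneq i j) => [<-|ij].
    rewrite /= mulr1n rmorph1 mul1r weyl_EF ?lo_neq_hi //.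
    exact: q_nroot.
  rewrite /= mulr0n rmorph0 !mul0r weyl_swap ?subrr ?eq_hi ?eq_lo //.
  by rewrite eq_sym.
- move=> i j dij; rewrite !rmorphM /= !evE /= weyl_swap //.
    rewrite neqSE; apply: contraL dij => /eqP e.
    by rewrite /distant e ltnn ltnNge ltnW.
  rewrite neqSE; apply: contraL dij => /eqP e.
  by rewrite /distant e ltnn orbF ltnNge ltnW.
- move=> i j dij; rewrite !rmorphM /= !evE /= weyl_swap //.
    rewrite eq_sym neqSE; apply: contraL dij => /eqP e.
    by rewrite /distant e ltnn orbF ltnNge ltnW.
  rewrite eq_sym neqSE; apply: contraL dij => /eqP e.
  by rewrite /distant e ltnn ltnNge ltnW.
- move=> i j aij; rewrite rmorph0 rmorphD rmorphB /= free_evalZ.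
  rewrite !expr2 !rmorphM /= !evE /= -!expr2.
  case/orP: aij => /eqP e.
    have -> : lo j = hi i by apply/eqP; rewrite eq_sym neqSE e.
    apply: weyl_serreY => //; rewrite -?val_eqE /= /bump /= ?add1n ?e.
    + by rewrite gtn_eqF.
    + by rewrite ltn_eqF.
    + by rewrite ltn_eqF // ltnW.
  have -> : hi j = lo i by apply/eqP; rewrite neqSE e.
  apply: weyl_serreX => //; rewrite -?val_eqE /= /bump /= ?add1n ?e.
  + by rewrite ltn_eqF.
  + by rewrite gtn_eqF.
  + by rewrite gtn_eqF // ltnW.
- move=> i j aij; rewrite rmorph0 rmorphD rmorphB /= free_evalZ.
  rewrite !expr2 !rmorphM /= !evE /= -!expr2.
  case/orP: aij => /eqP e.
    have -> : lo j = hi i by apply/eqP; rewrite eq_sym neqSE e.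
    apply: weyl_serreX => //; rewrite -?val_eqE /= /bump /= ?add1n ?e.
    + by rewrite gtn_eqF.
    + by rewrite ltn_eqF.
    + by rewrite ltn_eqF // ltnW.
  have -> : hi j = lo i by apply/eqP; rewrite neqSE e.
  apply: weyl_serreY => //; rewrite -?val_eqE /= /bump /= ?add1n ?e.
  + by rewrite ltn_eqF.
  + by rewrite gtn_eqF.
  + by rewrite gtn_eqF // ltnW.
Qed.

(* The homomorphism pi; that q is nonzero and not a root of unity is used to
   check the relation for [E_i, F_i], through q - q^-1 != 0. *)
Definition gl_to_weyl : {rmorphism Uqgl q n -> A} := presented_lift gl_weyl_rel.

Lemma gl_to_weyl_scal c : gl_to_weyl (scal c) = scal c.
Proof. exact: presented_lift_scal. Qed.

Lemma gl_to_weylE i : gl_to_weyl (glE q i) = weylX q (lo i) * weylY q (hi i).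
Proof. exact: presented_lift_gen. Qed.

Lemma gl_to_weylF i : gl_to_weyl (glF q i) = weylX q (hi i) * weylY q (lo i).
Proof. exact: presented_lift_gen. Qed.

Lemma gl_to_weylK j : gl_to_weyl (glK q j) = weylO q j.
Proof. exact: presented_lift_gen. Qed.

Lemma gl_to_weylKV j : gl_to_weyl (glKV q j) = weylOV q j.
Proof. exact: presented_lift_gen. Qed.

End GlWeyl.

(* Main.v *)
Require Import Defs.
From HB Require Import structures.
From mathcomp Require Import all_boot all_order perm all_algebra.
From mathcomp Require Import boolp.
From mathcomp Require Import ring zify.

Set Implicit Arguments.
Unset Strict Implicit.
Unset Printing Implicit Defensive.

Import GRing.Theory.
Local Open Scope ring_scope.

(** The one-dimensional weight spaces of V are labelled by a set S of vectors k of
    coordinate sum zero in Z^(n+1), with basis vectors e_k, and V is described by the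
    scalars eps i k and phi i k by which E_i and F_i carry e_k to multiples of
    e_(k + alpha_i) and e_(k - alpha_i) ([weight_basis_exists]). Rescaling the basis
    changes these scalars but not their products along closed words; and because
    E_i F_j = F_j E_i for distinct i and j, the value of a closed word depends only
    on the eigenvalues of the operators F_i E_i and E_i F_i ([closed_value_eq]). So
    it is enough to find a module over the Weyl algebra with the same eigenvalues.
    They are recorded by the values c_i(k) of the Casimir elements of the n copies
    of the quantum sl_2 ([coef_pointed_system]).

    The heart of the proof is [pointed_system_weyl_type]: there are w_1, ..., w_(n+1)
    such that, with x = w_i q^(k_i) and y = w_(i+1) q^(k_(i+1)), the value of K_i on
    e_k is x / y and c_i(k) = q x y + (q x y)^-1, exactly as if omega_l acted on e_k
    as w_l q^(k_l). By irreducibility each E_i is either injective or locally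
    nilpotent, and so is each F_i ([injective_or_ends]).
    - If all of them are locally nilpotent, the strings of the quantum sl_2 show
      that S, suitably translated, is closed under moves that balance two
      coordinates. An unbounded set of this kind contains every vector of its
      coordinate sum ([unbounded_target]), and then strings would be infinite
      ([not_integrable]). So V would have finite dimension.
    - Otherwise, after exchanging the E with the F if needed, some E_i is injective.
      (For n = 1 it remains to solve quadratic equations, so let n > 1.) For a
      neighbour j of i, the Serre relations make c_j a combination of q^m and q^-m
      along the string of weights k + m alpha_i, and the relations between E_i, F_i, E_j, F_j force this
      combination to be t q^-m + t^-1 q^m, with c_i determined by the same t
      ([pair_value_exists]). A square root of t K_j / q fixes all the w_l. The
      formula for the other neighbour of i follows by comparing the two values of t
      ([model_left]), and it spreads along the diagram by [chain_step]: weights at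
      which it could fail are avoided by moving with generators whose action is
      already known.

    Given w, the Weyl algebra acts on the finitely supported functions on the set
    of weights that can be reached from 0 without crossing a zero of w_l - w_l^-1,
    each x_l and y_l being a weighted shift. This module W is irreducible and
    completely pointed ([weyl_irreducible], [weyl_module_pointed]). Since closed
    words have the same values in V and in W, mapping e_k to a suitable multiple of
    the weight vector k of W is an embedding. No nonzero coefficient of E_i or F_i
    on W joins S to its complement, so the weight vectors of W outside S span a
    complementary submodule ([embed_summand]). *)

(** * Weights *)

Section HyperbolicSums.
Variable F : fieldType.
Implicit Types x y : F.

(** With x = exp u these are 2 cosh u and 2 sinh u; [sh_mul] is the addition
    formula. *)
Definition ch x := x + x^-1.
Definition sh x := x - x^-1.

Lemma chV x : ch x^-1 = ch x.
Proof. by rewrite /ch invrK addrC. Qed.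

Lemma shV x : sh x^-1 = - sh x.
Proof. by rewrite /sh invrK opprB. Qed.

Lemma sh_mul x y : x != 0 -> y != 0 -> sh x * sh y = ch (x * y) - ch (x / y).
Proof. by move=> x0 y0; rewrite /sh /ch; field; apply/andP. Qed.

Lemma sh_eq0 x : x != 0 -> (sh x == 0) = (x ^+ 2 == 1).
Proof.
move=> x0; rewrite /sh subr_eq0 -(inj_eq (mulfI x0)) mulfV //.
Qed.

Lemma ch_inj x y : x != 0 -> y != 0 -> ch x = ch y -> x = y \/ x * y = 1.
Proof.
move=> x0 y0 e.
have : (x - y) * (x * y - 1) = 0.
  have -> : (x - y) * (x * y - 1) = x * y * (ch x - ch y).
    by rewrite /ch; field; apply/andP.
  by rewrite e subrr mulr0.
move/eqP; rewrite mulf_eq0 !subr_eq0 => /orP[/eqP|/eqP]; first by left.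
by right.
Qed.

End HyperbolicSums.

Section Lattice.
Variable n : nat.

(** The weights of the quantum gl_(n+1). The weights of an irreducible module over
    the quantum sl_(n+1) are indexed by vectors of coordinate sum zero, as
    translates of one of them. *)
Definition lattice := {ffun 'I_n.+1 -> int}.

(** The simple roots. *)
Definition alpha (i : 'I_n) : lattice :=
  [ffun l => (l == lo i)%:Z - (l == hi i)%:Z].

Lemma alpha_lo (i j : 'I_n) :
  alpha j (lo i) = (i == j :> nat)%:Z - (i == j.+1 :> nat)%:Z.
Proof. by rewrite ffunE -!val_eqE /= /bump /= add1n. Qed.

Lemma alpha_hi (i j : 'I_n) :
  alpha j (hi i) = (i.+1 == j :> nat)%:Z - (i == j :> nat)%:Z.
Proof. by rewrite ffunE -!val_eqE /= /bump /= !add1n eqSS. Qed.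

Lemma sum_alpha (i : 'I_n) : \sum_l alpha i l = 0.
Proof.
rewrite (eq_bigr (fun l => (l == lo i)%:Z - (l == hi i)%:Z)); last by move=> l _; rewrite ffunE.
rewrite sumrB (bigD1 (lo i)) //= eqxx big1 => [|l /negbTE->] //.
by rewrite (bigD1 (hi i)) //= eqxx big1 ?subrr // => l /negbTE->.
Qed.

End Lattice.

(** The eigenvalue of K_i on the translate by k of the weight lam, locked to
    be handled as one quantity rather than as a product. *)
HB.lock Definition wtK (F : fieldType) (q : F) (n : nat) (lam : 'I_n -> F)
  (i : 'I_n) (k : lattice n) : F := lam i * q ^ (k (lo i) - k (hi i)).

Section Weights.
Variables (F : fieldType) (q : F) (n : nat).
Hypotheses (q_neq0 : q != 0) (q_nroot : not_root_of_unity q).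
Local Notation L := (lattice n).

Lemma expz_eq1 (z : int) : q ^ z = 1 -> z = 0.
Proof.
case: z => [[|m]|m] // e; have /negP[] := q_nroot (ltn0Sn m).
- by apply/eqP.
- by rewrite -invr_eq1; apply/eqP.
Qed.

Lemma expz_inj : injective (fun z : int => q ^ z).
Proof.
move=> a b e; apply/eqP; rewrite -subr_eq0; apply/eqP/expz_eq1.
by rewrite expfzDr // e -expfzDr // subrr expr0z.
Qed.

Lemma expz_neq0 (z : int) : q ^ z != 0.
Proof. exact: expfz_neq0. Qed.

Lemma expq_eq1 m : (0 < m)%N -> (q ^+ m == 1) = false.
Proof. by move=> m0; apply/negbTE/q_nroot. Qed.

Lemma q2_neq1 : q ^+ 2 - 1 != 0.
Proof. by rewrite subr_eq0 expq_eq1. Qed.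

Lemma sh_q_neq0 : sh q != 0.
Proof. by rewrite sh_eq0 // expq_eq1. Qed.

Variable lam : 'I_n -> F.
Hypothesis lam_neq0 : forall i, lam i != 0.
Local Notation K := (wtK q lam).

Lemma wtK_neq0 i k : K i k != 0.
Proof. by rewrite wtK.unlock mulf_neq0 // expz_neq0. Qed.

Lemma wtKD i (k l : L) : K i (k + l) = q ^ (l (lo i) - l (hi i)) * K i k.
Proof.
rewrite wtK.unlock !ffunE mulrCA -expfzDr //; congr (_ * q ^ _).
by rewrite opprD addrACA addrC.
Qed.

Lemma wtK_alpha i k : K i (k + alpha i) = q ^+ 2 * K i k.
Proof.
by rewrite wtKD alpha_lo alpha_hi !eqxx (ltn_eqF (ltnSn i)) (gtn_eqF (ltnSn i)).
Qed.

Lemma wtK_adj i j k : adjacent i j -> K i (k + alpha j) = q^-1 * K i k.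
Proof.
move=> aij; rewrite wtKD alpha_lo alpha_hi; congr (_ * _).
have -> : (i == j :> nat)%:Z - (i == j.+1 :> nat)%:Z -
   ((i.+1 == j :> nat)%:Z - (i == j :> nat)%:Z) = - 1.
  by case/orP: aij => /eqP; lia.
by rewrite exprN1.
Qed.

Lemma wtK_far i j k : distant i j -> K i (k + alpha j) = K i k.
Proof.
move=> dij; rewrite wtKD alpha_lo alpha_hi.
have -> : (i == j :> nat)%:Z - (i == j.+1 :> nat)%:Z -
   ((i.+1 == j :> nat)%:Z - (i == j :> nat)%:Z) = 0.
  by move: dij; rewrite /distant; lia.
by rewrite expr0z mul1r.
Qed.

End Weights.

Lemma adjacentC n (i j : 'I_n) : adjacent i j = adjacent j i.
Proof. by rewrite /adjacent orbC. Qed.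

Lemma distantC n (i j : 'I_n) : distant i j = distant j i.
Proof. by rewrite /distant orbC. Qed.

Lemma index_cases n (i j : 'I_n) : [\/ i = j, adjacent i j | distant i j].
Proof.
case: (eqVneq i j) => [->|/eqP ij]; first by constructor 1.
have /eqP ij' : i <> j :> nat by move/val_inj.
case a: (adjacent i j); first by constructor 2.
constructor 3; move: a ij'; rewrite /adjacent /distant; lia.
Qed.

Lemma adjacent_neq n (i j : 'I_n) : adjacent i j -> i != j.
Proof. by move=> a; apply: contraL a => /eqP->; rewrite /adjacent; lia. Qed.

(** * Systems of Casimir values *)

Section PointedSystems.
Variables (F : fieldType) (q : F) (n : nat).
Local Notation L := (lattice n).

Definition raise_coef lam (c : 'I_n -> L -> F) i k := c i k - ch (q * wtK q lam i k).
Definition lower_coef lam (c : 'I_n -> L -> F) i k := c i k - ch (wtK q lam i k / q).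

(** The element (q - q^-1)^2 F_i E_i + q K_i + (q K_i)^-1 is the Casimir element of
    the i-th quantum sl_2; on a one-dimensional weight space k it is a scalar
    c i k. Then raise_coef and lower_coef are the values of (q - q^-1)^2 F_i E_i and
    (q - q^-1)^2 E_i F_i there. Each axiom is the trace of a relation on these
    scalars: [ps_up], [ps_dn] of centrality in the quantum sl_2, [ps_far] and
    [ps_serre] of the commutation and Serre relations between the E_i, [ps_square]
    and [ps_mixed] of E_i F_j = F_j E_i, and [ps_conn] of irreducibility. *)
Record pointed_system (lam : 'I_n -> F) (S : L -> Prop) (c : 'I_n -> L -> F) :
    Prop := PointedSystem {
  ps_lam : forall i, lam i != 0;
  ps_up : forall i k, S k -> raise_coef lam c i k != 0 ->
    S (k + alpha i) /\ c i (k + alpha i) = c i k;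
  ps_dn : forall i k, S k -> lower_coef lam c i k != 0 ->
    S (k - alpha i) /\ c i (k - alpha i) = c i k;
  ps_far : forall i j k, distant i j -> S k -> raise_coef lam c i k != 0 ->
    c j (k + alpha i) = c j k;
  ps_serre : forall i j k, adjacent i j -> S k -> raise_coef lam c i k != 0 ->
    raise_coef lam c i (k + alpha i) != 0 ->
    c j k - qtwo q * c j (k + alpha i) + c j (k + alpha i + alpha i) = 0;
  ps_square : forall i j k, adjacent i j -> S k -> raise_coef lam c i k != 0 ->
    raise_coef lam c j k != 0 ->
    raise_coef lam c i k * raise_coef lam c j k =
      raise_coef lam c i (k + alpha j) * raise_coef lam c j (k + alpha i);
  ps_mixed : forall i j k, i != j -> S k ->
    (lower_coef lam c j k != 0 /\ raise_coef lam c i (k - alpha j) != 0) <->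
    (raise_coef lam c i k != 0 /\ lower_coef lam c j (k + alpha i) != 0);
  ps_conn : forall (P : L -> Prop) k0, S k0 -> P k0 ->
    (forall i k, S k -> P k -> raise_coef lam c i k != 0 -> P (k + alpha i)) ->
    (forall i k, S k -> P k -> lower_coef lam c i k != 0 -> P (k - alpha i)) ->
    forall k, S k -> P k
}.

End PointedSystems.

Section PointedSystemTheory.
Variables (F : fieldType) (q : F) (n : nat).
Hypotheses (q_neq0 : q != 0) (q_nroot : not_root_of_unity q).
Local Notation L := (lattice n).
Variables (lam : 'I_n -> F) (S : L -> Prop) (c : 'I_n -> L -> F).
Hypothesis H : pointed_system q lam S c.
Local Notation K := (wtK q lam).
Local Notation up := (raise_coef q lam c).
Local Notation dn := (lower_coef q lam c).
Implicit Types (i j l : 'I_n) (k : L).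

Let K_neq0 i k : K i k != 0.
Proof. exact/wtK_neq0/(ps_lam H). Qed.

Lemma wtK_alphaB i k : K i (k - alpha i) = q ^- 2 * K i k.
Proof. by rewrite -{2}(subrK (alpha i) k) wtK_alpha // mulKf // expf_neq0. Qed.

Lemma dn_up i k : S k -> up i k != 0 -> dn i (k + alpha i) = up i k.
Proof.
move=> Sk u; rewrite /lower_coef (ps_up H Sk u).2 /raise_coef wtK_alpha //; congr (_ - ch _).
by field.
Qed.

Lemma up_dn i k : S k -> dn i k != 0 -> up i (k - alpha i) = dn i k.
Proof.
move=> Sk u; rewrite /raise_coef (ps_dn H Sk u).2 /lower_coef wtK_alphaB; congr (_ - ch _).
by field.
Qed.

Lemma S_up i k : S k -> up i k != 0 -> S (k + alpha i).
Proof. by move=> Sk u; case: (ps_up H Sk u). Qed.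

Lemma S_dn i k : S k -> dn i k != 0 -> S (k - alpha i).
Proof. by move=> Sk u; case: (ps_dn H Sk u). Qed.

Lemma up_adj i j k : adjacent i j -> S k -> up i k != 0 -> up j k != 0 ->
  up i (k + alpha j) != 0.
Proof.
move=> a Sk ui uj; have := mulf_neq0 ui uj.
by rewrite (ps_square H a Sk ui uj) mulf_eq0 => /norP[].
Qed.

Lemma up_far i j k : distant i j -> S k -> up i k != 0 ->
  up j (k + alpha i) = up j k.
Proof.
by move=> d Sk u; rewrite /raise_coef (ps_far H d Sk u) wtK_far // distantC.
Qed.

(** The shifted weights of K_j along alpha_i obey the same recursion as c_j. *)
Lemma up_serre i j k : adjacent i j -> S k -> up i k != 0 ->
  up i (k + alpha i) != 0 ->
  up j k - qtwo q * up j (k + alpha i) + up j (k + alpha i + alpha i) = 0.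
Proof.
move=> a Sk u u'; have := ps_serre H a Sk u u'; rewrite /raise_coef.
rewrite !(@wtK_adj _ _ _ q_neq0 _ j i) 1?adjacentC //.
move=> e.
have -> : c j k = qtwo q * c j (k + alpha i) - c j (k + alpha i + alpha i).
  by apply/eqP; rewrite -subr_eq0 -e; apply/eqP; ring.
rewrite /qtwo /ch; have := K_neq0 j k; move: (K j k) => x x0.
by field; rewrite x0 q_neq0.
Qed.

End PointedSystemTheory.

(** * Symmetries, and injective or locally nilpotent generators *)

Section Symmetries.
Variables (F : fieldType) (q : F) (n : nat).
Hypotheses (q_neq0 : q != 0) (q_nroot : not_root_of_unity q).
Local Notation L := (lattice n).
Variables (lam : 'I_n -> F) (S : L -> Prop) (c : 'I_n -> L -> F).
Hypothesis H : pointed_system q lam S c.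
Local Notation up := (raise_coef q lam c).
Local Notation dn := (lower_coef q lam c).
Let upE := up_dn q_neq0 H.

Lemma dn_far i j k : distant i j -> S k -> dn i k != 0 ->
  c j (k - alpha i) = c j k.
Proof.
move=> d Sk u; have Sk' := S_dn H Sk u.
by rewrite -(ps_far H d Sk') ?subrK ?upE.
Qed.

Lemma dn_serre i j k : adjacent i j -> S k -> dn i k != 0 ->
  dn i (k - alpha i) != 0 ->
  c j k - qtwo q * c j (k - alpha i) + c j (k - alpha i - alpha i) = 0.
Proof.
move=> a Sk u u'; have Sk' := S_dn H Sk u; have Sk2 := S_dn H Sk' u'.
have := ps_serre H a Sk2; rewrite !subrK !upE // => <- //; ring.
Qed.

(** The square for E_i, E_j, read from its opposite corner; [ps_mixed] provides the
    missing edges. *)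
Lemma dn_square i j k : adjacent i j -> S k -> dn i k != 0 -> dn j k != 0 ->
  dn i k * dn j k = dn i (k - alpha j) * dn j (k - alpha i).
Proof.
move=> a Sk di dj; have ij := adjacent_neq a.
have Si := S_dn H Sk di; have Sj := S_dn H Sk dj.
have [dj' ui'] : dn j (k - alpha i) != 0 /\ up i (k - alpha i - alpha j) != 0.
  by apply/(ps_mixed H ij Si); rewrite subrK upE.
have [di' uj'] : dn i (k - alpha j) != 0 /\ up j (k - alpha j - alpha i) != 0.
  by apply/(ps_mixed H _ Sj); rewrite ?subrK ?upE // eq_sym.
have Sl := S_dn H Si dj'; rewrite addrAC in uj'.
have := ps_square H a Sl ui' uj'.
rewrite subrK [k - alpha i - alpha j]addrAC subrK !upE // => <-.
by rewrite [k - alpha j - alpha i]addrAC upE // mulrC.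
Qed.

(** The symmetry exchanging E_i and F_i, which negates weights. *)
Definition swap_lam (i : 'I_n) := (lam i)^-1.
Definition swap_S (k : L) := S (- k).
Definition swap_c (i : 'I_n) (k : L) := c i (- k).

Lemma swap_K i k : wtK q swap_lam i k = (wtK q lam i (- k))^-1.
Proof. by rewrite wtK.unlock /swap_lam invfM !ffunE -opprD -invr_expz invrK. Qed.

Lemma swap_up i k : raise_coef q swap_lam swap_c i k = dn i (- k).
Proof. by rewrite /raise_coef /lower_coef swap_K -[in LHS]chV invfM invrK mulrC. Qed.

Lemma swap_dn i k : lower_coef q swap_lam swap_c i k = up i (- k).
Proof. by rewrite /raise_coef /lower_coef swap_K -[in LHS]chV invfM !invrK mulrC. Qed.

Let opp_dn (k : L) i : - (k + alpha i) = - k - alpha i.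
Proof. by rewrite opprD. Qed.
Let opp_up (k : L) i : - (k - alpha i) = - k + alpha i.
Proof. by rewrite opprB addrC. Qed.

Lemma swap_system : pointed_system q swap_lam swap_S swap_c.
Proof.
split; rewrite /swap_S.
- by move=> i; rewrite invr_neq0 // (ps_lam H).
- by move=> i k; rewrite swap_up /swap_c opp_dn; apply: (ps_dn H).
- by move=> i k; rewrite swap_dn /swap_c opp_up; apply: (ps_up H).
- by move=> i j k; rewrite swap_up /swap_c opp_dn; apply: dn_far.
- by move=> i j k; rewrite !swap_up /swap_c !opp_dn; apply: dn_serre.
- by move=> i j k; rewrite !swap_up !opp_dn; apply: dn_square.
- move=> i j k ij Sk; rewrite !swap_up !swap_dn opp_up opp_dn.
  by apply: iff_sym; apply: (ps_mixed H); rewrite 1?eq_sym.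
- move=> P k0 S0 P0 Pu Pd k Sk; rewrite -[k]opprK.
  apply: (ps_conn H (P := fun k => P (- k)) S0) Sk; first by rewrite opprK.
    move=> i l Sl Pl u; rewrite opp_dn; apply: Pd => //; first by rewrite opprK.
    by rewrite swap_dn opprK.
  move=> i l Sl Pl u; rewrite opp_up; apply: Pu => //; first by rewrite opprK.
  by rewrite swap_up opprK.
Qed.

(** The symmetry of the Dynkin diagram, which reverses the order of the indices. *)
Definition flip (k : L) : L := [ffun l => - k (rev_ord l)].
Definition flip_lam (i : 'I_n) := lam (rev_ord i).
Definition flip_S (k : L) := S (flip k).
Definition flip_c (i : 'I_n) (k : L) := c (rev_ord i) (flip k).

Lemma flipK : involutive flip.
Proof. by move=> k; apply/ffunP=> l; rewrite !ffunE rev_ordK opprK. Qed.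

Lemma rev_lo (i : 'I_n) : rev_ord (lo i) = hi (rev_ord i).
Proof. by apply/val_inj; rewrite /= /bump /= add1n subSS subnSK. Qed.

Lemma rev_hi (i : 'I_n) : rev_ord (hi i) = lo (rev_ord i).
Proof. by apply/val_inj; rewrite /= /bump /= add1n subSS. Qed.

Lemma flipD k l : flip (k + l) = flip k + flip l.
Proof. by apply/ffunP=> x; rewrite !ffunE opprD. Qed.

Lemma flipN k : flip (- k) = - flip k.
Proof. by apply/ffunP=> x; rewrite !ffunE. Qed.

Lemma flip_alpha (i : 'I_n) : flip (alpha i) = alpha (rev_ord i).
Proof.
have E (l x : 'I_n.+1) : (rev_ord l == x) = (l == rev_ord x).
  by rewrite -(inj_eq rev_ord_inj) rev_ordK.
by apply/ffunP=> l; rewrite !ffunE opprB !E rev_lo rev_hi.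
Qed.

Lemma flip_K i k : wtK q flip_lam i k = wtK q lam (rev_ord i) (flip k).
Proof.
rewrite wtK.unlock /flip_lam !ffunE -rev_hi -rev_lo !rev_ordK opprK.
by rewrite [- _ + _]addrC.
Qed.

Lemma flip_up i k : raise_coef q flip_lam flip_c i k = up (rev_ord i) (flip k).
Proof. by rewrite /raise_coef flip_K. Qed.

Lemma flip_dn i k : lower_coef q flip_lam flip_c i k = dn (rev_ord i) (flip k).
Proof. by rewrite /lower_coef flip_K. Qed.

Lemma adjacent_rev (i j : 'I_n) :
  adjacent (rev_ord i) (rev_ord j) = adjacent i j.
Proof.
rewrite /adjacent /=; have := ltn_ord i; have := ltn_ord j; lia.
Qed.

Lemma distant_rev (i j : 'I_n) :
  distant (rev_ord i) (rev_ord j) = distant i j.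
Proof.
rewrite /distant /=; have := ltn_ord i; have := ltn_ord j; lia.
Qed.

Let flip_add k i : flip (k + alpha i) = flip k + alpha (rev_ord i).
Proof. by rewrite flipD flip_alpha. Qed.
Let flip_sub k i : flip (k - alpha i) = flip k - alpha (rev_ord i).
Proof. by rewrite flipD flipN flip_alpha. Qed.

Lemma flip_system : pointed_system q flip_lam flip_S flip_c.
Proof.
have E := (flip_up, flip_dn, flip_add, flip_sub).
split; rewrite /flip_S /flip_c.
- by move=> i; apply: (ps_lam H).
- by move=> i k; rewrite !E; apply: (ps_up H).
- by move=> i k; rewrite !E; apply: (ps_dn H).
- by move=> i j k; rewrite !E -distant_rev; apply: (ps_far H).
- by move=> i j k; rewrite !E -adjacent_rev; apply: (ps_serre H).
- by move=> i j k; rewrite !E -adjacent_rev; apply: (ps_square H).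
- move=> i j k; rewrite !E => ij; apply: (ps_mixed H).
  by rewrite (inj_eq rev_ord_inj).
- move=> P k0 S0 P0 Pu Pd k Sk; rewrite -[k]flipK.
  apply: (ps_conn H (P := fun k => P (flip k)) S0) Sk; first by rewrite flipK.
    move=> i l Sl Pl u; rewrite -[i]rev_ordK -flip_alpha -[l]flipK -flipD !flipK.
    by apply: Pu; rewrite ?flip_up ?flipK ?rev_ordK.
  move=> i l Sl Pl u; rewrite flipD flipN flip_alpha.
  by apply: Pd; rewrite ?flip_dn ?flipK ?rev_ordK.
Qed.

End Symmetries.

Section Dichotomy.
Variables (F : fieldType) (q : F) (n : nat).
Hypotheses (q_neq0 : q != 0) (q_nroot : not_root_of_unity q).
Local Notation L := (lattice n).
Variables (lam : 'I_n -> F) (S : L -> Prop) (c : 'I_n -> L -> F).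
Hypothesis H : pointed_system q lam S c.
Local Notation up := (raise_coef q lam c).
Local Notation dn := (lower_coef q lam c).

Definition ends_at i k := exists m, up i (k + alpha i *+ m) = 0.

Let shiftS i k m : k + alpha i *+ m.+1 = k + alpha i + alpha i *+ m :> L.
Proof. by rewrite mulrS addrA. Qed.

(** Here v of weight k has E_i v = 0 and E_j v != 0, so F_j kills E_i E_j v and
    E_i E_i E_j v; but then the recursion for c_j fails along alpha_i. *)
Lemma ends_adj i j k : adjacent i j -> S k -> up j k != 0 -> up i k = 0 ->
  ends_at i (k + alpha j).
Proof.
move=> a Sk uj ui; set k' := k + alpha j; have Sk' := S_up H Sk uj.
case: (eqVneq (up i k') 0) => [e|u0]; first by exists 0%N; rewrite addr0.
case: (eqVneq (up i (k' + alpha i)) 0) => [e|u1]; first by exists 1%N.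
have ij := adjacent_neq a.
have Sp := S_up H Sk' u0; have Sp2 := S_up H Sp u1.
have d0 : dn j (k' + alpha i) = 0.
  apply/eqP; apply: contraT => d.
  have [_] := proj2 (ps_mixed H ij Sk') (conj u0 d).
  by rewrite /k' addrK ui eqxx.
have d1 : dn j (k' + alpha i + alpha i) = 0.
  apply/eqP; apply: contraT => d.
  by have [] := proj2 (ps_mixed H ij Sp) (conj u1 d); rewrite d0 eqxx.
have dk : dn j k' != 0 by rewrite (dn_up q_neq0 H).
have := ps_serre H a Sk' u0 u1; move: dk d0 d1; rewrite /lower_coef.
rewrite !(@wtK_adj _ _ _ q_neq0 _ j i) 1?adjacentC //.
move=> dk /eqP; rewrite subr_eq0 => /eqP -> /eqP; rewrite subr_eq0 => /eqP ->.
move=> e; case/negP: dk; rewrite subr_eq0 -subr_eq0 -e; apply/eqP.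
have := wtK_neq0 q_neq0 (ps_lam H) j k'; rewrite /ch /qtwo.
by move: (wtK q lam j k') => x x0; field; rewrite x0 q_neq0.
Qed.

Lemma ends_up i j k : S k -> up j k != 0 -> ends_at i k ->
  ends_at i (k + alpha j).
Proof.
case: (index_cases i j) => [<-|a|d] Sk uj [m e].
- case: m e => [|m] e; first by rewrite addr0 in e; rewrite e eqxx in uj.
  by exists m; rewrite -shiftS.
- elim: m k Sk uj e => [|m IH] k Sk uj e.
    by apply: ends_adj => //; rewrite addr0 in e.
  case: (eqVneq (up i k) 0) => [|ui]; first exact: ends_adj.
  rewrite shiftS in e; rewrite adjacentC in a.
  have [m' e'] := IH _ (S_up H Sk ui) (up_adj H a Sk uj ui) e.
  by exists m'.+1; rewrite shiftS [k + _ + _]addrAC.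
- elim: m k Sk uj e => [|m IH] k Sk uj e.
    exists 0%N; rewrite !addr0 in e *.
    by rewrite (up_far q_neq0 H _ Sk uj) // distantC.
  case: (eqVneq (up i k) 0) => [e0|ui].
    by exists 0%N; rewrite addr0 (up_far q_neq0 H _ Sk uj) // distantC.
  rewrite shiftS in e; have uj' : up j (k + alpha i) != 0.
    by rewrite (up_far q_neq0 H).
  have [m' e'] := IH _ (S_up H Sk ui) uj' e.
  by exists m'.+1; rewrite shiftS [k + _ + _]addrAC.
Qed.

Lemma ends_dn i j k : S k -> dn j k != 0 -> ends_at i k ->
  ends_at i (k - alpha j).
Proof.
case: (eqVneq i j) => [<-|ij] Sk dj [m e].
  by exists m.+1; rewrite shiftS subrK.
elim: m k Sk dj e => [|m IH] k Sk dj e.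
  case: (eqVneq (up i (k - alpha j)) 0) => [e0|u0].
    by exists 0%N; rewrite addr0.
  have [] := proj1 (ps_mixed H ij Sk) (conj dj u0).
  by rewrite addr0 in e; rewrite e eqxx.
case: (eqVneq (up i (k - alpha j)) 0) => [e0|u0].
  by exists 0%N; rewrite addr0.
have [ui dj'] := proj1 (ps_mixed H ij Sk) (conj dj u0).
rewrite shiftS in e; have [m' e'] := IH _ (S_up H Sk ui) dj' e.
by exists m'.+1; rewrite shiftS [k - _ + _]addrAC.
Qed.

(** The vectors on which E_i acts nilpotently form a submodule. *)
Lemma injective_or_ends i :
  (forall k, S k -> up i k != 0) \/ (forall k, S k -> ends_at i k).
Proof.
case: (pselect (exists2 k0, S k0 & up i k0 = 0)) => [[k0 S0 e0]|no].
  right; apply: (ps_conn H S0); first by exists 0%N; rewrite addr0.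
    by move=> j k Sk Pk u; apply: ends_up.
  by move=> j k Sk Pk u; apply: ends_dn.
by left=> k Sk; apply/negP => /eqP e; apply: no; exists k.
Qed.

End Dichotomy.

(** * Identities for a pair of adjacent indices *)

Ltac field_nz := field; repeat (apply/andP; split);
  rewrite // ?expf_neq0 ?mulf_neq0 ?invr_neq0 ?oppr_eq0 ?oner_neq0 //.

Section PairAlgebra.
Variables (F : fieldType) (q : F).
Hypotheses (q_neq0 : q != 0) (q2 : q ^+ 2 - 1 != 0).

Let qV : q - q^-1 != 0.
Proof.
apply: contra q2 => /eqP e; have -> : q ^+ 2 - 1 = q * (q - q^-1).
  by rewrite mulrBr divff.
by rewrite e mulr0.
Qed.

Lemma recursion_solution (s : nat -> F) :
  (forall m, s m - qtwo q * s m.+1 + s m.+2 = 0) ->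
  exists A B, forall m, s m = A * q ^- m + B * q ^+ m.
Proof.
move=> rec; pose A := (q * s 0 - s 1%N) / (q - q^-1).
pose B := (s 1%N - s 0 / q) / (q - q^-1).
have s2 m : s m.+2 = qtwo q * s m.+1 - s m.
  by apply/eqP; rewrite -subr_eq0 -(rec m); apply/eqP; ring.
exists A, B; suff both m : s m = A * q ^- m + B * q ^+ m /\
  s m.+1 = A * q ^- m.+1 + B * q ^+ m.+1 by move=> m; case: (both m).
elim: m => [|m [IH0 IH1]].
  by split; rewrite /A /B ?expr0 ?expr1; field_nz.
split=> //; rewrite s2 IH1 IH0 /qtwo !exprSr; field_nz.
Qed.

Lemma sequence_coefs A B A' B' : A + B = A' + B' ->
  A / q + B * q = A' / q + B' * q -> A = A' /\ B = B'.
Proof.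
move=> e0 e1; have BE : B = B'.
  apply: (mulIf qV); apply/eqP; rewrite -subr_eq0; apply/eqP.
  transitivity (A / q + B * q - (A' / q + B' * q) - (A + B - (A' + B')) / q).
    by field_nz.
  by rewrite e0 e1 !subrr mul0r subr0.
by split=> //; apply: (addIr B); rewrite e0 BE.
Qed.

Lemma ch_step_inj x y : x != 0 -> y != 0 -> ch x = ch y ->
  ch (x / q) = ch (y / q) -> x = y.
Proof.
move=> x0 y0 e; case: (ch_inj x0 y0 e) => // xy e'.
have xE : x = y^-1 by apply: (mulIf y0); rewrite xy mulVf.
have : (q - q^-1) * (y - y^-1) = 0.
  have -> : (q - q^-1) * (y - y^-1) = ch (x / q) - ch (y / q).
    by rewrite xE /ch; field_nz.
  by rewrite e' subrr.
by move=> /eqP; rewrite mulf_eq0 (negbTE qV) subr_eq0 /= xE => /eqP.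
Qed.

(** Here x and y are the values of K_i and K_j, c is c_i and c' is c_i translated by
    alpha_j, and c_j = A q^-m + B q^m along the alpha_i-string, so that
    A' q^-m + B' q^m is the value of (q - q^-1)^2 F_j E_j. The two hypotheses are the
    square relations at m = 0 and m = 1; they are linear in c and c'. *)
Lemma pair_algebra c c' x y A B (A' := A - q * y) (B' := B - (q * y)^-1) :
  x != 0 -> y != 0 -> A' + B' != 0 ->
  (c - ch (q * x)) * (A' + B') = (c' - ch x) * (A' / q + q * B') ->
  (c - ch (q * (q ^+ 2 * x))) * (A' / q + q * B') =
    (c' - ch (q ^+ 2 * x)) * (A' / q ^+ 2 + q ^+ 2 * B') ->
  exists T, [/\ T != 0, A' = - T * q ^+ 2 * B', c = ch (q * x * T) &
    c' = ch (q ^+ 2 * x * T)].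
Proof.
move: A' B' => A' B' x0 y0 AB e0 e1.
pose E0 := (c - ch (q * x)) * (A' + B') - (c' - ch x) * (A' / q + q * B').
pose E1 := (c - ch (q * (q ^+ 2 * x))) * (A' / q + q * B') -
  (c' - ch (q ^+ 2 * x)) * (A' / q ^+ 2 + q ^+ 2 * B').
have E00 : E0 = 0 by rewrite /E0 e0 subrr.
have E10 : E1 = 0 by rewrite /E1 e1 subrr.
have al : c * B' - q * x * A' - (q * c' * B' - x * A' / q) = 0.
  apply: (mulIf qV); rewrite mul0r; transitivity (E1 - E0 / q).
    by rewrite /E0 /E1 /ch; field_nz.
  by rewrite E00 E10 mul0r subrr.
have be : c * A' - B' / (q * x) - (c' * A' / q - q * B' / x) = 0.
  apply: (mulIf qV); rewrite mul0r; transitivity (q * E0 - E1).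
    by rewrite /E0 /E1 /ch; field_nz.
  by rewrite E00 E10 mulr0 subrr.
have B0 : B' != 0.
  apply/eqP=> B0; move: al AB; rewrite B0 addr0 => al /eqP; apply.
  apply: (mulIf (mulf_neq0 x0 qV)); rewrite mul0r -oppr0 -al; field_nz.
have A0 : A' != 0.
  apply/eqP=> A0; move: be AB; rewrite A0 add0r => be /eqP; apply.
  apply: (mulIf (mulf_neq0 (invr_neq0 x0) qV)); rewrite mul0r -be; field_nz.
pose T := - A' / (q ^+ 2 * B').
have T0 : T != 0 by rewrite mulf_neq0 ?oppr_eq0 ?invr_neq0 ?mulf_neq0 ?expf_neq0.
have AE : A' = - T * q ^+ 2 * B' by rewrite /T; field_nz.
clearbody T; clear E0 E1 E00 E10.
have c'E : c' = ch (q ^+ 2 * x * T).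
  apply/eqP; rewrite -subr_eq0; apply/eqP/(mulIf qV); rewrite mul0r.
  transitivity ((c * A' - B' / (q * x) - (c' * A' / q - q * B' / x)) / A' -
     (c * B' - q * x * A' - (q * c' * B' - x * A' / q)) / B').
    by rewrite AE /ch; field_nz.
  by rewrite al be !mul0r subrr.
exists T; split=> //; apply/eqP; rewrite -subr_eq0; apply/eqP/(mulIf B0).
rewrite mul0r -al AE c'E /ch; field_nz.
Qed.

(** The two linear equations are the value of T at a weight and at its
    translate, where T is multiplied by q^2. *)
Lemma pair_solution y A B T : y != 0 -> T != 0 ->
  A - q * y = - T * q ^+ 2 * (B - (q * y)^-1) ->
  A - q * (q ^+ 2 * y) =
    - (q ^+ 2 * T) * q ^+ 2 * (B - (q * (q ^+ 2 * y))^-1) ->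
  A = q * T / y /\ B = (q * T / y)^-1.
Proof.
move=> y0 T0 e e'.
have BE : B = (q * T / y)^-1.
  apply: (mulIf (mulf_neq0 (mulf_neq0 T0 (expf_neq0 2 q_neq0)) q2)).
  apply/eqP; rewrite -subr_eq0; apply/eqP.
  transitivity (A - q * (q ^+ 2 * y) + q ^+ 2 * T * q ^+ 2 *
      (B - (q * (q ^+ 2 * y))^-1) - (A - q * y + T * q ^+ 2 * (B - (q * y)^-1))).
    by field_nz.
  by rewrite e e' !mulNr !addNr subrr.
split=> //; apply/eqP; rewrite -subr_eq0; apply/eqP.
transitivity (A - q * y + T * q ^+ 2 * (B - (q * y)^-1)).
  by rewrite BE; field_nz.
by rewrite e !mulNr addNr.
Qed.

Lemma pair_solution_top y A B : y != 0 ->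
  A + B = ch (q ^+ 3 * y) -> A / q + B * q = ch (q ^+ 2 * y) ->
  A = q ^+ 3 * y /\ B = (q ^+ 3 * y)^-1.
Proof.
move=> y0 e e'; apply: sequence_coefs; rewrite ?e ?e' /ch //; field_nz.
Qed.

End PairAlgebra.

(** * An injective generator and its neighbours *)

Section InjectivePair.
Variables (F : fieldType) (q : F) (n : nat).
Hypotheses (q_neq0 : q != 0) (q_nroot : not_root_of_unity q).
Local Notation L := (lattice n).
Variables (lam : 'I_n -> F) (S : L -> Prop) (c : 'I_n -> L -> F).
Hypothesis H : pointed_system q lam S c.
Local Notation K := (wtK q lam).
Local Notation up := (raise_coef q lam c).
Local Notation dn := (lower_coef q lam c).
Variables (i j : 'I_n).
Hypothesis ij : adjacent i j.
Hypothesis inj : forall k, S k -> up i k != 0.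

Let ji : adjacent j i. Proof. by rewrite adjacentC. Qed.
Let q2 := q2_neq1 q_nroot.
Let K_neq0 l k : K l k != 0.
Proof. exact/wtK_neq0/(ps_lam H). Qed.
Let qm m : q ^+ m != 0. Proof. exact: expf_neq0. Qed.

Let shiftS k m : k + alpha i *+ m.+1 = k + alpha i + alpha i *+ m :> L.
Proof. by rewrite mulrS addrA. Qed.
Let shiftSr k m : k + alpha i *+ m.+1 = k + alpha i *+ m + alpha i :> L.
Proof. by rewrite mulrSr addrA. Qed.

Lemma inj_S m k : S k -> S (k + alpha i *+ m).
Proof.
elim: m => [|m IH] Sk; first by rewrite addr0.
by rewrite shiftSr; apply: (S_up H) => //; [apply: IH | apply/inj/IH].
Qed.

Lemma inj_Si k : S k -> S (k + alpha i).
Proof. by move=> Sk; apply: (S_up H) => //; apply: inj. Qed.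

Lemma inj_c m k : S k -> c i (k + alpha i *+ m) = c i k.
Proof.
move=> Sk; elim: m => [|m IH]; first by rewrite addr0.
by rewrite shiftSr (ps_up H _ (inj (inj_S m Sk))).2 //; apply: inj_S.
Qed.

Lemma inj_Kj m k : K j (k + alpha i *+ m) = q ^- m * K j k.
Proof.
elim: m => [|m IH]; first by rewrite addr0 expr0 invr1 mul1r.
by rewrite shiftSr wtK_adj // IH mulrA exprS invfM.
Qed.

Lemma inj_up_adj m k : S k -> up j k != 0 -> up j (k + alpha i *+ m) != 0.
Proof.
move=> Sk u; elim: m => [|m IH]; first by rewrite addr0.
by rewrite shiftSr; apply: (up_adj H ji); rewrite ?inj //; apply: inj_S.
Qed.

Lemma inj_sequence k : S k ->
  exists A B, forall m, c j (k + alpha i *+ m) = A * q ^- m + B * q ^+ m.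
Proof.
move=> Sk; apply: (recursion_solution q_neq0 q2) => m.
rewrite !shiftSr; apply: (ps_serre H ij); first exact: inj_S.
  exact/inj/inj_S.
by apply/inj/inj_Si/inj_S.
Qed.

(** As E_i is injective, the recursion for c_j holds along the whole string. The
    constants A, B are then tied to c_i by the square relations at two consecutive
    weights of the string. *)
Lemma inj_pair_core k : S k -> up j k != 0 -> exists A B T, [/\ T != 0,
  forall m, c j (k + alpha i *+ m) = A * q ^- m + B * q ^+ m,
  A - q * K j k = - T * q ^+ 2 * (B - (q * K j k)^-1),
  c i k = ch (q * K i k * T) & c i (k + alpha j) = ch (q ^+ 2 * K i k * T)].
Proof.
move=> Sk uj; have [A [B AB]] := inj_sequence Sk.
have Sj := S_up H Sk uj; have Sk1 := inj_Si Sk.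
have uE m : up j (k + alpha i *+ m) =
    (A - q * K j k) / q ^+ m + q ^+ m * (B - (q * K j k)^-1).
  by rewrite /raise_coef AB inj_Kj /ch; field_nz.
have u0 := uE 0%N; rewrite addr0 expr0 divr1 mul1r in u0.
have u1 := uE 1%N; rewrite expr1 mulr1n in u1.
have u2 := uE 2%N; rewrite !shiftS addr0 in u2.
have e0 := ps_square H ij Sk (inj Sk) uj.
have uj1 : up j (k + alpha i) != 0 by rewrite -[alpha i]mulr1n inj_up_adj.
have e1 := ps_square H ij Sk1 (inj Sk1) uj1.
have ci1 : c i (k + alpha i) = c i k by rewrite -[alpha i]mulr1n inj_c.
have ci1' : c i (k + alpha i + alpha j) = c i (k + alpha j).
  by rewrite addrAC -[alpha i]mulr1n inj_c.
rewrite u0 u1 /raise_coef wtK_adj // mulVKf // in e0.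
rewrite u1 u2 /raise_coef ci1 ci1' (wtK_adj q_neq0 lam _ ij) wtK_alpha // mulVKf // in e1.
have nz : A - q * K j k + (B - (q * K j k)^-1) != 0 by rewrite -u0.
have [T [T0 TE E1 E2]] :=
  pair_algebra q_neq0 q2 (K_neq0 i k) (K_neq0 j k) nz e0 e1.
by exists A, B, T.
Qed.

(** The Casimir values are those of a module over the Weyl algebra on which the
    product of q and of the two omega attached to j acts as t. *)
Definition pair_value k t := [/\ t != 0,
  forall m, c j (k + alpha i *+ m) = ch (t * q ^- m) &
  c i k = ch (K i k * K j k * t)].

Lemma pair_value_back k t :
  S k -> pair_value (k + alpha i) t -> pair_value k (q * t).
Proof.
move=> Sk [t0 cj ci]; split; first by rewrite mulf_neq0.
  case=> [|m]; last first.
    by rewrite shiftS cj exprS invfM mulrACA divff // mul1r.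
  have := ps_serre H ij Sk (inj Sk) (inj (inj_Si Sk)).
  have := cj 0%N; have := cj 1%N.
  rewrite !addr0 mulr1n expr0 invr1 mulr1 expr1 => -> ->.
  move=> e; apply/eqP; rewrite -subr_eq0 -e mulr1; apply/eqP.
  by rewrite /qtwo /ch; field_nz.
move: ci; rewrite (ps_up H Sk (inj Sk)).2 => ->; congr ch.
by rewrite wtK_alpha // wtK_adj //; field_nz.
Qed.

(** The linear equation between A and B holds at k and at k + alpha_j with the same
    A and B, since c_j is constant along alpha_j; the two equations determine
    them. *)
Lemma pair_value_step k : S k -> up j k != 0 -> up j (k + alpha j) != 0 ->
  exists t, pair_value k t.
Proof.
move=> Sk u u'; have [A [B [T [T0 AB e ci ci']]]] := inj_pair_core Sk u.
have Sk' := S_up H Sk u.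
have [A' [B' [T' [T'0 AB' e' cj cj']]]] := inj_pair_core Sk' u'.
have AB0 m : c j (k + alpha j + alpha i *+ m) = A * q ^- m + B * q ^+ m.
  by rewrite addrAC (ps_up H _ (inj_up_adj m Sk u)).2 ?AB //; apply: inj_S.
have E0 : A' + B' = A + B.
  by have := AB0 0%N; rewrite AB' expr0 !invr1 !mulr1.
have E1 : A' / q + B' * q = A / q + B * q.
  by have := AB0 1%N; rewrite AB' !expr1.
have [AE BE] := sequence_coefs q_neq0 q2 E0 E1.
have TE : T' = q ^+ 2 * T.
  have := ps_serre H ji Sk u u'; rewrite cj' ci' ci.
  rewrite wtK_adj // => rec.
  have e1 : ch (q * K i k * T') = ch (q ^+ 3 * K i k * T).
    have -> : q * K i k * T' = q ^+ 2 * (q^-1 * K i k) * T' by field_nz.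
    apply/eqP; rewrite -subr_eq0 -rec; apply/eqP.
    by rewrite /qtwo /ch; field_nz.
  have e2 : ch (q * K i k * T' / q) = ch (q ^+ 3 * K i k * T / q).
    have -> : q * K i k * T' / q = q * (q^-1 * K i k) * T' by field_nz.
    have -> : q ^+ 3 * K i k * T / q = q ^+ 2 * K i k * T by field_nz.
    by rewrite -(wtK_adj q_neq0 lam _ ij) -cj ci'.
  have := ch_step_inj q_neq0 q2 _ _ e1 e2.
  have nz : q * K i k != 0 by rewrite mulf_neq0.
  rewrite !mulf_neq0 // => /(_ isT isT) TT.
  by apply: (mulfI nz); rewrite TT; ring.
move: e'; rewrite AE BE TE wtK_alpha // => e'.
have [EA EB] := pair_solution q_neq0 q2 (K_neq0 j k) T0 e e'.
exists (q * T / K j k); split; first by rewrite !mulf_neq0 ?invr_neq0.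
  by move=> m; rewrite AB EA EB /ch; field_nz.
by rewrite ci; congr ch; field_nz.
Qed.

(** If E_j^2 v = 0, the equation at k + alpha_j is not available. Either it is after
    applying E_i, or c_j is known at two points of the string because E_j vanishes
    at both. *)
Lemma pair_value_up k : S k -> up j k != 0 -> exists t, pair_value k t.
Proof.
move=> Sk u; case: (eqVneq (up j (k + alpha j)) 0) => [e0|]; last first.
  exact: pair_value_step.
have Sk1 := inj_Si Sk.
have u1 : up j (k + alpha i) != 0 by rewrite -[alpha i]mulr1n inj_up_adj.
case: (eqVneq (up j (k + alpha i + alpha j)) 0) => [e1|u1']; last first.
  have [t tP] := pair_value_step Sk1 u1 u1'.
  by exists (q * t); apply: pair_value_back.
have [A [B [T [T0 AB e ci _]]]] := inj_pair_core Sk u.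
have [EA EB] : A = q ^+ 3 * K j k /\ B = (q ^+ 3 * K j k)^-1.
  apply: (pair_solution_top q_neq0 q2) => //.
    have := AB 0%N; rewrite addr0 expr0 invr1 !mulr1 => <-.
    rewrite -(ps_up H Sk u).2; move/eqP: e0.
    rewrite subr_eq0 wtK_alpha // => /eqP ->; congr ch; ring.
  have := AB 1%N; rewrite !expr1 mulr1n => <-.
  rewrite -(ps_up H Sk1 u1).2; move/eqP: e1.
  by rewrite subr_eq0 wtK_alpha // wtK_adj // => /eqP ->; congr ch; field_nz.
have q2' : q ^+ 2 != 1 by rewrite -subr_eq0.
have TE : T = (q * K j k) ^+ 2.
  apply: (mulIf (mulf_neq0 (mulf_neq0 (invr_neq0 q_neq0)
    (invr_neq0 (K_neq0 j k))) q2)).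
  apply/eqP; rewrite -subr_eq0; apply/eqP.
  transitivity (- (A - q * K j k + T * q ^+ 2 * (B - (q * K j k)^-1))).
    by rewrite EA EB; field_nz.
  by rewrite e !mulNr addNr oppr0.
exists (q ^+ 3 * K j k); split; first by rewrite mulf_neq0.
  by move=> m; rewrite AB EA EB /ch; field_nz.
by rewrite ci TE; congr ch; ring.
Qed.

(** E_j and F_j can both kill v only if K_j^2 = 1 on v, and not on E_i v, since q is
    not a root of unity; a value at E_i v gives one at v. *)
Lemma pair_value_exists k : S k -> exists t, pair_value k t.
Proof.
have nonzero k0 : S k0 -> K j k0 ^+ 2 != 1 -> exists t, pair_value k0 t.
  move=> Sk K2; case: (eqVneq (up j k0) 0) => [u0|]; last exact: pair_value_up.
  have d : dn j k0 != 0.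
    apply: contra K2; move/eqP: u0; rewrite subr_eq0 => /eqP cE.
    rewrite /lower_coef cE [q * _]mulrC -sh_mul // mulf_eq0 orbC.
    by rewrite (negbTE (sh_q_neq0 q_neq0 q_nroot)) sh_eq0.
  set l := k0 - alpha j; have Sl : S l := S_dn H Sk d.
  have ul : up j l != 0 by rewrite (up_dn q_neq0 H).
  have lj : l + alpha j = k0 by apply: subrK.
  have [t [t0 cj ci]] := pair_value_up Sl ul.
  have [A [B [T [T0 AB e ci1 ci2]]]] := inj_pair_core Sl ul.
  have [EA EB] : A = t /\ B = t^-1.
    apply: (sequence_coefs q_neq0 q2).
      by have := cj 0%N; rewrite AB expr0 invr1 !mulr1.
    have := cj 1%N; rewrite AB !expr1 /ch => ->; field_nz.
  have tqK : t - q * K j l != 0.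
    apply: contra ul; rewrite subr_eq0 => /eqP tE; apply/eqP.
    have := cj 0%N; rewrite addr0 expr0 invr1 mulr1 /raise_coef => ->.
    by rewrite tE subrr.
  have TE : T = t * K j l / q.
    apply: (mulIf tqK); apply/eqP; rewrite -subr_eq0; apply/eqP.
    transitivity (- (A - q * K j l + T * q ^+ 2 * (B - (q * K j l)^-1)) *
      (t * K j l / q)).
      by rewrite EA EB; field_nz.
    by rewrite e !mulNr addNr mul0r oppr0.
  exists t; split=> // [m|].
    rewrite -cj -lj addrAC (ps_up H _ (inj_up_adj m Sl ul)).2 //.
    exact: inj_S.
  rewrite -lj ci2 TE wtK_alpha // (wtK_adj q_neq0 lam _ ij).
  by congr ch; field_nz.
move=> Sk; case: (eqVneq (K j k ^+ 2) 1) => [K1|]; last exact: nonzero.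
have [|t tP] := nonzero _ (inj_Si Sk); last by exists (q * t); apply: pair_value_back.
rewrite wtK_adj // exprMn K1 mulr1 exprVn invr_eq1.
by rewrite -subr_eq0.
Qed.

Lemma pair_value_uniq k t t' : pair_value k t -> pair_value k t' -> t = t'.
Proof.
move=> [t0 cj _] [t'0 cj' _]; apply: (ch_step_inj q_neq0 q2) => //.
  by have := cj 0%N; rewrite cj' expr0 invr1 !mulr1.
by have := cj 1%N; rewrite cj' expr1.
Qed.

(** Two values of c_j on the string already determine t. *)
Lemma pair_value_transfer k k' t : S k' -> pair_value k t ->
  (forall m, c j (k' + alpha i *+ m) = c j (k + alpha i *+ m)) ->
  pair_value k' t.
Proof.
move=> Sk' [t0 cj _] e; have [t' P'] := pair_value_exists Sk'.
suff -> : t = t' by [].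
have [t'0 cj' _] := P'; apply: (ch_step_inj q_neq0 q2) => //.
  by have := cj 0%N; rewrite -e cj' expr0 invr1 !mulr1.
by have := cj 1%N; rewrite -e cj' expr1.
Qed.

Lemma inj_up_run l m k : i != l -> S k -> up l k != 0 ->
  up l (k + alpha i *+ m) != 0.
Proof.
move=> il Sk u; elim: m => [|m IH]; first by rewrite addr0.
have Sm := inj_S m Sk; rewrite shiftSr.
case: (index_cases i l) => [e|a|d]; first by rewrite e eqxx in il.
  by apply: (up_adj H); rewrite ?inj // adjacentC.
by rewrite (up_far q_neq0 H) ?inj.
Qed.

Lemma pair_value_i k t : S k -> pair_value k t ->
  pair_value (k + alpha i) (t / q).
Proof.
move=> Sk P; have [t' P'] := pair_value_exists (inj_Si Sk).
suff -> : t / q = t' by [].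
rewrite -(pair_value_uniq (pair_value_back Sk P') P); field_nz.
Qed.

Lemma pair_value_run k t m : S k -> pair_value k t ->
  pair_value (k + alpha i *+ m) (t / q ^+ m).
Proof.
move=> Sk P; elim: m => [|m IH]; first by rewrite addr0 expr0 divr1.
rewrite shiftSr exprSr invfM mulrA.
by apply: pair_value_i => //; apply: inj_S.
Qed.

Lemma pair_value_j k t : S k -> up j k != 0 -> pair_value k t ->
  pair_value (k + alpha j) t.
Proof.
move=> Sk u P; apply: (pair_value_transfer _ P); first exact: (S_up H).
move=> m; rewrite addrAC (ps_up H _ (inj_up_run _ _ _ u)).2 //.
  exact: inj_S.
exact: adjacent_neq.
Qed.

Lemma pair_value_far l k t : distant j l -> i != l -> S k -> up l k != 0 ->
  pair_value k t -> pair_value (k + alpha l) t.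
Proof.
move=> d il Sk u P; apply: (pair_value_transfer _ P); first exact: (S_up H).
move=> m; rewrite addrAC (ps_far H _ _ (inj_up_run _ il _ u)) //.
  by rewrite distantC.
exact: inj_S.
Qed.

Section NextNeighbour.
Variable l : 'I_n.
Hypotheses (jl : adjacent j l) (il : i != l).

Let lj : adjacent l j. Proof. by rewrite adjacentC. Qed.

Let dil : distant i l.
Proof.
have : i != l :> nat := il; move: ij jl; rewrite /adjacent /distant; lia.
Qed.

Let up_const k m : S k -> up l (k + alpha i *+ m) = up l k.
Proof.
move=> Sk; elim: m => [|m IH]; first by rewrite addr0.
by rewrite shiftSr (up_far q_neq0 H) ?inj //; apply: inj_S.
Qed.

Let up_jE k t : pair_value k t ->
  up j k = (t - q * K j k) * (1 - (q * K j k * t)^-1).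
Proof.
move=> [t0 cj _]; have := cj 0%N; rewrite addr0 expr0 invr1 mulr1.
by rewrite /raise_coef => ->; rewrite /ch; field_nz.
Qed.

Let dn_jE k t : pair_value k t ->
  dn j k = (t - K j k / q) * (1 - (K j k / q * t)^-1).
Proof.
move=> [t0 cj _]; have := cj 0%N; rewrite addr0 expr0 invr1 mulr1.
by rewrite /lower_coef => ->; rewrite /ch; field_nz.
Qed.

(** E_l does not see alpha_i, so the square relations for j and l at k and at
    k + alpha_i have a common factor; its cancellation leaves an equation in t
    and t'. *)
Let core k t t' : S k -> up j k != 0 -> up l k != 0 -> pair_value k t ->
  pair_value (k + alpha l) t' -> t' = q * t.
Proof.
move=> Sk uj ul P P'; have Sl := S_up H Sk ul; have Sk1 := inj_Si Sk.
have Sj := S_up H Sk uj.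
have P1 := pair_value_i Sk P; have P1' := pair_value_i Sl P'.
have uj1 : up j (k + alpha i) != 0.
  by rewrite -[alpha i]mulr1n inj_up_run // adjacent_neq.
have ul1 : up l (k + alpha i) = up l k by rewrite -[alpha i]mulr1n up_const.
have e0 := ps_square H jl Sk uj ul.
have := ps_square H jl Sk1 uj1; rewrite ul1 => /(_ ul).
rewrite [k + alpha i + alpha l]addrAC [k + alpha i + alpha j]addrAC.
have -> : up l (k + alpha j + alpha i) = up l (k + alpha j).
  by rewrite -[alpha i]mulr1n up_const.
move=> e1; have ulj : up l (k + alpha j) != 0 := up_adj H lj Sk ul uj.
have ujl : up j (k + alpha l) != 0 := up_adj H jl Sk uj ul.
have cross : up j k * up j (k + alpha l + alpha i) =
    up j (k + alpha i) * up j (k + alpha l).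
  apply: (mulIf (mulf_neq0 ul ulj)).
  by rewrite mulrACA e0 [in RHS]mulrACA e1; ring.
have [t0 _ _] := P; have [t'0 _ _] := P'.
move: cross uj ujl.
rewrite (up_jE P) (up_jE P1) (up_jE P') (up_jE P1').
rewrite !(wtK_adj q_neq0 lam _ ji) !(wtK_adj q_neq0 lam _ jl) => cross.
rewrite !mulf_eq0 !negb_or => /andP[nz _] /andP[nz' _].
have y0 := K_neq0 j k; set y := K j k in cross nz nz' y0.
have qqV : q - q^-1 != 0 by apply: sh_q_neq0.
have e : (q * y * t)^-1 = (y * t')^-1.
  apply: (mulIf (mulf_neq0 (mulf_neq0 nz nz') qqV)).
  apply/eqP; rewrite -subr_eq0; apply/eqP; move/eqP: cross.
  rewrite -subr_eq0 => /eqP <-; field_nz.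
by apply: (mulfI y0); rewrite -[LHS]invrK -e invrK; ring.
Qed.

(** If E_j v = 0, then E_j E_i v is nonzero unless t takes one special value. *)
Let core_up k t t' : S k -> up l k != 0 -> pair_value k t ->
  pair_value (k + alpha l) t' -> t != q * K j k -> t' = q * t.
Proof.
move=> Sk ul P P' tn; have [t0 _ _] := P.
case: (eqVneq (up j k) 0) => [u0|u]; last exact: core P'.
have Sk1 := inj_Si Sk; have Sl := S_up H Sk ul.
have P1 := pair_value_i Sk P; have P1' := pair_value_i Sl P'.
rewrite addrAC in P1'.
have ul1 : up l (k + alpha i) != 0 by rewrite -[alpha i]mulr1n up_const.
suff u1 : up j (k + alpha i) != 0.
  have := core Sk1 u1 ul1 P1 P1'; rewrite mulrA => e.
  by apply: (mulIf (invr_neq0 q_neq0)).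
move/eqP: u0; rewrite (up_jE P) mulf_eq0 subr_eq0 (negbTE tn) /= subr_eq0.
move=> /eqP e; rewrite (up_jE P1) (wtK_adj q_neq0 lam _ ji).
have -> : (q * (q^-1 * K j k) * (t / q))^-1 = q ^+ 2 * (q * K j k * t)^-1.
  by field_nz.
have -> : t / q - q * (q^-1 * K j k) = (t - q * K j k) / q by field_nz.
rewrite -e mulr1 !mulf_neq0 ?invr_neq0 // ?subr_eq0 //.
by rewrite eq_sym -subr_eq0.
Qed.

Let core_dn k t t' : S k -> up l k != 0 -> pair_value k t ->
  pair_value (k + alpha l) t' -> dn j (k + alpha l) != 0 -> t' = q * t.
Proof.
move=> Sk ul P P' d; have lj' : l != j by apply: adjacent_neq.
have [dk ulv] := proj2 (ps_mixed H lj' Sk) (conj ul d).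
set v := k - alpha j in ulv; have Sv : S v := S_dn H Sk dk.
have vk : v + alpha j = k by apply: subrK.
have ujv : up j v != 0 by rewrite (up_dn q_neq0 H).
have [tv Pv] := pair_value_exists Sv.
have tvE : tv = t.
  by apply: (pair_value_uniq _ P); rewrite -vk; apply: pair_value_j.
have Svl := S_up H Sv ulv; have [tl Pl] := pair_value_exists Svl.
rewrite -tvE -(core Sv ujv ulv Pv Pl).
apply: (pair_value_uniq P'); rewrite -vk addrAC.
by apply: pair_value_j => //; apply: (up_adj H).
Qed.

Let core_low k t t' : S k -> up l k != 0 -> pair_value k t ->
  pair_value (k + alpha l) t' -> t' != K j (k + alpha l) / q -> t' = q * t.
Proof.
move=> Sk ul P P' tn; have [t'0 _ _] := P'.
case: (eqVneq (dn j (k + alpha l)) 0) => [u0|u]; last exact: core_dn P' u.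
have Sk1 := inj_Si Sk; have Sl := S_up H Sk ul.
have P1 := pair_value_i Sk P; have P1' := pair_value_i Sl P'.
have E : k + alpha l + alpha i = k + alpha i + alpha l by rewrite addrAC.
have ul1 : up l (k + alpha i) != 0 by rewrite -[alpha i]mulr1n up_const.
suff u1 : dn j (k + alpha l + alpha i) != 0.
  rewrite E in P1' u1; have := core_dn Sk1 ul1 P1 P1' u1; rewrite mulrA => e.
  by apply: (mulIf (invr_neq0 q_neq0)).
move/eqP: u0; rewrite (dn_jE P') mulf_eq0 subr_eq0 (negbTE tn) /= subr_eq0.
move=> /eqP e; rewrite (dn_jE P1') (wtK_adj q_neq0 lam (k + alpha l) ji).
set y := K j (k + alpha l) in e tn *; have y0 : y != 0 by apply: K_neq0.
have -> : (q^-1 * y / q * (t' / q))^-1 = q ^+ 2 * (y / q * t')^-1.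
  by field_nz.
have -> : t' / q - q^-1 * y / q = (t' - y / q) / q by field_nz.
rewrite -e mulr1 !mulf_neq0 ?invr_neq0 // ?subr_eq0 //.
by rewrite eq_sym -subr_eq0.
Qed.

(** For v of weight k, F_j E_l v = 0 forces E_l F_j v = 0 and then E_l F_j^2 v = 0,
    while the conditions on K_j keep F_j^2 v nonzero; the recursion along alpha_j
    then gives E_l v = 0. *)
Let no_corner k : S k -> up l k != 0 -> pair_value k (q * K j k) ->
  pair_value (k + alpha l) (K j (k + alpha l) / q) ->
  K j k ^+ 2 != 1 -> K j k ^+ 2 != q ^+ 2 -> False.
Proof.
move=> Sk ul P P' K1 K2.
have lj' : l != j by apply: adjacent_neq.
have d' : dn j (k + alpha l) = 0 by rewrite (dn_jE P') subrr mul0r.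
have y0 := K_neq0 j k; have qqV := sh_q_neq0 q_neq0 q_nroot.
have d : dn j k != 0.
  rewrite (dn_jE P); set y := K j k in K1 K2 y0 *.
  have -> : q * y - y / q = y * sh q by rewrite /sh; ring.
  have -> : y / q * (q * y) = y ^+ 2 by field_nz.
  rewrite !mulf_neq0 // subr_eq0 eq_sym invr_eq1; exact: K1.
set v := k - alpha j; have Sv : S v := S_dn H Sk d.
have vk : v + alpha j = k by apply: subrK.
have ujv : up j v != 0 by rewrite (up_dn q_neq0 H).
have ulv : up l v = 0.
  apply/eqP; apply: contraT => u.
  by have [_] := proj1 (ps_mixed H lj' Sk) (conj d u); rewrite d' eqxx.
have [tv Pv] := pair_value_exists Sv.
have tvE : tv = q * K j k.
  by apply: (pair_value_uniq _ P); rewrite -vk; apply: pair_value_j.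
have dv : dn j v != 0.
  rewrite (dn_jE Pv) tvE (wtK_alphaB q_neq0).
  set y := K j k in K1 K2 y0 *.
  have -> : q * y - q ^- 2 * y / q = y * (q ^+ 4 - 1) / q ^+ 3 by field_nz.
  have -> : q ^- 2 * y / q * (q * y) = y ^+ 2 / q ^+ 2 by field_nz.
  rewrite !mulf_neq0 ?invr_neq0 // ?subr_eq0 ?q_nroot //.
  rewrite eq_sym invr_eq1; apply: contra K2 => /eqP e.
  by rewrite -[y ^+ 2](divfK (qm 2)) e mul1r.
set w := v - alpha j; have Sw : S w := S_dn H Sv dv.
have wv : w + alpha j = v by apply: subrK.
have ujw : up j w != 0 by rewrite (up_dn q_neq0 H).
have ulw : up l w = 0.
  apply/eqP; apply: contraT => u.
  by have [] := proj1 (ps_mixed H lj' Sv) (conj dv u); rewrite ulv eqxx.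
have := up_serre q_neq0 H jl Sw ujw; rewrite wv vk ulw ulv => /(_ ujv).
by rewrite mulr0 subr0 add0r => e; rewrite e eqxx in ul.
Qed.

(** Only the corner where both t and t' are special remains. It persists along
    alpha_i, while K_j^2 is multiplied by q^-2 at each step, so one of three
    consecutive weights satisfies the conditions of [no_corner]. *)
Lemma pair_value_next k t : S k -> up l k != 0 -> pair_value k t ->
  pair_value (k + alpha l) (q * t).
Proof.
move=> Sk ul P; have Sl := S_up H Sk ul.
have [t' P'] := pair_value_exists Sl; suff <- : t' = q * t by [].
case: (eqVneq t (q * K j k)) => [tE|]; last exact: core_up P'.
case: (eqVneq t' (K j (k + alpha l) / q)) => [t'E|]; last exact: core_low P'.
rewrite {}tE {}t'E in P P' *; exfalso.
have corner m : K j (k + alpha i *+ m) ^+ 2 != 1 ->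
    K j (k + alpha i *+ m) ^+ 2 != q ^+ 2 -> False.
  apply: no_corner; [exact: inj_S | by rewrite up_const | |].
    rewrite inj_Kj mulrCA [_ * (_ * _)]mulrC; exact: pair_value_run.
  rewrite [k + _ + _]addrAC inj_Kj -mulrA [_ ^- m * _]mulrC.
  exact: pair_value_run.
have pq m : (0 < m)%N -> (q ^+ m == 1) = false by apply: expq_eq1.
have qE a b : (a < b)%N -> (q ^+ a == q ^+ b) = false.
  move=> ab; rewrite -(subnK (ltnW ab)) exprD -{1}[q ^+ a]mul1r.
  by rewrite (inj_eq (mulIf (qm a))) eq_sym pq // subn_gt0.
have KE m : K j (k + alpha i *+ m) ^+ 2 = K j k ^+ 2 / q ^+ m.*2.
  by rewrite inj_Kj exprMn exprVn -exprM muln2 mulrC.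
have div1 x m : (x / q ^+ m == 1) = (x == q ^+ m).
  by rewrite -(inj_eq (mulIf (qm m))) divfK // mul1r.
have div2 x m : (x / q ^+ m == q ^+ 2) = (x == q ^+ (2 + m)).
  by rewrite -(inj_eq (mulIf (qm m))) divfK // exprD.
have := corner 0%N; have := corner 1%N; have := corner 2%N.
rewrite !KE !div1 !div2 /= expr0.
case: (eqVneq (K j k ^+ 2) 1) => [->|Z1].
  by move=> _ + _; rewrite -[1](expr0 q) !qE // => /(_ isT isT).
case: (eqVneq (K j k ^+ 2) (q ^+ 2)) => [->|Z2].
  by move=> + _ _; rewrite !qE // => /(_ isT isT).
by move=> _ _ /(_ isT isT).
Qed.

End NextNeighbour.
End InjectivePair.

(** * Casimir values of Weyl type: one step along the diagram *)

(** The eigenvalue of omega_l on the translate by k of the weight w, locked for the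
    same reason as [wtK]. *)
HB.lock Definition wtO (F : fieldType) (q : F) (n : nat) (w : 'I_n.+1 -> F)
  (l : 'I_n.+1) (k : lattice n) : F := w l * q ^ k l.

Section WeylWeights.
Variables (F : fieldType) (q : F) (n : nat).
Hypotheses (q_neq0 : q != 0) (q_nroot : not_root_of_unity q).
Local Notation L := (lattice n).
Variables (w : 'I_n.+1 -> F).
Hypothesis w_neq0 : forall l, w l != 0.
Local Notation O := (wtO q w).
Implicit Types (i j : 'I_n) (k : L).

Lemma wtO_neq0 l k : O l k != 0.
Proof. by rewrite wtO.unlock mulf_neq0 // expz_neq0. Qed.

Lemma wtOD l (k x : L) : O l (k + x) = q ^ x l * O l k.
Proof. by rewrite wtO.unlock ffunE expfzDr // mulrCA mulrA mulrC !mulrA; ring. Qed.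

Lemma wtO_lo i k : O (lo i) (k + alpha i) = q * O (lo i) k.
Proof. by rewrite wtOD alpha_lo eqxx (ltn_eqF (ltnSn i)). Qed.

Lemma wtO_hi i k : O (hi i) (k + alpha i) = q^-1 * O (hi i) k.
Proof. by rewrite wtOD alpha_hi eqxx (gtn_eqF (ltnSn i)). Qed.

Lemma wtO_id l i k : l != lo i -> l != hi i -> O l (k + alpha i) = O l k.
Proof. by move=> a b; rewrite wtOD ffunE (negbTE a) (negbTE b) mul1r. Qed.

Lemma wtO_loB i k : O (lo i) (k - alpha i) = q^-1 * O (lo i) k.
Proof. by rewrite -{2}(subrK (alpha i) k) wtO_lo mulKf. Qed.

Lemma wtO_hiB i k : O (hi i) (k - alpha i) = q * O (hi i) k.
Proof. by rewrite -{2}(subrK (alpha i) k) wtO_hi mulVKf. Qed.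

Lemma wtO_idB l i k : l != lo i -> l != hi i -> O l (k - alpha i) = O l k.
Proof. by move=> a b; rewrite -{2}(subrK (alpha i) k) wtO_id. Qed.

(** On the weight space k of a module over the Weyl algebra, E_i = x_i y_(i+1) and
    F_i = x_(i+1) y_i give c i k this value; see [fits_up] and [fits_dn]. *)
Definition fits_at (c : 'I_n -> L -> F) i k :=
  c i k = ch (q * O (lo i) k * O (hi i) k).

Variable lam : 'I_n -> F.
Hypothesis lamE : forall i, lam i = w (lo i) / w (hi i).
Local Notation K := (wtK q lam).

Lemma wtK_O i k : K i k = O (lo i) k / O (hi i) k.
Proof.
by rewrite wtK.unlock wtO.unlock lamE expfzDr // -invr_expz invfM; ring.
Qed.

Lemma fits_up c i k : fits_at c i k ->
  raise_coef q lam c i k = sh (q * O (lo i) k) * sh (O (hi i) k).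
Proof.
move=> e; rewrite /raise_coef e wtK_O sh_mul ?mulf_neq0 ?wtO_neq0 //.
by rewrite [q * (_ / _)]mulrA.
Qed.

Lemma fits_dn c i k : fits_at c i k ->
  lower_coef q lam c i k = sh (O (lo i) k) * sh (q * O (hi i) k).
Proof.
have a := wtO_neq0 (lo i) k; have b := wtO_neq0 (hi i) k.
move=> e; rewrite /lower_coef e wtK_O sh_mul ?mulf_neq0 //.
by congr (ch _ - ch _); field_nz.
Qed.

Lemma up_fits c i k :
  raise_coef q lam c i k = sh (q * O (lo i) k) * sh (O (hi i) k) -> fits_at c i k.
Proof.
move=> e; rewrite /fits_at; apply: (addIr (- ch (q * K i k))).
rewrite -[LHS]/(raise_coef q lam c i k) e wtK_O.
by rewrite sh_mul ?mulf_neq0 ?wtO_neq0 // [q * (_ / _)]mulrA.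
Qed.

Lemma sh_shift (a : F) m : a != 0 -> (0 < m)%N -> sh a = 0 ->
  sh (q ^+ m * a) != 0.
Proof.
move=> a0 m0 /eqP; rewrite sh_eq0 // => /eqP e.
rewrite sh_eq0 ?mulf_neq0 ?expf_neq0 // exprMn e mulr1 -exprM.
by rewrite q_nroot // muln_gt0 m0.
Qed.

Lemma sh_shiftV (a : F) m : a != 0 -> (0 < m)%N -> sh a = 0 ->
  sh (q ^- m * a) != 0.
Proof.
move=> a0 m0 e; rewrite -oppr_eq0 -shV invfM invrK sh_shift ?invr_neq0 //.
by rewrite shV e oppr0.
Qed.

End WeylWeights.

Section ChainStep.
Variables (F : fieldType) (q : F) (n : nat).
Hypotheses (q_neq0 : q != 0) (q_nroot : not_root_of_unity q).
Local Notation L := (lattice n).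
Variables (lam : 'I_n -> F) (S : L -> Prop) (c : 'I_n -> L -> F).
Hypothesis H : pointed_system q lam S c.
Local Notation K := (wtK q lam).
Local Notation up := (raise_coef q lam c).
Local Notation dn := (lower_coef q lam c).
Variables (w : 'I_n.+1 -> F).
Hypothesis w_neq0 : forall l, w l != 0.
Hypothesis lamE : forall i, lam i = w (lo i) / w (hi i).
Local Notation O := (wtO q w).
Local Notation fits := (fits_at q w c).
Variables (i j : 'I_n).
Hypothesis ij : j = i.+1 :> nat.
Hypothesis fits_i : forall k, S k -> fits i k.
Local Notation z := (O (lo i)).
Local Notation x := (O (lo j)).
Local Notation y := (O (hi j)).

(** Weights that cannot be told apart at the index j. *)
Definition same_at k k' :=
  [/\ S k', c j k' = c j k, x k' = x k & y k' = y k].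

Hypothesis move_up :
  forall k, S k -> exists2 k', same_at k k' & sh (q * z k') != 0.
Hypothesis move_dn :
  forall k, S k -> exists2 k', same_at k k' & sh (z k') != 0.

Let aij : adjacent i j. Proof. by rewrite /adjacent ij eqxx. Qed.
Let aji : adjacent j i. Proof. by rewrite adjacentC. Qed.
Let hiE : hi i = lo j.
Proof. by apply/val_inj; rewrite /= /bump /= add1n ij. Qed.
Let x0 k : x k != 0. Proof. exact: wtO_neq0. Qed.
Let y0 k : y k != 0. Proof. exact: wtO_neq0. Qed.
Let z0 k : z k != 0. Proof. exact: wtO_neq0. Qed.

Let z_i k : z (k + alpha i) = q * z k. Proof. exact: wtO_lo. Qed.
Let x_i k : x (k + alpha i) = q^-1 * x k. Proof. by rewrite -hiE wtO_hi. Qed.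
Let y_i k : y (k + alpha i) = y k.
Proof. by apply: wtO_id; rewrite // -val_eqE /= /bump /= !add1n ij; lia. Qed.
Let z_j k : z (k + alpha j) = z k.
Proof. by apply: wtO_id; rewrite // -val_eqE /= /bump /= ?add1n ij; lia. Qed.
Let x_j k : x (k + alpha j) = q * x k. Proof. exact: wtO_lo. Qed.
Let y_j k : y (k + alpha j) = q^-1 * y k. Proof. exact: wtO_hi. Qed.
Let x_iB k : x (k - alpha i) = q * x k. Proof. by rewrite -hiE wtO_hiB. Qed.
Let y_iB k : y (k - alpha i) = y k.
Proof. by rewrite -{2}(subrK (alpha i) k) y_i. Qed.
Let x_jB k : x (k - alpha j) = q^-1 * x k. Proof. exact: wtO_loB. Qed.
Let y_jB k : y (k - alpha j) = q * y k. Proof. exact: wtO_hiB. Qed.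

Let KE k : K j k = x k / y k. Proof. exact: wtK_O. Qed.
Let up_iE k : S k -> up i k = sh (q * z k) * sh (x k).
Proof. by move=> Sk; rewrite (fits_up q_neq0 w_neq0 lamE) ?hiE //; apply: fits_i. Qed.
Let dn_iE k : S k -> dn i k = sh (z k) * sh (q * x k).
Proof. by move=> Sk; rewrite (fits_dn q_neq0 w_neq0 lamE) ?hiE //; apply: fits_i. Qed.

Let same_up k k' : same_at k k' -> up j k' = up j k.
Proof. by case=> _ e ex ey; rewrite /raise_coef e !KE ex ey. Qed.
Let same_dn k k' : same_at k k' -> dn j k' = dn j k.
Proof. by case=> _ e ex ey; rewrite /lower_coef e !KE ex ey. Qed.
Let same_fits k k' : same_at k k' -> fits j k' -> fits j k.
Proof. by case=> _ e ex ey; rewrite /fits_at e ex ey. Qed.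

(** If sh (q x) = 0 then E_i E_j v = 0, against F_i E_j E_i v = E_j F_i E_i v. *)
Let up_j_shq k : S k -> up j k != 0 -> sh (q * x k) != 0.
Proof.
move=> Sk u; apply/eqP=> e0.
have sx : sh (x k) != 0.
  apply: contra (q2_neq1 q_nroot); rewrite sh_eq0 // => /eqP ex.
  move/eqP: e0; rewrite sh_eq0 ?mulf_neq0 // exprMn ex mulr1 => /eqP->.
  by rewrite subrr.
have [k' sk' nz] := move_up Sk; have [Sk' _ ex _] := sk'.
have ui : up i k' != 0 by rewrite up_iE // ex mulf_neq0.
have uj : up j k' != 0 by rewrite (same_up sk').
have := up_adj H aij Sk' ui uj; rewrite (up_iE (S_up H Sk' uj)).
by rewrite x_j ex e0 mulr0 eqxx.
Qed.

(** The square relation for i and j, where the values at i are known. *)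
Let relation k : S k -> up i k != 0 -> up j k != 0 ->
  sh (x k) * up j k = sh (q * x k) * up j (k + alpha i).
Proof.
move=> Sk ui uj; have nz : sh (q * z k) != 0.
  by move: ui; rewrite up_iE // mulf_eq0 => /norP[].
apply: (mulfI nz); have := ps_square H aij Sk ui uj.
by rewrite (up_iE Sk) (up_iE (S_up H Sk uj)) z_j x_j -!mulrA.
Qed.

Let fits_shift k : S k -> up i k != 0 -> up j k != 0 ->
  fits j (k + alpha i) <-> fits j k.
Proof.
move=> Sk ui uj; have sx : sh (x k) != 0.
  by move: ui; rewrite up_iE // mulf_eq0 => /norP[].
have sqx := up_j_shq Sk uj; have e := relation Sk ui uj.
split=> f; apply: (up_fits q_neq0 w_neq0 lamE).
  apply: (mulfI sx); rewrite e (fits_up q_neq0 w_neq0 lamE f).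
  by rewrite x_i y_i mulVKf // mulrCA.
apply: (mulfI sqx); rewrite -e (fits_up q_neq0 w_neq0 lamE f).
by rewrite x_i y_i mulVKf // mulrCA.
Qed.

(** Both the value of c_j along the alpha_j-string and its value along the
    translated string are constant, so the relation at k and k + alpha_j gives
    two independent equations for the two deviations from the model; on a string
    of length two these are replaced by the value of c_j at the end. *)
Let generic_fits k : S k -> up j k != 0 -> sh (x k) != 0 ->
  sh (q ^+ 2 * x k) != 0 -> sh (q * z k) != 0 -> fits j k.
Proof.
move=> Sk uj sx sq2x sqz.
have ui : up i k != 0 by rewrite up_iE // mulf_neq0.
have sqx := up_j_shq Sk uj; have Si := S_up H Sk ui; have Sj := S_up H Sk uj.
have e := relation Sk ui uj.
have ujt : up j (k + alpha i) != 0 by apply: (up_adj H).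
have Sij := S_up H Si ujt.
have cj2 : c j (k + alpha j) = c j k := (ps_up H Sk uj).2.
have cij : c j (k + alpha i + alpha j) = c j (k + alpha i) := (ps_up H Si ujt).2.
have ui2 : up i (k + alpha j) != 0 by apply: (up_adj H).
have qq := sh_q_neq0 q_neq0 q_nroot.
have nx := x0 k; have ny := y0 k.
rewrite /fits_at; set X := x k in sx sq2x sqx e nx *.
set Y := y k in ny *.
case: (eqVneq (up j (k + alpha j)) 0) => [e0|u2].
  have e1 : up j (k + alpha i + alpha j) = 0.
    apply/eqP; apply: contraT => u3; set p := k + alpha i + alpha j + alpha j.
    have Sp : S p by apply: (S_up H).
    have dj : dn j p != 0 by rewrite (dn_up q_neq0 H).
    have di : dn i p != 0.
      rewrite dn_iE // /p !z_j z_i !x_j x_i mulf_neq0 //.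
      by have -> : q * (q * (q * (q^-1 * x k))) = q ^+ 2 * X by rewrite /X; field_nz.
    have := mulf_neq0 di dj; rewrite (dn_square q_neq0 H aij Sp di dj).
    rewrite mulf_eq0 => /norP[_]; have -> : p - alpha i = k + alpha j + alpha j.
      by rewrite /p [k + alpha i + _]addrAC [_ + alpha i + _]addrAC addrK.
    move=> d2; have S2 : S (k + alpha j + alpha j).
      have := S_dn H Sp di; rewrite /p [k + alpha i + _]addrAC.
      by rewrite [_ + alpha i + _]addrAC addrK.
    by have := d2; rewrite -(up_dn q_neq0 H S2 d2) addrK e0 eqxx.
  move: e0 e1 e; rewrite /raise_coef cj2 cij !KE !x_j !x_i !y_j !y_i -/X -/Y.
  move=> /eqP; rewrite subr_eq0 => /eqP -> /eqP; rewrite subr_eq0 => /eqP ->.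
  have -> : q * (q * X / (q^-1 * Y)) = q ^+ 2 * X / Y * q by field_nz.
  have -> : q * (q * (q^-1 * X) / (q^-1 * Y)) = q * X / Y * q by field_nz.
  have -> : q * (X / Y) = q ^+ 2 * X / Y / q by field_nz.
  have -> : q * (q^-1 * X / Y) = q * X / Y / q by field_nz.
  rewrite -!sh_mul ?mulf_neq0 ?invr_neq0 ?expf_neq0 //.
  rewrite !mulrA => /(mulIf qq); rewrite !sh_mul ?mulf_neq0 ?invr_neq0 ?expf_neq0 //.
  have -> : X * (q ^+ 2 * X / Y) = q * X * (q * X / Y) by field_nz.
  move=> /addrI/oppr_inj.
  have -> : X / (q ^+ 2 * X / Y) = Y / q ^+ 2 by field_nz.
  have -> : q * X / (q * X / Y) = Y by field_nz.
  case/ch_inj; rewrite ?mulf_neq0 ?invr_neq0 ?expf_neq0 //.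
    move=> /eqP; rewrite -[in X in _ == X](mulr1 Y) (inj_eq (mulfI ny)).
    by rewrite invr_eq1 (negbTE (q_nroot _)).
  move=> YY; congr ch; have -> : Y ^-1 = Y / q ^+ 2.
    by apply: (mulIf ny); rewrite mulVf // YY.
  by field_nz.
have e2 := relation Sj ui2 u2.
move: e e2; rewrite /raise_coef [k + alpha j + alpha i]addrAC cj2 cij !KE.
rewrite !x_j !x_i !y_j !y_i -/X -/Y.
set C := c j k; set C1 := c j (k + alpha i) => e e2.
have det : sh (q * X) ^+ 2 - sh X * sh (q ^+ 2 * X) != 0.
  have -> : sh (q * X) ^+ 2 - sh X * sh (q ^+ 2 * X) = sh q ^+ 2.
    by rewrite /sh; field_nz.
  exact: expf_neq0.
apply/eqP; rewrite -subr_eq0; apply/eqP; apply: (mulIf det); rewrite mul0r.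
pose G1 := sh X * (C - ch (q * (X / Y))) -
  sh (q * X) * (C1 - ch (q * (q^-1 * X / Y))).
pose G2 := sh (q * X) * (C - ch (q * (q * X / (q^-1 * Y)))) -
  sh (q * (q * X)) * (C1 - ch (q * (q * (q^-1 * X) / (q^-1 * Y)))).
transitivity (sh (q * X) * G2 - sh (q ^+ 2 * X) * G1).
  by rewrite /G1 /G2 /sh /ch; field_nz.
by rewrite /G1 /G2 e e2 !subrr !mulr0 subrr.
Qed.

Let fits_moved k : S k -> up j k != 0 -> sh (x k) != 0 ->
  sh (q ^+ 2 * x k) != 0 -> fits j k.
Proof.
move=> Sk uj sx sx2; have [k' sk' nz] := move_up Sk; have [Sk' _ ex _] := sk'.
by apply: (same_fits sk'); apply: generic_fits; rewrite ?(same_up sk') ?ex.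
Qed.

Let fits_of_sh k : S k -> up j k != 0 -> sh (x k) != 0 -> fits j k.
Proof.
move=> Sk uj sx; have [k' sk' nz] := move_up Sk; have [Sk' _ ex _] := sk'.
apply: (same_fits sk').
have uj' : up j k' != 0 by rewrite (same_up sk').
rewrite -ex in sx; case: (eqVneq (sh (q ^+ 2 * x k')) 0) => [e0|]; last first.
  exact: fits_moved.
have ui : up i k' != 0 by rewrite up_iE // mulf_neq0.
apply/(fits_shift Sk' ui uj'); apply: fits_moved.
- exact: (S_up H).
- exact: (up_adj H).
- have -> : x (k' + alpha i) = q ^- 3 * (q ^+ 2 * x k') by rewrite x_i; field_nz.
  by apply: sh_shiftV e0; rewrite // mulf_neq0 ?expf_neq0.
- have -> : q ^+ 2 * x (k' + alpha i) = q * x k' by rewrite x_i; field_nz.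
  exact: up_j_shq.
Qed.

Let fits_up_j k : S k -> up j k != 0 -> fits j k.
Proof.
move=> Sk uj; case: (eqVneq (sh (x k)) 0) => [e0|]; last exact: fits_of_sh.
have [k' sk' nz] := move_dn Sk; have [Sk' _ ex _] := sk'.
apply: (same_fits sk'); have uj' : up j k' != 0 by rewrite (same_up sk').
rewrite -ex in e0; have sqx : sh (q * x k') != 0 by apply: up_j_shq.
have sq2x : sh (q ^+ 2 * x k') != 0 by apply: sh_shift.
have di : dn i k' != 0 by rewrite dn_iE // mulf_neq0.
have dij : dn i (k' + alpha j) != 0.
  by rewrite dn_iE ?z_j ?x_j ?mulrA ?mulf_neq0 //; apply: (S_up H).
have ji : j != i by apply: adjacent_neq.
have [_ uv] := proj2 (ps_mixed H ji Sk') (conj uj' dij).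
set v := k' - alpha i in uv; have Sv : S v := S_dn H Sk' di.
have vk : v + alpha i = k' by apply: subrK.
have uiv : up i v != 0 by rewrite (up_dn q_neq0 H).
rewrite -vk; apply/(fits_shift Sv uiv uv); apply: fits_of_sh => //.
by rewrite x_iB.
Qed.

Let fits_dn_j k : S k -> dn j k != 0 -> fits j k.
Proof.
move=> Sk dj; have Sv := S_dn H Sk dj.
have : fits j (k - alpha j) by apply: fits_up_j; rewrite // (up_dn q_neq0 H).
rewrite /fits_at (ps_dn H Sk dj).2 x_jB y_jB => ->; congr ch; field_nz.
Qed.

(** When E_j and F_j both kill v, their neighbours E_i v and F_i v are in the
    cases above, which forces x^2 = q^2 and x^2 = q^-4. The exceptions are x^2 = 1
    and (q x)^2 = 1, where c_j has the expected value by itself. *)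
Lemma chain_step k : S k -> fits j k.
Proof.
move=> Sk; case: (eqVneq (up j k) 0) => [u0|]; last exact: fits_up_j.
case: (eqVneq (dn j k) 0) => [d0|]; last exact: fits_dn_j.
have qq := sh_q_neq0 q_neq0 q_nroot; have nx := x0 k; have ny := y0 k.
have nK k' : S k' -> K j k' ^+ 2 != 1 -> fits j k'.
  move=> Sk' K2; case: (eqVneq (up j k') 0) => [e0|]; last exact: fits_up_j.
  apply: fits_dn_j => //; apply: contra K2; rewrite /lower_coef.
  move: e0 => /eqP; rewrite subr_eq0 => /eqP ->.
  have nK := wtK_neq0 q_neq0 (ps_lam H) j k'.
  by rewrite [q * _]mulrC -sh_mul // mulf_eq0 (negbTE qq) orbF sh_eq0.
have K2 : x k ^+ 2 = y k ^+ 2.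
  have : sh (x k / y k) * sh q = 0.
    rewrite sh_mul ?mulf_neq0 ?invr_neq0 // -KE -[RHS]subr0 -{1}d0 -u0.
    by rewrite /raise_coef /lower_coef [q * _]mulrC; ring.
  move/eqP; rewrite mulf_eq0 (negbTE qq) orbF sh_eq0 ?mulf_neq0 ?invr_neq0 //.
  rewrite exprMn exprVn => /eqP e.
  by apply: (mulIf (invr_neq0 (expf_neq0 2 ny))); rewrite e mulfV // expf_neq0.
have cE : c j k = ch (q * x k / y k).
  by move/eqP: u0; rewrite subr_eq0 KE mulrA => /eqP.
case: (eqVneq (sh (x k)) 0) => [/eqP|sx].
  rewrite sh_eq0 // => /eqP x1; rewrite /fits_at cE; congr ch.
  have -> : (y k)^-1 = y k by apply: (mulIf ny); rewrite mulVf // -expr2 -K2.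
  by [].
case: (eqVneq (sh (q * x k)) 0) => [/eqP|sqx].
  rewrite sh_eq0 ?mulf_neq0 // exprMn K2 => /eqP x1.
  rewrite /fits_at cE -chV; congr ch.
  have nz : q * x k / y k != 0 by rewrite !mulf_neq0 ?invr_neq0.
  apply: (mulIf nz); rewrite mulVf //.
  have -> : q * x k * y k * (q * x k / y k) = q ^+ 2 * x k ^+ 2 by field_nz.
  by rewrite K2 x1.
exfalso; have [k1 sk1 n1] := move_up Sk; have [S1 _ ex1 ey1] := sk1.
have [k2 sk2 n2] := move_dn Sk; have [S2 _ ex2 ey2] := sk2.
have ui : up i k1 != 0 by rewrite up_iE // ex1 mulf_neq0.
have di : dn i k2 != 0 by rewrite dn_iE // ex2 mulf_neq0.
have Sv1 := S_up H S1 ui; have Sv2 := S_dn H S2 di.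
have f1 : fits j (k1 + alpha i).
  apply: nK => //; rewrite KE x_i y_i ex1 ey1 !exprMn !exprVn K2.
  by rewrite mulfK ?expf_neq0 // invr_eq1 q_nroot.
have f2 : fits j (k2 - alpha i).
  apply: nK => //; rewrite KE x_iB y_iB ex2 ey2 !exprMn !exprVn K2.
  by rewrite mulfK ?expf_neq0 // q_nroot.
have e1 : dn j (k1 + alpha i) = 0.
  apply/eqP; apply: contraT => d.
  have [] := proj2 (ps_mixed H (adjacent_neq aij) S1) (conj ui d).
  by rewrite (same_dn sk1) d0 eqxx.
have e2 : up j (k2 - alpha i) = 0.
  apply/eqP; apply: contraT => u.
  have [] := proj1 (ps_mixed H (adjacent_neq aji) S2) (conj di u).
  by rewrite (same_up sk2) u0 eqxx.
have sy : sh (y k) != 0 by rewrite sh_eq0 // -K2 -sh_eq0.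
have sqy : sh (q * y k) != 0.
  by rewrite sh_eq0 ?mulf_neq0 // exprMn -K2 -exprMn -sh_eq0 // mulf_neq0.
move/eqP: e1; rewrite (fits_dn q_neq0 w_neq0 lamE f1) x_i y_i ex1 ey1.
rewrite mulf_eq0 (negbTE sqy) orbF => /eqP e1.
move/eqP: e2; rewrite (fits_up q_neq0 w_neq0 lamE f2) x_iB y_iB ex2 ey2.
rewrite mulf_eq0 (negbTE sy) orbF => /eqP.
have -> : q * (q * x k) = q ^+ 3 * (q^-1 * x k) by field_nz.
by apply/eqP; apply: sh_shift; rewrite ?mulf_neq0 ?invr_neq0.
Qed.

End ChainStep.

(** * Propagation along the diagram *)

Section Chain.
Variables (F : fieldType) (q : F) (n : nat).
Hypotheses (q_neq0 : q != 0) (q_nroot : not_root_of_unity q).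
Local Notation L := (lattice n).
Variables (lam : 'I_n -> F) (S : L -> Prop) (c : 'I_n -> L -> F).
Hypothesis H : pointed_system q lam S c.
Local Notation up := (raise_coef q lam c).
Local Notation dn := (lower_coef q lam c).
Variables (w : 'I_n.+1 -> F).
Hypothesis w_neq0 : forall l, w l != 0.
Hypothesis lamE : forall i, lam i = w (lo i) / w (hi i).
Local Notation O := (wtO q w).
Local Notation fits := (fits_at q w c).

(** Weights joined by nonzero actions of E_i and F_i with i <= m. *)
Inductive reach (m : nat) (k : L) : L -> Prop :=
| ReachRefl : reach m k k
| ReachUp (i : 'I_n) k' : (i <= m)%N -> reach m k k' -> up i k' != 0 ->
    reach m k (k' + alpha i)
| ReachDn (i : 'I_n) k' : (i <= m)%N -> reach m k k' -> dn i k' != 0 ->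
    reach m k (k' - alpha i).

Lemma reach_leq m m' k k' : (m <= m')%N -> reach m k k' -> reach m' k k'.
Proof.
move=> mm; elim=> [|i x im _ IH u|i x im _ IH u]; first by constructor.
  by apply: ReachUp => //; apply: leq_trans mm.
by apply: ReachDn => //; apply: leq_trans mm.
Qed.

Lemma reach_S m k k' : S k -> reach m k k' -> S k'.
Proof.
by move=> Sk; elim=> // i x _ _ IH u; [apply: (S_up H) | apply: (S_dn H)].
Qed.

Lemma reach_far m k k' (j : 'I_n) : (m.+1 < j)%N -> S k -> reach m k k' ->
  c j k' = c j k.
Proof.
move=> mj Sk r; have [] : S k' /\ c j k' = c j k => //.
elim: {k'} r => [|i x im r [Sx <-] u|i x im r [Sx <-] u] //.
  have d : distant i j by rewrite /distant; lia.
  by split; [apply: (S_up H) | apply: (ps_far H)].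
have d : distant i j by rewrite /distant; lia.
by split; [apply: (S_dn H) | apply: (dn_far q_neq0 H)].
Qed.

Lemma reach_O m k k' (l : 'I_n.+1) : (m.+1 < l)%N -> reach m k k' ->
  O l k' = O l k.
Proof.
move=> ml; elim=> // i x im _ <- _.
  by apply: wtO_id => //; rewrite -val_eqE /= /bump /= ?add1n; lia.
by apply: wtO_idB => //; rewrite -val_eqE /= /bump /= ?add1n; lia.
Qed.

Variable i0 : 'I_n.
Hypothesis inj : forall k, S k -> up i0 k != 0.

Let hi_lo (i j : 'I_n) : j = i.+1 :> nat -> hi i = lo j.
Proof. by move=> e; apply/val_inj; rewrite /= /bump /= add1n e. Qed.

(** E_(i0) changes w_(i0+1) without ever vanishing; whenever w_m is not at a
    zero of the relevant factor, E_m or F_m can be used to change w_(m+1). *)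
Lemma reach_normal d (m : 'I_n) : m = (i0 + d)%N :> nat ->
  (forall i : 'I_n, (i0 <= i <= m)%N -> forall k, S k -> fits i k) ->
  forall k, S k ->
    (exists2 k', reach m k k' & sh (q * O (hi m) k') != 0) /\
    (exists2 k', reach m k k' & sh (O (hi m) k') != 0).
Proof.
have nO l k : O l k != 0 by apply: wtO_neq0.
elim: d m => [|d IH] m mE fit k Sk.
  have {mE} -> : m = i0 by apply/val_inj; rewrite /= mE addn0.
  split.
    case: (eqVneq (sh (q * O (hi i0) k)) 0) => [e|nz]; last first.
      by exists k => //; constructor.
    exists (k + alpha i0); first by apply: ReachUp; rewrite ?inj //; constructor.
    rewrite wtO_hi // mulVKf //.
    have -> : O (hi i0) k = q ^- 1 * (q * O (hi i0) k) by rewrite expr1 mulKf.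
    by apply: sh_shiftV; rewrite ?mulf_neq0.
  case: (eqVneq (sh (O (hi i0) k)) 0) => [e|nz]; last first.
    by exists k => //; constructor.
  exists (k + alpha i0); first by apply: ReachUp; rewrite ?inj //; constructor.
  by rewrite wtO_hi // -[q^-1]/(q ^- 1) sh_shiftV.
have m0 : (m.-1 < n)%N by have := ltn_ord m; lia.
pose m' : 'I_n := Ordinal m0.
have m'E : m' = (i0 + d)%N :> nat by rewrite /= mE addnS.
have mS : m = m'.+1 :> nat by rewrite m'E mE addnS.
have [[k1 r1 n1] [k2 r2 n2]] := IH m' m'E (fun i im => fit i ltac:(lia)) k Sk.
have fm x : S x -> fits m x by apply: fit; lia.
rewrite (hi_lo mS) in n1 n2.
have hiO k' : reach m' k k' -> O (hi m) k' = O (hi m) k.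
  by apply: reach_O; rewrite /= /bump /=; lia.
split.
  case: (eqVneq (sh (q * O (hi m) k)) 0) => [e|nz]; last first.
    by exists k => //; constructor.
  have S1 := reach_S Sk r1.
  have nh : sh (O (hi m) k) != 0.
    have -> : O (hi m) k = q ^- 1 * (q * O (hi m) k) by rewrite expr1 mulKf.
    by apply: sh_shiftV; rewrite ?mulf_neq0.
  exists (k1 + alpha m).
    apply: ReachUp => //; first by apply: reach_leq r1; rewrite mS.
    by rewrite (fits_up q_neq0 w_neq0 lamE) ?hiO ?mulf_neq0 //; apply: fm.
  by rewrite wtO_hi // mulVKf // hiO.
case: (eqVneq (sh (O (hi m) k)) 0) => [e|nz]; last first.
  by exists k => //; constructor.
have S2 := reach_S Sk r2.
have nh : sh (q * O (hi m) k) != 0 by rewrite -[q]expr1 sh_shift.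
exists (k2 - alpha m).
  apply: ReachDn => //; first by apply: reach_leq r2; rewrite mS.
  by rewrite (fits_dn q_neq0 w_neq0 lamE) ?hiO ?mulf_neq0 //; apply: fm.
by rewrite wtO_hiB // hiO.
Qed.

Hypothesis fits_i0 : forall k, S k -> fits i0 k.
Hypothesis fits_next : forall j : 'I_n, j = i0.+1 :> nat ->
  forall k, S k -> fits j k.

(** The hypotheses of [chain_step] for i and j = i + 1 ask for moves that change
    omega_i but nothing at j; the generators of index less than i provide them. *)
Lemma chain_right (j : 'I_n) : (i0 <= j)%N -> forall k, S k -> fits j k.
Proof.
move: {2}(val j) (leqnn j) => d; elim: d j => [|d IH] j jd i0j.
  by have -> : j = i0 by apply/val_inj => /=; lia.
case: (eqVneq (val j) (val i0)) => [/val_inj-> //|ji0].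
case: (eqVneq (val j) i0.+1) => [|ji1]; first exact: fits_next.
have Hi : (j.-1 < n)%N by have := ltn_ord j; lia.
have Hm : (j.-2 < n)%N by have := ltn_ord j; lia.
pose i : 'I_n := Ordinal Hi; pose m : 'I_n := Ordinal Hm.
have ji : j = i.+1 :> nat by rewrite /=; move/eqP: ji0 => /=; lia.
have im : i = m.+1 :> nat by move/eqP: ji0 => /=; move/eqP: ji1 => /=; lia.
have nm k : S k ->
    (exists2 k', reach m k k' & sh (q * O (hi m) k') != 0) /\
    (exists2 k', reach m k k' & sh (O (hi m) k') != 0).
  apply: (reach_normal (d := m - i0)); first by move/eqP: ji0; move/eqP: ji1; move: im => /=; lia.
  by move=> l /andP[l1 l2]; apply: IH => //; lia.
have same k k' : S k -> reach m k k' -> same_at q S c w j k k'.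
  move=> Sk r; split; first exact: reach_S r.
  - by apply: reach_far r; rewrite // ji im.
  - by apply: reach_O r; rewrite /= ji im.
  - by apply: reach_O r; rewrite /= /bump /= ji im; lia.
apply: (chain_step q_neq0 q_nroot H w_neq0 lamE ji) => k Sk.
- by apply: IH => //=; move/eqP: ji0 => /=; lia.
- have [[k' r nz] _] := nm k Sk; exists k'; first exact: same.
  by rewrite -(hi_lo im).
- have [_ [k' r nz]] := nm k Sk; exists k'; first exact: same.
  by rewrite -(hi_lo im).
Qed.

End Chain.

(** * Systems with an injective generator are of Weyl type *)

Section WeylType.
Variables (F : fieldType) (q : F) (n : nat).
Hypotheses (q_neq0 : q != 0) (q_nroot : not_root_of_unity q).
Local Notation L := (lattice n).
Implicit Types (lam : 'I_n -> F) (S : L -> Prop) (c : 'I_n -> L -> F).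
Implicit Types (w : 'I_n.+1 -> F) (k : L).

Definition weyl_type lam S c := exists w, [/\ forall l, w l != 0,
  forall i, lam i = w (lo i) / w (hi i) &
  forall i k, S k -> fits_at q w c i k].

Definition flip_w w l := (q * w (rev_ord l))^-1.
Definition swap_w w l := (q * w l)^-1.

Lemma wtO_flip w l k :
  wtO q (flip_w w) l k = (q * wtO q w (rev_ord l) (flip k))^-1.
Proof.
rewrite !wtO.unlock /flip_w ffunE rev_ordK !invfM invr_expz opprK.
by rewrite mulrA.
Qed.

Lemma wtO_swap w l k : wtO q (swap_w w) l k = (q * wtO q w l (- k))^-1.
Proof. by rewrite !wtO.unlock /swap_w ffunE !invfM invr_expz opprK mulrA. Qed.

Let ch_inverses (a b : F) : a != 0 -> b != 0 ->
  ch (q * (q * a)^-1 * (q * b)^-1) = ch (q * b * a).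
Proof. by move=> a0 b0; rewrite -[LHS]chV; congr ch; field_nz. Qed.

Lemma fits_flip w c i k : (forall l, w l != 0) ->
  fits_at q w c (rev_ord i) (flip k) <-> fits_at q (flip_w w) (flip_c c) i k.
Proof.
move=> w0; rewrite /fits_at /flip_c !wtO_flip rev_lo rev_hi.
by rewrite ch_inverses ?wtO_neq0.
Qed.

Lemma weyl_type_flip lam S c :
  weyl_type (flip_lam lam) (flip_S S) (flip_c c) -> weyl_type lam S c.
Proof.
move=> [w [w0 lamE wf]]; exists (flip_w w); split.
- by move=> l; rewrite invr_neq0 // mulf_neq0.
- move=> i; have := lamE (rev_ord i); rewrite /flip_lam rev_ordK => ->.
  by rewrite /flip_w rev_lo rev_hi; field_nz.
- move=> i k Sk; rewrite /fits_at !wtO_flip rev_lo rev_hi.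
  rewrite ch_inverses ?wtO_neq0 //.
  have := wf (rev_ord i) (flip k); rewrite /fits_at /flip_S /flip_c flipK rev_ordK.
  exact.
Qed.

Lemma weyl_type_swap lam S c :
  weyl_type (swap_lam lam) (swap_S S) (swap_c c) -> weyl_type lam S c.
Proof.
move=> [w [w0 lamE wf]]; exists (swap_w w); split.
- by move=> l; rewrite invr_neq0 // mulf_neq0.
- move=> i; rewrite -[LHS]invrK; have := lamE i; rewrite /swap_lam => ->.
  by rewrite /swap_w; field_nz.
- move=> i k Sk; rewrite /fits_at !wtO_swap ch_inverses ?wtO_neq0 //.
  have := wf i (- k); rewrite /fits_at /swap_S /swap_c opprK => -> //.
  by congr ch; rewrite mulrAC.
Qed.

(** The ratios of consecutive w are prescribed, hence so are all w given one. *)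
Lemma weyl_vector lam (l0 : 'I_n.+1) (a : F) :
  (forall i, lam i != 0) -> a != 0 ->
  exists w, [/\ forall l, w l != 0, forall i, lam i = w (lo i) / w (hi i) &
    w l0 = a].
Proof.
move=> lam0 a0; pose u (l : 'I_n.+1) := \prod_(m < n | (m < l)%N) (lam m)^-1.
have u0 l : u l != 0 by apply/prodf_neq0 => i _; rewrite invr_neq0.
have uS i : u (hi i) = (lam i)^-1 * u (lo i).
  rewrite /u (bigD1 i) /= /bump /= ?add1n ?ltnS //; congr (_ * _).
  by apply: eq_bigl => m; rewrite ltnS -val_eqE /= ltn_neqAle andbC.
exists (fun l => a * u l / u l0); split.
- by move=> l; rewrite !mulf_neq0 ?invr_neq0.
- move=> i; rewrite uS; have := u0 l0; have := u0 (lo i); have := lam0 i.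
  by move: (u (lo i)) (u l0) (lam i) => x y z x0 y0 z0; field_nz.
- by rewrite mulfK.
Qed.

End WeylType.

Section RightNeighbour.
Variables (F : fieldType) (q : F) (n : nat).
Hypothesis F_quadratic : forall p : {poly F}, size p = 3%N -> exists x, root p x.
Hypotheses (q_neq0 : q != 0) (q_nroot : not_root_of_unity q).
Local Notation L := (lattice n).
Variables (lam : 'I_n -> F) (S : L -> Prop) (c : 'I_n -> L -> F).
Hypothesis H : pointed_system q lam S c.
Local Notation K := (wtK q lam).
Local Notation up := (raise_coef q lam c).
Local Notation dn := (lower_coef q lam c).

Lemma square_root (a : F) : a != 0 -> exists2 x, x != 0 & x ^+ 2 = a.
Proof.
move=> a0; have [|x] := F_quadratic (p := 'X^2 - a%:P).
  exact: size_XnsubC.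
rewrite rootE !hornerE subr_eq0 => /eqP xa; exists x => //.
by apply: contra a0 => /eqP x0; rewrite -xa x0 expr0n.
Qed.

Lemma ch_root (a : F) : exists2 x, x != 0 & ch x = a.
Proof.
have [|x] := F_quadratic (p := 'X^2 + ((- a) *: 'X + 1%:P)).
  rewrite size_polyDl ?size_polyXn // (leq_ltn_trans (size_polyD _ _)) //.
  rewrite size_polyC oner_eq0 /= gtn_max.
  by rewrite (leq_ltn_trans (size_scale_leq _ _)) // size_polyX.
rewrite rootE !hornerE => /eqP e; have {}e : x ^+ 2 + - a * x + 1 = 0 := e.
have x0 : x != 0.
  apply/eqP=> x0; move/eqP: e; rewrite x0 expr0n mulr0 !add0r.
  by rewrite oner_eq0.
exists x => //; apply: (mulIf x0); apply/eqP; rewrite -subr_eq0 -e; apply/eqP.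
by rewrite /ch; field_nz.
Qed.

Variables (i j : 'I_n).
Hypothesis ij : j = i.+1 :> nat.
Hypothesis inj : forall k, S k -> up i k != 0.
Variable k0 : L.
Hypothesis S0 : S k0.

Let aij : adjacent i j. Proof. by rewrite /adjacent ij eqxx. Qed.
Let hiE : hi i = lo j.
Proof. by apply/val_inj; rewrite /= /bump /= add1n ij. Qed.

Section Model.
Variables (w : 'I_n.+1 -> F).
Hypothesis w_neq0 : forall l, w l != 0.
Hypothesis lamE : forall i, lam i = w (lo i) / w (hi i).
Local Notation O := (wtO q w).
Local Notation fits := (fits_at q w c).
Local Notation pv := (pair_value q lam c i j).
Let model k := q * O (lo j) k * O (hi j) k.
Hypothesis pv0 : pv k0 (model k0).

Let O0 l k : O l k != 0. Proof. exact: wtO_neq0. Qed.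

Let step_factor l : exists2 f, f != 0 & forall k t, S k -> up l k != 0 ->
  pv k t -> pv (k + alpha l) (f * t) /\ model (k + alpha l) = f * model k.
Proof.
have vE (a b : 'I_n.+1) : (a != b) = (val a != val b) by [].
case: (eqVneq l i) => [->|li].
  exists q^-1; rewrite ?invr_neq0 // => k t Sk u P; split.
    by rewrite mulrC; apply: (pair_value_i q_neq0 q_nroot H aij inj).
  have e : O (hi j) (k + alpha i) = O (hi j) k.
    by apply: wtO_id; rewrite // vE /= /bump /= ?add1n; lia.
  by rewrite /model -hiE wtO_hi // hiE e; ring.
case: (index_cases j l) => [<-|jl|jl].
- exists 1; rewrite ?oner_neq0 // => k t Sk u P; split.
    by rewrite mul1r; apply: (pair_value_j q_neq0 q_nroot H aij inj).
  by rewrite /model wtO_lo // wtO_hi //; field_nz.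
- have lE : l = j.+1 :> nat.
    have := li; rewrite -val_eqE /=; move: jl; rewrite /adjacent; lia.
  exists q => // k t Sk u P; split.
    by apply: (pair_value_next q_neq0 q_nroot H aij inj) => //; rewrite eq_sym.
  have -> : model (k + alpha l) = q * O (lo j) k * (q * O (hi j) k).
    rewrite /model; congr (_ * _ * _).
      by apply: wtO_id; rewrite // vE /= /bump /= ?add1n; lia.
    have -> : hi j = lo l by apply/val_inj; rewrite /= /bump /= add1n lE.
    exact: wtO_lo.
  by rewrite /model; ring.
- exists 1; rewrite ?oner_neq0 // => k t Sk u P; split.
    by rewrite mul1r; apply: (pair_value_far q_neq0 q_nroot H aij inj) => //; rewrite eq_sym.
  move: jl; rewrite /distant /model mul1r => jl; congr (_ * _ * _);
    by apply: wtO_id; rewrite // vE /= /bump /= ?add1n; lia.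
Qed.

(** Both t and the product q w_j w_(j+1) are multiplied by the same factor at each
    step. *)
Lemma pair_value_model k : S k -> pv k (model k).
Proof.
apply: (ps_conn H (P := fun k => pv k (model k)) S0 pv0) => l {}k Sk P u; have [f f0 fP] := step_factor l.
  by have [P' e] := fP _ _ Sk u P; rewrite e.
have Sv := S_dn H Sk u; have [t Pt] := pair_value_exists q_neq0 q_nroot H aij inj Sv.
have u' : up l (k - alpha l) != 0 by rewrite (up_dn q_neq0 H).
have [P' e] := fP _ _ Sv u' Pt; rewrite subrK in P' e.
suff -> : model (k - alpha l) = t by [].
by apply: (mulfI f0); rewrite -e (pair_value_uniq q_neq0 q_nroot P P').
Qed.

Lemma model_fits_j k : S k -> fits j k.
Proof.
move=> /pair_value_model[_ cj _]; have := cj 0%N.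
by rewrite addr0 expr0 invr1 mulr1.
Qed.

Lemma model_fits_i k : S k -> fits i k.
Proof.
move=> /pair_value_model[_ _ ci]; rewrite /fits_at ci !(wtK_O q_neq0 lamE) hiE.
by congr ch; rewrite /model; field_nz.
Qed.

(** Let z be q w_i w_(i+1), known to fit c_i, and s the value of the pair (i, l),
    which also fits: ch z = ch (K_i K_l s). Applying E_j changes z to q z and
    K_i K_l s to K_i K_l s / q, so z and K_i K_l s are inverse to each other, on any
    v that E_j or F_j does not kill. *)
Lemma model_left (l : 'I_n) : i = l.+1 :> nat -> forall k, S k -> fits l k.
Proof.
move=> il; have ail : adjacent i l by rewrite /adjacent il eqxx orbT.
have hlE : hi l = lo i by apply/val_inj; rewrite /= /bump /= add1n il.
have djl : distant j l by rewrite /distant ij il ltnSn orbT.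
have dlj : distant l j by rewrite distantC.
have neq_ij : i != j := adjacent_neq aij.
pose pl := pair_value q lam c i l.
pose z k := q * O (lo i) k * O (hi i) k.
have z0 k : z k != 0 by rewrite !mulf_neq0.
have KK0 k : K i k * K l k != 0.
  by rewrite mulf_neq0 //; apply: (wtK_neq0 q_neq0 (ps_lam H)).
have zi k : z (k + alpha i) = z k.
  by rewrite /z wtO_lo // wtO_hi //; field_nz.
have zj k : z (k + alpha j) = q * z k.
  rewrite /z hiE wtO_lo // wtO_id; first by ring.
  - by [].
  - by rewrite -val_eqE /= ij; lia.
  - by rewrite -val_eqE /= /bump /= ij; lia.
have KKi k : K i (k + alpha i) * K l (k + alpha i) = q * (K i k * K l k).
  rewrite wtK_alpha // (wtK_adj q_neq0); first by field_nz.
  by rewrite adjacentC.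
have KKj k : K i (k + alpha j) * K l (k + alpha j) = q^-1 * (K i k * K l k).
  by rewrite (wtK_adj q_neq0) // (wtK_far q_neq0 _ _ dlj) mulrA.
have zch k s : S k -> pl k s -> ch (z k) = ch (K i k * K l k * s).
  by move=> Sk [_ _ <-]; rewrite (model_fits_i Sk).
have step k s : S k -> up j k != 0 -> pl k s -> pl (k + alpha j) s.
  by move=> Sk u P; apply: (pair_value_far q_neq0 q_nroot H ail inj) => //.
have q21 := q2_neq1 q_nroot.
have moved k s : S k -> up j k != 0 -> pl k s -> z k * (K i k * K l k * s) = 1.
  move=> Sk u P; have [s0 _ _] := P; have e := zch _ _ Sk P.
  have := zch _ _ (S_up H Sk u) (step _ _ Sk u P); rewrite zj KKj => e'.
  have nz : K i k * K l k * s != 0 by rewrite mulf_neq0.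
  case: (ch_inj (z0 k) nz e) => // ez; rewrite -ez in nz e' *.
  have {}e' : ch (q * z k) = ch (q^-1 * z k) by rewrite e' ez; congr ch; ring.
  case: (ch_inj _ _ e'); rewrite ?mulf_neq0 ?invr_neq0 //; last first.
    by move=> <-; field_nz.
  move/(mulIf (z0 k)) => qq; case/negP: q21.
  by rewrite expr2 {2}qq mulfV ?subrr.
have moved' k s : S k -> dn j k != 0 -> pl k s -> z k * (K i k * K l k * s) = 1.
  move=> Sk d P; have Sv := S_dn H Sk d; have vk := subrK (alpha j) k.
  have u : up j (k - alpha j) != 0 by rewrite (up_dn q_neq0 H).
  have [s' P'] := pair_value_exists q_neq0 q_nroot H ail inj Sv.
  have := step _ _ Sv u P'; rewrite vk => P2.
  rewrite -(pair_value_uniq q_neq0 q_nroot P2 P) -vk zj KKj.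
  rewrite -(moved _ _ Sv u P'); field_nz.
have nK k s : S k -> K j k ^+ 2 != 1 -> pl k s ->
    z k * (K i k * K l k * s) = 1.
  move=> Sk K2 P; case: (eqVneq (up j k) 0) => [e0|u]; last exact: moved.
  apply: moved' => //; apply: contra K2; rewrite /lower_coef.
  move: e0 => /eqP; rewrite subr_eq0 => /eqP ->.
  have nK := wtK_neq0 q_neq0 (ps_lam H) j k.
  rewrite [q * _]mulrC -sh_mul // mulf_eq0 sh_eq0 //.
  by rewrite (negbTE (sh_q_neq0 q_neq0 q_nroot)) orbF.
have all1 k s : S k -> pl k s -> z k * (K i k * K l k * s) = 1.
  move=> Sk P; case: (eqVneq (K j k ^+ 2) 1) => [K1|K1]; last exact: nK.
  have Si := S_up H Sk (inj Sk).
  have := nK _ _ Si _ (pair_value_i q_neq0 q_nroot H ail inj Sk P).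
  rewrite zi KKi (wtK_adj q_neq0 lam k (etrans (adjacentC _ _) aij)).
  rewrite exprMn K1 mulr1 exprVn invr_eq1 q_nroot // => <- //; field_nz.
move=> k Sk; have [s P] := pair_value_exists q_neq0 q_nroot H ail inj Sk.
have [s0 cl _] := P; have := cl 0%N; rewrite addr0 expr0 invr1 mulr1 => ce.
rewrite /fits_at ce -chV; congr ch; apply: (mulIf s0); rewrite mulVf //.
rewrite -(all1 _ _ Sk P) !(wtK_O q_neq0 lamE) hlE /z; field_nz.
Qed.

Lemma model_right (l : 'I_n) : (i <= l)%N -> forall k, S k -> fits l k.
Proof.
apply: (chain_right q_neq0 q_nroot H w_neq0 lamE inj model_fits_i) => l' l'E.
have -> : l' = j by apply/val_inj; rewrite /= l'E ij.
exact: model_fits_j.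
Qed.

Lemma model_fits (l : 'I_n) k : S k -> fits l k.
Proof.
move=> Sk; case: (leqP i l) => [il|li]; first exact: model_right.
have back (l' : 'I_n) x : fits (rev_ord l') (flip x) ->
    fits_at q (flip_w q w) (flip_c c) l' x.
  by move=> h; apply/(fits_flip q_neq0 c l' x w_neq0).
have : fits_at q (flip_w q w) (flip_c c) (rev_ord l) (flip k).
  apply: (@chain_right _ _ _ q_neq0 q_nroot _ _ _ (flip_system H)
    (flip_w q w) _ _ (rev_ord i)).
  - by move=> x; rewrite invr_neq0 // mulf_neq0.
  - move=> x; rewrite /flip_lam lamE /flip_w rev_lo rev_hi; field_nz.
  - by move=> x Sx; rewrite flip_up rev_ordK; apply: inj.
  - by move=> x Sx; apply: back; rewrite rev_ordK; apply: model_fits_i.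
  - move=> l' l'E x Sx; apply: back; apply: model_left => //.
    by move: l'E => /=; have := ltn_ord i; have := ltn_ord l'; lia.
  - by rewrite /=; have := ltn_ord i; lia.
  - by rewrite /flip_S flipK.
by move/(fits_flip q_neq0 c _ _ w_neq0); rewrite rev_ordK flipK.
Qed.

End Model.

(** The value t of the pair must be q w_j w_(j+1), and w_j / w_(j+1) is the value of
    K_j: this determines w_j up to a choice of square root. *)
Lemma right_weyl_type : weyl_type q lam S c.
Proof.
have [t P] := pair_value_exists q_neq0 q_nroot H aij inj S0.
have [t0 _ _] := P; have K0 := wtK_neq0 q_neq0 (ps_lam H) j k0.
have [|a a0 aE] := square_root (a := t * K j k0 / q).
  by rewrite !mulf_neq0 ?invr_neq0.
have [w [w0 lamE wE]] := weyl_vector (lo j) (a := a / q ^ (k0 (lo j)))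
  (ps_lam H) (mulf_neq0 a0 (invr_neq0 (expz_neq0 q_neq0 _))).
exists w; split=> // l k Sk; apply: model_fits => //.
suff <- : t = q * wtO q w (lo j) k0 * wtO q w (hi j) k0 by [].
have xE : wtO q w (lo j) k0 = a.
  by rewrite wtO.unlock wE divfK // expz_neq0.
have b0 : wtO q w (hi j) k0 != 0 by apply: wtO_neq0.
rewrite (wtK_O q_neq0 lamE) xE in aE; rewrite xE.
apply: (mulIf (mulf_neq0 a0 (invr_neq0 (mulf_neq0 q_neq0 b0)))).
have -> : t * (a / (q * wtO q w (hi j) k0)) = t * (a / wtO q w (hi j) k0) / q.
  by field_nz.
by rewrite -aE; field_nz.
Qed.
End RightNeighbour.

Section WeylTypeTheorem.
Variables (F : fieldType) (q : F) (n : nat).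
Hypothesis F_quadratic : forall p : {poly F}, size p = 3%N -> exists x, root p x.
Hypotheses (q_neq0 : q != 0) (q_nroot : not_root_of_unity q).
Local Notation L := (lattice n).
Implicit Types (lam : 'I_n -> F) (S : L -> Prop) (c : 'I_n -> L -> F).

Lemma injective_weyl_type lam S c (i : 'I_n) k0 : pointed_system q lam S c ->
  S k0 -> (1 < n)%N -> (forall k, S k -> raise_coef q lam c i k != 0) ->
  weyl_type q lam S c.
Proof.
move=> H S0 n1 inj; case: (ltnP i.+1 n) => [ltin|lein].
  by apply: (@right_weyl_type _ _ _ F_quadratic q_neq0 q_nroot _ _ _ H
    i (Ordinal ltin) erefl inj _ S0).
apply: (weyl_type_flip q_neq0).
have Hj : ((rev_ord i).+1 < n)%N by rewrite /=; have := ltn_ord i; lia.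
apply: (@right_weyl_type _ _ _ F_quadratic q_neq0 q_nroot _ _ _
  (flip_system H) (rev_ord i) (Ordinal Hj) erefl _ (flip k0)).
  by move=> k Sk; rewrite flip_up rev_ordK; apply: inj.
by rewrite /flip_S flipK.
Qed.

(** For n = 1 only c = t + t^-1 and then a square root have to be solved. *)
Lemma rank1_weyl_type lam S c k0 : pointed_system q lam S c -> S k0 ->
  n = 1%N -> weyl_type q lam S c.
Proof.
move=> H S0 n1; have n0 : (0 < n)%N by rewrite n1.
pose i : 'I_n := Ordinal n0.
have iE (j : 'I_n) : j = i by apply/val_inj => /=; have := ltn_ord j; lia.
have K0 := wtK_neq0 q_neq0 (ps_lam H) i k0.
have [t t0 tE] := ch_root F_quadratic (c i k0).
have [|a a0 aE] := square_root F_quadratic (a := t / (q * wtK q lam i k0)).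
  by rewrite mulf_neq0 ?invr_neq0 ?mulf_neq0.
have [w [w0 lamE wE]] := weyl_vector (hi i) (a := a / q ^ (k0 (hi i)))
  (ps_lam H) (mulf_neq0 a0 (invr_neq0 (expz_neq0 q_neq0 _))).
have xE : wtO q w (hi i) k0 = a by rewrite wtO.unlock wE divfK // expz_neq0.
have tO : t = q * wtO q w (lo i) k0 * wtO q w (hi i) k0.
  have b0 : wtO q w (lo i) k0 != 0 by apply: wtO_neq0.
  move: aE; rewrite (wtK_O q_neq0 lamE) xE => aE.
  have -> : t = t / (q * (wtO q w (lo i) k0 / a)) * q * wtO q w (lo i) k0 / a.
    by field_nz.
  by rewrite -aE; field_nz.
exists w; split=> // j k Sk; rewrite (iE j) /fits_at.
suff [-> <-] : c i k = ch t /\ t = q * wtO q w (lo i) k * wtO q w (hi i) k.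
  by [].
apply: (ps_conn H (P := fun k => c i k = ch t /\
  t = q * wtO q w (lo i) k * wtO q w (hi i) k) S0) Sk; first by [].
  move=> l x Sx [ex tx]; rewrite (iE l) => u; rewrite (ps_up H Sx u).2 ex tx.
  by split=> //; rewrite wtO_lo // wtO_hi //; field_nz.
move=> l x Sx [ex tx]; rewrite (iE l) => u; rewrite (ps_dn H Sx u).2 ex tx.
by split=> //; rewrite wtO_loB // wtO_hiB //; field_nz.
Qed.

End WeylTypeTheorem.

(** * Unbounded sets closed under balancing moves *)

Section Balancing.
Import Order.TTheory Num.Theory.
Variable n : nat.
Local Notation L := (lattice n).
Local Notation I := 'I_n.+1.
Variable X : L -> Prop.
Implicit Types (a b d : I) (y : L).

Definition transfer a b (p : int) y : L :=
  [ffun l => y l - (l == a)%:Z * p + (l == b)%:Z * p].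
Definition exchange a b y : L := [ffun l => y (tperm a b l)].
(** Moving p units from a to b is allowed as long as the difference y_a - y_b does
    not fall below its opposite: this is the property of weights that a string of a
    finite-dimensional sl_2-module gives. *)
Definition balanced_pair a b := forall y p,
  X y -> 0 <= p <= y a - y b -> X (transfer a b p y).

Lemma transferL a b p y : a != b -> transfer a b p y a = y a - p.
Proof. by move=> ab; rewrite ffunE eqxx (negbTE ab) mul1r mul0r addr0. Qed.

Lemma transferR a b p y : a != b -> transfer a b p y b = y b + p.
Proof.
by move=> ab; rewrite ffunE eqxx eq_sym (negbTE ab) mul1r mul0r subr0.
Qed.

Lemma transferD a b p y l : l != a -> l != b -> transfer a b p y l = y l.
Proof.
by move=> la lb; rewrite ffunE (negbTE la) (negbTE lb) !mul0r subr0 addr0.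
Qed.

Lemma exchange_balanced a b y : a != b ->
  balanced_pair a b -> balanced_pair b a -> X y -> X (exchange a b y).
Proof.
move=> ab Bab Bba Xy; case: (lerP (y b) (y a)) => h.
  have -> : exchange a b y = transfer a b (y a - y b) y.
    apply/ffunP=> l; rewrite !ffunE; case: tpermP => [->|->|/eqP/negbTE-> /eqP/negbTE->].
    - by rewrite eqxx (negbTE ab); lia.
    - by rewrite eqxx eq_sym (negbTE ab); lia.
    - by rewrite !mul0r subr0 addr0.
  by apply: Bab; rewrite // lexx subr_ge0 h.
have -> : exchange a b y = transfer b a (y b - y a) y.
  apply/ffunP=> l; rewrite !ffunE; case: tpermP => [->|->|/eqP/negbTE-> /eqP/negbTE->].
  - by rewrite eqxx (negbTE ab); lia.
  - by rewrite eqxx eq_sym (negbTE ab); lia.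
  - by rewrite !mul0r subr0 addr0.
by apply: Bba; rewrite // lexx subr_ge0 ltW.
Qed.

Lemma balanced_exchange a b d : a != b -> b != d -> a != d ->
  (forall y, X y -> X (exchange b d y)) -> balanced_pair a b ->
  balanced_pair a d.
Proof.
move=> ab bd ad Xbd Bab y p Xy /andP[p0 py].
have E := (eqxx, eq_sym b a, eq_sym d b, eq_sym d a, negbTE ab, negbTE bd, negbTE ad).
have -> : transfer a d p y = exchange b d (transfer a b p (exchange b d y)).
  apply/ffunP=> l; rewrite !ffunE tpermK; case: tpermP => [->|->|/eqP h1 /eqP h2].
  - by rewrite !E.
  - by rewrite !E.
  - by rewrite (negbTE h1) (negbTE h2).
apply: (Xbd); apply: Bab; first exact: Xbd.
by rewrite p0 !ffunE tpermL tpermD // eq_sym.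
Qed.

Lemma balanced_exchange' a b d : a != b -> b != d -> a != d ->
  (forall y, X y -> X (exchange b d y)) -> balanced_pair b a ->
  balanced_pair d a.
Proof.
move=> ab bd ad Xbd Bab y p Xy /andP[p0 py].
have E := (eqxx, eq_sym b a, eq_sym d b, eq_sym d a, negbTE ab, negbTE bd, negbTE ad).
have -> : transfer d a p y = exchange b d (transfer b a p (exchange b d y)).
  apply/ffunP=> l; rewrite !ffunE tpermK; case: tpermP => [->|->|/eqP h1 /eqP h2].
  - by rewrite !E.
  - by rewrite !E.
  - by rewrite (negbTE h1) (negbTE h2).
apply: (Xbd); apply: Bab; first exact: Xbd.
by rewrite p0 !ffunE tpermL tpermD // eq_sym.
Qed.

Hypothesis X_lo : forall i, balanced_pair (@lo n i) (hi i).
Hypothesis X_hi : forall i, balanced_pair (@hi n i) (lo i).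

(** The exchanges of adjacent coordinates conjugate one pair into any other. *)
Lemma all_balanced a b : a != b -> balanced_pair a b.
Proof.
suff both (x z : I) : (x < z)%N -> balanced_pair x z /\ balanced_pair z x.
  by move=> ab; case: (ltngtP a b) => [/both[]|/both[]|/val_inj e] //;
    rewrite e eqxx in ab.
move: {2}(z - x)%N (leqnn (z - x)) => m; elim: m x z => [|m IH] x z zx xz.
  by lia.
have Hj : (z.-1 < n)%N by have := ltn_ord z; lia.
pose j : 'I_n := Ordinal Hj.
have hj : z = hi j by apply/val_inj; rewrite /= /bump /=; lia.
case: (eqVneq x (lo j)) => [->|xj]; first by rewrite hj.
have xj' : (x < lo j)%N.
  by move: xj; rewrite -val_eqE /=; lia.
have [B1 B2] : balanced_pair x (lo j) /\ balanced_pair (lo j) x.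
  by apply: IH => //; rewrite /=; lia.
have xz' : x != hi j by rewrite -hj -val_eqE /=; lia.
have ex y : X y -> X (exchange (lo j) (hi j) y).
  by apply: exchange_balanced => //; apply: lo_neq_hi.
rewrite hj; split; [apply: (balanced_exchange xj) => // | apply: (balanced_exchange' xj) => //];
  exact: lo_neq_hi.
Qed.

Lemma exchange_X a b y : a != b -> X y -> X (exchange a b y).
Proof.
move=> ab; have ba : b != a by rewrite eq_sym.
by apply: exchange_balanced => //; apply: all_balanced.
Qed.

Definition large (M : int) (x : int) := (M <= x) || (x <= - M).

Variable s : int.
Hypothesis X_sum : forall y, X y -> \sum_l y l = s.
Hypothesis X_unbounded : forall M, exists2 y, X y & exists l, large M (y l).

Section Target.
Variable tau : L.
Hypothesis tau_sum : \sum_l tau l = s.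

Let fixed (D : {set I}) := forall M, exists y,
  [/\ X y, forall l, l \in D -> y l = tau l & exists2 l, l \notin D & large M (y l)].

(** The sum over the complement of D is fixed, so one large coordinate
    forces both a large positive and a large negative one. *)
Let spread (D : {set I}) : fixed D -> forall A : int, exists y a b,
  [/\ X y, forall l, l \in D -> y l = tau l, a \notin D /\ b \notin D,
      A <= y a & y b <= - A].
Proof.
move=> fD A0; pose A := `|A0|; pose r := \sum_(l | l \notin D) tau l.
(* A coordinate of size M cannot be compensated by n others of size at most A. *)
pose M := n.+1%:Z * A + `|r| + 1.
have [y [Xy yD [l0 l0D big]]] := fD M; exists y.
have rE : \sum_(l | l \notin D) y l = r.
  have := X_sum Xy; rewrite -tau_sum (bigID (mem D)) [RHS](bigID (mem D)) /=.
  by rewrite (eq_bigr tau) => [/addrI|l lD]; last exact: yD.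
have A_ge0 : 0 <= A by apply: normr_ge0.
have AA : A0 <= A by apply: ler_norm.
have sumA (P : pred I) : \sum_(l | P l) A <= n.+1%:Z * A.
  have -> : n.+1%:Z * A = \sum_(l : I) A.
    by rewrite sumr_const card_ord -mulr_natl natz.
  by rewrite [leRHS](bigID P) /= lerDl sumr_ge0.
have r1 : r <= `|r| by apply: ler_norm.
have r2 : - `|r| <= r by rewrite lerNl ler_normr lexx orbT.
have rD : r = y l0 + \sum_(l | (l \notin D) && (l != l0)) y l.
  by rewrite -rE (bigD1 l0).
have [a aD ya] : exists2 a, a \notin D & A <= y a.
  case: (pselect (exists2 a, a \notin D & A <= y a)) => // no; exfalso.
  have ub l : l \notin D -> y l <= A.
    by move=> lD; rewrite leNgt; apply/negP=> /ltW h; apply: no; exists l.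
  have := ub _ l0D; have : \sum_(l | (l \notin D) && (l != l0)) y l <= n.+1%:Z * A.
    apply: le_trans (sumA (fun l => (l \notin D) && (l != l0))).
    by apply: ler_sum => l /andP[lD _]; apply: ub.
  move: big rD; rewrite /large /M; have : y l0 < A by rewrite ltNge; apply/negP => h; apply: no; exists l0.
  move: (\sum_(l | _) _) => z; have : 0 <= n%:Z * A by rewrite mulr_ge0.
  have : n.+1%:Z * A = n%:Z * A + A by rewrite intS mulrDl mul1r addrC.
  lia.
have [b bD yb] : exists2 b, b \notin D & y b <= - A.
  case: (pselect (exists2 b, b \notin D & y b <= - A)) => // no; exfalso.
  have lb l : l \notin D -> - A <= y l.
    by move=> lD; rewrite leNgt; apply/negP=> /ltW h; apply: no; exists l.
  have : - (n.+1%:Z * A) <= \sum_(l | (l \notin D) && (l != l0)) y l.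
    apply: le_trans (_ : \sum_(l | (l \notin D) && (l != l0)) - A <= _).
      by rewrite sumrN lerN2; apply: (sumA (fun l => (l \notin D) && (l != l0))).
    by apply: ler_sum => l /andP[lD _]; apply: lb.
  move: big rD; rewrite /large /M; have : - A < y l0 by rewrite ltNge; apply/negP => h; apply: no; exists l0.
  move: (\sum_(l | _) _) => z; have : 0 <= n%:Z * A by rewrite mulr_ge0.
  have : n.+1%:Z * A = n%:Z * A + A by rewrite intS mulrDl mul1r addrC.
  lia.
by exists a, b; split; rewrite // ?(le_trans AA) // (le_trans yb) // lerN2.
Qed.

(** With three free coordinates, one of them can be adjusted against a large one of
    the right sign while a large one of the other sign is kept. *)
Let fixed_step (D : {set I}) (z : I) : z \notin D -> (2 < #|~: D|)%N ->
  fixed D -> fixed (z |: D).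
Proof.
move=> zD D3 fD M; pose A := `|M| + `|tau z| + 1.
have A1 : 0 < A by rewrite /A; lia.
have [y [a [b [Xy yD [aD bD] ya bz]]]] : exists y a b,
    [/\ X y, forall l, l \in D -> y l = tau l, a \notin D /\ b \notin D,
      A <= y a & y b <= - A /\ [/\ a != b, a != z & b != z]].
  have [y [a [b [Xy yD [aD bD] ya yb]]]] := spread fD A.
  have ab : a != b by apply/eqP=> e; move: ya yb; rewrite e; lia.
  case: (boolP (z \in [set a; b])); last first.
    rewrite !inE negb_or => /andP[h1 h2]; exists y, a, b.
    by split=> //; split=> //; split=> //; rewrite eq_sym.
  have [x] : exists x, x \in ~: D :\: [set a; b].
    apply/set0Pn; rewrite -card_gt0 cardsD subn_gt0.
    apply: leq_ltn_trans D3; apply: leq_trans (subset_leq_card (subsetIr _ _)) _.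
    by rewrite cards2; case: (a == b).
  rewrite !inE negb_or => /andP[/andP[xa xb] xD] /orP[/eqP zE|/eqP zE].
    exists (exchange z x y), x, b; rewrite zE; split.
    - by apply: exchange_X; rewrite // eq_sym.
    - move=> l lD; rewrite ffunE tpermD ?yD //.
        by apply: contraNneq aD => ->.
      by apply: contraNneq xD => ->.
    - by [].
    - by rewrite ffunE tpermR.
    - rewrite ffunE tpermD //; split=> //; split=> //; by rewrite eq_sym.
  exists (exchange z x y), a, x; rewrite zE; split.
  - by apply: exchange_X; rewrite // eq_sym.
  - move=> l lD; rewrite ffunE tpermD ?yD //.
      by apply: contraNneq bD => ->.
    by apply: contraNneq xD => ->.
  - by [].
  - by rewrite ffunE tpermD // eq_sym.
  - by rewrite ffunE tpermR; split=> //; split=> //; rewrite eq_sym.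
case: bz => [yb [ab az bz]].
case: (lerP (tau z) (y z)) => h.
  exists (transfer z b (y z - tau z) y); split.
  - by apply: all_balanced; rewrite 1?eq_sym //; lia.
  - move=> l; rewrite !inE !ffunE => /orP[/eqP->|lD].
      by rewrite eqxx eq_sym (negbTE bz); lia.
    have -> : l == z = false by apply: contraTF lD => /eqP->.
    have -> : l == b = false by apply: contraTF lD => /eqP->.
    by rewrite !mul0r subr0 addr0 yD.
  - exists a; first by rewrite !inE negb_or az.
    rewrite ffunE (negbTE az) (negbTE ab) /large; lia.
exists (transfer a z (tau z - y z) y); split.
- by apply: all_balanced => //; lia.
- move=> l; rewrite !inE !ffunE => /orP[/eqP->|lD].
    by rewrite eqxx eq_sym (negbTE az); lia.
  have -> : l == z = false by apply: contraTF lD => /eqP->.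
  have -> : l == a = false by apply: contraTF lD => /eqP->.
  by rewrite !mul0r subr0 addr0 yD.
- exists b; first by rewrite !inE negb_or bz.
  rewrite ffunE (negbTE bz) eq_sym (negbTE ab) /large; lia.
Qed.

Let fixed0 : fixed set0.
Proof.
move=> M; have [y Xy [l big]] := X_unbounded M.
by exists y; split=> // [x|]; [rewrite inE | exists l; rewrite // inE].
Qed.

Let fixed_all (D : {set I}) : (1 < #|~: D|)%N -> fixed D.
Proof.
move: {2}#|D| (leqnn #|D|) => m; elim: m D => [|m IH] D Dm D2.
  by have -> : D = set0 by apply/eqP; rewrite -cards_eq0 -leqn0.
case: (set_0Vmem D) => [->|[z zD]]; first exact: fixed0.
have cD := cardsD1 z D; rewrite zD add1n in cD.
have cE : (#|~: (D :\ z)| = #|~: D|.+1)%N.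
  have := cardsC D; have := cardsC (D :\ z); rewrite !card_ord; lia.
rewrite -(setD1K zD); apply: fixed_step; first by rewrite !inE eqxx.
  by rewrite cE.
by apply: IH; [lia | rewrite cE; lia].
Qed.

(** Once all coordinates but two are right, the last two have the right sum and one
    balancing move between them suffices. *)
Lemma unbounded_target : (0 < n)%N -> X tau.
Proof.
move=> n0; pose a : I := ord0; pose b : I := lift ord0 (Ordinal n0).
have ab : a != b by []; clearbody a b.
have DC : ~: (~: [set a; b]) = [set a; b] by rewrite setCK.
have fD : fixed (~: [set a; b]) by apply: fixed_all; rewrite DC cards2 ab.
have bound (x : int) : exists m : int, - m <= x <= m.
  by exists `|x|; rewrite -ler_norml.
have [na ta] := bound (tau a); have [nb tb] := bound (tau b).
pose M := na + nb + na + nb + 1.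
have [y [Xy yD [l lD big]]] := fD M.
have yE x : x != a -> x != b -> y x = tau x.
  by move=> xa xb; apply: yD; rewrite !inE negb_or xa xb.
have ysum : y a + y b = tau a + tau b.
  have := X_sum Xy; rewrite -tau_sum (bigD1 a) //= (bigD1 b) 1?eq_sym //=.
  rewrite [RHS](bigD1 a) //= [in RHS](bigD1 b) 1?eq_sym //= !addrA.
  rewrite (eq_bigr tau) => [/addIr //|x /andP[xa xb]]; exact: yE.
have {}lD : l = a \/ l = b.
  by move: lD; rewrite !inE negbK => /orP[/eqP|/eqP]; [left|right].
have {big} : large M (y a) || large M (y b).
  by apply/orP; case: lD => <-; [left|right].
rewrite /large /M => big; clear M.
have ba : b != a by rewrite eq_sym.
have e1 : tau a = y a - (y a - tau a) by rewrite subKr.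
have e2 : tau b = y b - (y b - tau b) by rewrite subKr.
have e3 : tau b = y b + (y a - tau a) by lia.
have e4 : tau a = y a + (y b - tau b) by lia.
case: (lerP (y b) (y a)) => h.
  have -> : tau = transfer a b (y a - tau a) y.
    apply/ffunP=> x; case: (eqVneq x a) => [->|xa]; first by rewrite transferL.
    case: (eqVneq x b) => [->|xb]; first by rewrite transferR.
    by rewrite transferD ?yE.
  by apply: all_balanced => //; lia.
have -> : tau = transfer b a (y b - tau b) y.
  apply/ffunP=> x; case: (eqVneq x a) => [->|xa]; first by rewrite transferR.
  case: (eqVneq x b) => [->|xb]; first by rewrite transferL.
  by rewrite transferD ?yE.
by apply: all_balanced => //; lia.
Qed.

End Target.
End Balancing.

(** * Locally nilpotent generators have bounded weights *)

Section Integrable.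
Import Order.TTheory Num.Theory.
Variables (F : fieldType) (q : F) (n : nat).
Hypotheses (q_neq0 : q != 0) (q_nroot : not_root_of_unity q).
Local Notation L := (lattice n).

Lemma wtK_run (lam : 'I_n -> F) i (k : L) m :
  wtK q lam i (k + alpha i *+ m) = q ^+ m.*2 * wtK q lam i k.
Proof.
elim: m => [|m IH]; first by rewrite addr0 mul1r.
by rewrite mulrSr addrA wtK_alpha // IH mulrA -exprD.
Qed.

Lemma string_top (lam : 'I_n -> F) S c i k : pointed_system q lam S c -> S k ->
  ends_at q lam c i k -> exists m : nat,
  [/\ raise_coef q lam c i (k + alpha i *+ m) = 0,
      forall p, (p <= m)%N ->
        S (k + alpha i *+ p) /\ c i (k + alpha i *+ p) = c i k &
      forall p, (p < m)%N -> raise_coef q lam c i (k + alpha i *+ p) != 0].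
Proof.
move=> H Sk [m0 /eqP e0].
have ex : exists m, raise_coef q lam c i (k + alpha i *+ m) == 0 by exists m0.
have [m /eqP e mmin] := ex_minnP ex.
have nz p : (p < m)%N -> raise_coef q lam c i (k + alpha i *+ p) != 0.
  by move=> pm; apply/negP => /mmin; rewrite leqNgt pm.
exists m; split=> //; elim=> [|p IH] pm; first by rewrite addr0.
have [Sp <-] := IH (ltnW pm); rewrite mulrSr addrA.
exact: (ps_up H Sp (nz p pm)).
Qed.

Variables (lam : 'I_n -> F) (S : L -> Prop) (c : 'I_n -> L -> F).
Hypothesis H : pointed_system q lam S c.
Local Notation K := (wtK q lam).
Local Notation up := (raise_coef q lam c).
Local Notation dn := (lower_coef q lam c).
Hypothesis up_ends : forall i k, S k -> ends_at q lam c i k.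
Hypothesis dn_ends : forall i k, swap_S S k ->
  ends_at q (swap_lam lam) (swap_c c) i k.

(** The Casimir element is constant on the string of weights through k, which has m
    steps above k and m' below. *)
Lemma string i k : S k -> exists m m' : nat,
  [/\ up i (k + alpha i *+ m) = 0, (0 < m')%N -> dn i k != 0,
      forall p, (p <= m)%N -> S (k + alpha i *+ p),
      forall p, (p <= m')%N -> S (k - alpha i *+ p) &
      K i k ^+ 2 * q ^+ m.*2 = q ^+ m'.*2].
Proof.
move=> Sk; have [m [um Sm _]] := string_top H Sk (up_ends i Sk).
have Sk' : swap_S S (- k) by rewrite /swap_S opprK.
have [m' [um' Sm' nz']] := string_top (swap_system q_neq0 H) Sk' (dn_ends i Sk').
exists m, m'; split=> //.
- by move=> m0; have := nz' 0%N m0; rewrite addr0 swap_up opprK.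
- by move=> p /Sm[].
- by move=> p /Sm'[]; rewrite /swap_S opprD opprK.
have [_ cm] := Sm m (leqnn m); have [_ cm'] := Sm' m' (leqnn m').
move: cm'; rewrite /swap_c opprD !opprK => cm'.
have K0 := wtK_neq0 q_neq0 (ps_lam H) i k.
have e1 : c i k = ch (q * (q ^+ m.*2 * K i k)).
  by move/eqP: um; rewrite subr_eq0 cm wtK_run => /eqP.
have e2 : c i k = ch (q ^- m'.*2 * K i k / q).
  move/eqP: um'; rewrite swap_up /lower_coef opprD !opprK subr_eq0 cm'.
  have -> : K i (k - alpha i *+ m') = q ^- m'.*2 * K i k.
    apply: (mulfI (expf_neq0 m'.*2 q_neq0)); rewrite -wtK_run subrK.
    by rewrite mulVKf ?expf_neq0.
  by move/eqP.
case: (@ch_inj _ (q * (q ^+ m.*2 * K i k)) (q ^- m'.*2 * K i k / q)).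
- by rewrite !mulf_neq0 ?expf_neq0.
- by rewrite !mulf_neq0 ?invr_neq0 ?expf_neq0.
- by rewrite -e1 e2.
- move=> e; exfalso; have := q_nroot (isT : 0 < 2 + (m.*2 + m'.*2))%N.
  case/negP; apply/eqP; apply: (mulIf K0); rewrite mul1r !exprD.
  transitivity (q * (q ^+ m.*2 * K i k) * q ^+ m'.*2 * q); first by ring.
  by rewrite e; field_nz.
move=> e; apply: (mulIf (invr_neq0 (expf_neq0 m'.*2 q_neq0))).
rewrite divff ?expf_neq0 // -e; field_nz.
Qed.

Hypothesis sumS : forall k, S k -> \sum_l k l = 0.
Hypothesis n_gt0 : (0 < n)%N.
Variable k0 : L.
Hypothesis S0 : S k0.

Lemma gl_shift (h : 'I_n -> int) :
  exists rho : L, forall i, rho (lo i) - rho (hi i) = h i.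
Proof.
pose u (l : 'I_n.+1) := \sum_(m < n | (m < l)%N) h m.
have uS i : u (hi i) = h i + u (lo i).
  rewrite /u (bigD1 i) /= /bump /= ?add1n ?ltnS //; congr (_ + _).
  by apply: eq_bigl => m; rewrite ltnS -val_eqE /= ltn_neqAle andbC.
by exists [ffun l => - u l] => i; rewrite !ffunE uS opprK addrC addrK.
Qed.

(** Up to sign, K_i is q to the power y_i - y_(i+1), for y in a translate of S. *)
Lemma integral_weights : exists rho : L, forall i y,
  K i (y - rho + k0) ^+ 2 = q ^ ((y (lo i) - y (hi i)) *+ 2).
Proof.
have hP i : exists h : int, K i k0 ^+ 2 = q ^ (h *+ 2).
  have [m [m' [_ _ _ _ e]]] := string i S0; exists (m'%:Z - m%:Z).
  rewrite mulrnBl expfzDr // -invr_expz; apply: (mulIf (expf_neq0 m.*2 q_neq0)).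
  rewrite e; have E (a : nat) : q ^ (a%:Z *+ 2) = q ^+ a.*2.
    by rewrite mulr2n -PoszD addnn.
  by rewrite !E divfK // expf_neq0.
have [h hE] := fin_all_exists hP; have [rho rhoE] := gl_shift h.
exists rho => i y; rewrite addrC wtKD // exprMn hE -rhoE expr2 !mulr2n.
by rewrite -!expfzDr //; congr (q ^ _); rewrite !ffunE; ring.
Qed.

Hypothesis S_unbounded :
  forall M, exists2 k, S k & exists l, large M (k l).

(** The translated support is balanced and unbounded, so it contains every
    vector with the right coordinate sum. *)
Lemma integrable_full m : S (k0 + alpha (Ordinal n_gt0) *+ m).
Proof.
have [rho rhoE] := integral_weights.
pose X y := S (y - rho + k0).
have main i y : X y -> exists m m' : nat,
    [/\ forall p, (p <= m)%N -> X (y + alpha i *+ p),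
        forall p, (p <= m')%N -> X (y - alpha i *+ p) &
        y (lo i) - y (hi i) = m'%:Z - m%:Z].
  move=> Xy; have [a [b [_ _ Sa Sb e]]] := string i Xy; exists a, b; split.
  - by move=> p /Sa; rewrite /X; congr S; rewrite addrAC [y - _ + _]addrAC.
  - by move=> p /Sb; rewrite /X; congr S; rewrite addrAC [y - _ + _]addrAC.
  move: e; rewrite rhoE.
  have E (x : nat) : q ^+ x.*2 = q ^ (x%:Z *+ 2) by rewrite mulr2n -PoszD addnn.
  rewrite !E -expfzDr // => /(expz_inj q_neq0 q_nroot); lia.
have tlo i y (p : nat) : transfer (lo i) (hi i) p%:Z y = y - alpha i *+ p.
  apply/ffunP=> l; rewrite !ffunE ffunMnE !ffunE -mulr_natr natz; ring.
have thi i y (p : nat) : transfer (hi i) (lo i) p%:Z y = y + alpha i *+ p.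
  apply/ffunP=> l; rewrite !ffunE ffunMnE !ffunE -mulr_natr natz; ring.
have Xlo i : balanced_pair X (lo i) (hi i).
  move=> y [p|p] Xy // /andP[_ py]; have [a [b [_ Xb e]]] := main i y Xy.
  by rewrite tlo; apply: Xb; rewrite e in py; lia.
have Xhi i : balanced_pair X (hi i) (lo i).
  move=> y [p|p] Xy // /andP[_ py]; have [a [b [Xa _ e]]] := main i y Xy.
  rewrite thi; apply: Xa.
  have {}e : y (hi i) - y (lo i) = a%:Z - b%:Z by rewrite -opprB e opprB.
  by rewrite e in py; lia.
have Xsum y : X y -> \sum_l y l = \sum_l rho l.
  move=> /sumS; rewrite (eq_bigr (fun l => y l - rho l + k0 l)); last first.
    by move=> l _; rewrite !ffunE.
  by rewrite big_split /= sumrB (sumS S0) addr0 => /eqP; rewrite subr_eq0 => /eqP.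
have Xunb M : exists2 y, X y & exists l, large M (y l).
  pose B := \sum_l `|rho l - k0 l|.
  have [k Sk [l big]] := S_unbounded (M + B).
  exists (k + rho - k0); first by rewrite /X [_ - k0 - _]addrAC addrK subrK.
  exists l; rewrite !ffunE; have : `|rho l - k0 l| <= B.
    by rewrite /B (bigD1 l) //= lerDl sumr_ge0.
  rewrite ler_norml; move: big; rewrite /large.
  move: B (k l) (rho l) (k0 l) => B' x y z; lia.
have := unbounded_target Xlo Xhi Xsum Xunb
  (tau := k0 + alpha (Ordinal n_gt0) *+ m + rho - k0).
rewrite /X [_ - k0 - _]addrAC addrK subrK; apply=> //.
transitivity (\sum_l (k0 l + alpha (Ordinal n_gt0) l *+ m + rho l - k0 l)).
  by apply: eq_bigr => l _; rewrite !ffunE ffunMnE ?ffunE.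
rewrite sumrB !big_split /= (sumS S0) add0r sumrMnl sum_alpha mul0rn add0r.
by rewrite subr0.
Qed.

(** E_0 kills a vector v at the top of its string, yet the weight space one step
    further is nonzero, and its own string cannot reach down to v. *)
Lemma not_integrable : False.
Proof.
pose i := Ordinal n_gt0; have full m : S (k0 + alpha i *+ m) := integrable_full m.
have [m [m' [um _ _ _ e]]] := string i S0.
have [a [b [_ dnz _ _ e']]] := string i (full m.+1).
case: b dnz e' => [_|b dnz _]; last first.
  have := dnz isT; have := up_dn q_neq0 H (full m.+1) (dnz isT).
  by rewrite mulrSr addrA addrK um => <-; rewrite eqxx.
have qq := q_nroot (isT : 0 < 4 + (m'.*2 + (m.*2 + a.*2)))%N.
rewrite wtK_run exprMn => e'; case/negP: qq; apply/eqP.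
transitivity ((q ^+ m.+1.*2) ^+ 2 * K i k0 ^+ 2 * q ^+ a.*2); last exact: e'.
apply: (mulIf (expf_neq0 m.*2 q_neq0)).
transitivity ((q ^+ m.+1.*2) ^+ 2 * (K i k0 ^+ 2 * q ^+ m.*2) * q ^+ a.*2);
  last by ring.
rewrite e -!exprM -!exprD; congr (q ^+ _); lia.
Qed.

End Integrable.

(** * Classification of the systems of Casimir values *)

Section PointedSystemTheorem.
Variables (F : fieldType) (q : F) (n : nat).
Hypothesis F_quadratic : forall p : {poly F}, size p = 3%N -> exists x, root p x.
Hypotheses (q_neq0 : q != 0) (q_nroot : not_root_of_unity q) (n_gt0 : (0 < n)%N).
Local Notation L := (lattice n).
Variables (lam : 'I_n -> F) (S : L -> Prop) (c : 'I_n -> L -> F).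
Hypothesis H : pointed_system q lam S c.

Theorem pointed_system_weyl_type k0 : S k0 ->
  (forall k, S k -> \sum_l k l = 0) ->
  (forall M, exists2 k, S k & exists l, large M (k l)) ->
  weyl_type q lam S c.
Proof.
move=> S0 sumS unb; case: (eqVneq n 1%N) => [n1|n1].
  exact: (rank1_weyl_type F_quadratic q_neq0 H S0 n1).
have {}n1 : (1 < n)%N by rewrite ltn_neqAle eq_sym n1.
have Hs := swap_system q_neq0 H.
case: (pselect (exists i, forall k, S k -> raise_coef q lam c i k != 0)).
  move=> [i inj]; exact: (injective_weyl_type F_quadratic q_neq0 q_nroot H S0 n1 inj).
move=> noE; case: (pselect (exists i, forall k, swap_S S k ->
    raise_coef q (swap_lam lam) (swap_c c) i k != 0)).
  move=> [i inj]; apply: (weyl_type_swap q_neq0).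
  apply: (injective_weyl_type F_quadratic q_neq0 q_nroot Hs _ n1 inj (k0 := - k0)).
  by rewrite /swap_S opprK.
move=> noF; exfalso; apply: (not_integrable q_neq0 q_nroot H _ _ sumS n_gt0 S0 unb).
  move=> i; case: (injective_or_ends q_neq0 H i) => // inj.
  by case: noE; exists i.
move=> i; case: (injective_or_ends q_neq0 Hs i) => // inj.
by case: noF; exists i.
Qed.

End PointedSystemTheorem.

(** * Values of words in the generators *)

Section Words.
Variables (F : fieldType) (n : nat).
Local Notation L := (lattice n).
Local Notation letter := (bool * 'I_n)%type.
Implicit Types (eps phi : 'I_n -> L -> F) (k : L) (w u v : seq letter).

Definition step (x : letter) : L := if x.1 then alpha x.2 else - alpha x.2.
Definition flipped (x : letter) : letter := (~~ x.1, x.2).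
Definition coef eps phi (x : letter) k := if x.1 then eps x.2 k else phi x.2 k.
Definition wt w : L := \sum_(x <- w) step x.

(* The head of the word acts first. *)
Fixpoint value eps phi w k : F :=
  if w is x :: w' then coef eps phi x k * value eps phi w' (k + step x) else 1.

Lemma value_cat eps phi u v k :
  value eps phi (u ++ v) k = value eps phi u k * value eps phi v (k + wt u).
Proof.
elim: u k => [|x u IH] k; first by rewrite /wt big_nil addr0 mul1r.
by rewrite /= IH mulrA /wt big_cons addrA.
Qed.

Definition commuting eps phi := forall i j k, i != j ->
  eps i (k - alpha j) * phi j k = phi j (k + alpha i) * eps i k.

(** Equality of words as products when the only relations are E_i F_j = F_j E_i for
    distinct i and j. *)
Definition word_eq w w' := perm_eq w w' /\ forall eps phi, commuting eps phi ->
  forall k, value eps phi w k = value eps phi w' k.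

Lemma word_eq_trans w w' w'' : word_eq w w' -> word_eq w' w'' -> word_eq w w''.
Proof.
move=> [p e] [p' e']; split; first exact: perm_trans p'.
by move=> eps phi c k; rewrite e // e'.
Qed.

Lemma word_eq_sym w w' : word_eq w w' -> word_eq w' w.
Proof. by move=> [p e]; split; [rewrite perm_sym | move=> *; rewrite e]. Qed.

Lemma word_eq_cat u v w w' : word_eq w w' -> word_eq (u ++ w ++ v) (u ++ w' ++ v).
Proof.
move=> [p e]; split; first by rewrite perm_cat2l perm_cat2r.
move=> eps phi c k; rewrite !value_cat e //.
by rewrite /wt (perm_big _ p).
Qed.

Lemma word_eq_cons x w w' : word_eq w w' -> word_eq (x :: w) (x :: w').
Proof. by move=> /(word_eq_cat [:: x] [::]); rewrite !cats0. Qed.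

Local Notation E := (pair true).
Local Notation Fl := (pair false).

Lemma swap_FE i j v : i != j -> word_eq (Fl j :: E i :: v) (E i :: Fl j :: v).
Proof.
move=> ij; apply: (word_eq_cat [::] v (w := [:: Fl j; E i]) (w' := [:: E i; Fl j])).
split; first by rewrite -[[:: Fl j; E i]]/(rcons [:: Fl j] (E i)) perm_rcons.
by move=> eps phi c k; rewrite /= /coef /= /step /= !mulr1 mulrC c // mulrC.
Qed.

Lemma swap_Fs j es v : j \notin es ->
  word_eq (Fl j :: map E es ++ v) (map E es ++ Fl j :: v).
Proof.
elim: es => [|i es IH] //=; rewrite inE negb_or => /andP[ji jes].
apply: word_eq_trans (swap_FE _ _) (word_eq_cons _ (IH jes)).
by rewrite eq_sym.
Qed.

Lemma swap_Es j fs v : j \notin fs ->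
  word_eq (E j :: map Fl fs ++ v) (map Fl fs ++ E j :: v).
Proof.
elim: fs => [|i fs IH] //=; rewrite inE negb_or => /andP[ji jfs].
apply: word_eq_trans (word_eq_sym (swap_FE _ _)) (word_eq_cons _ (IH jfs)).
exact: ji.
Qed.

Definition cancels w :=
  exists u x v, word_eq w (u ++ [:: x; flipped x] ++ v).

Lemma cancels_cat u w v : cancels w -> cancels (u ++ w ++ v).
Proof.
move=> [u' [x [v' e]]]; exists (u ++ u'), x, (v' ++ v).
by have := word_eq_cat u v e; rewrite !catA.
Qed.

Lemma first_occurrence (j : 'I_n) s : j \in s ->
  exists s1 s2, s = s1 ++ j :: s2 /\ j \notin s1.
Proof.
elim: s => [|i s IH] //; rewrite inE; case: (eqVneq j i) => [<- _|ji /= /IH].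
  by exists [::], s.
move=> [s1 [s2 [-> js1]]]; exists (i :: s1), s2; split=> //.
by rewrite inE negb_or ji.
Qed.

Lemma normal_form w :
  cancels w \/ exists es fs, word_eq w (map E es ++ map Fl fs).
Proof.
elim: w => [|x w [c|[es [fs e]]]].
- by right; exists [::], [::].
- by left; have := cancels_cat [:: x] [::] c; rewrite cats0.
case: x => [[] j]; first by right; exists (j :: es), fs; apply: word_eq_cons.
case: (boolP (j \in es)) => [/first_occurrence[e1 [e2 [eE je1]]]|je].
  left; exists (map E e1), (Fl j), (map E e2 ++ map Fl fs).
  apply: word_eq_trans (word_eq_cons _ e) _; rewrite eE map_cat -catA.
  exact: swap_Fs.
right; exists es, (j :: fs).
by apply: word_eq_trans (word_eq_cons _ e) _; apply: swap_Fs.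
Qed.

(** The coordinates in the basis of simple roots. *)
Definition height (j : 'I_n) (k : L) : int := \sum_(l < n.+1 | (l <= j)%N) k l.

Lemma heightD j k l : height j (k + l) = height j k + height j l.
Proof. by rewrite -big_split; apply: eq_bigr => x _; rewrite ffunE. Qed.

Lemma height0 j : height j 0 = 0.
Proof. by rewrite /height big1 // => x _; rewrite ffunE. Qed.

Lemma heightN j k : height j (- k) = - height j k.
Proof. by rewrite /height -sumrN; apply: eq_bigr => x _; rewrite ffunE. Qed.

Lemma height_alpha j i : height j (alpha i) = (i == j)%:Z.
Proof.
have E1 (a : 'I_n.+1) : \sum_(l < n.+1 | (l <= j)%N) (l == a)%:Z = (a <= j)%N%:Z :> int.
  case: (boolP (a <= j)%N) => aj.
    by rewrite (bigD1 a) //= eqxx big1 ?addr0 // => l /andP[_ /negbTE->].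
  rewrite big1 // => l lj; case: eqP => // la; by rewrite -la lj in aj.
rewrite /height (eq_bigr (fun l : 'I_n.+1 => (l == lo i)%:Z - (l == hi i)%:Z)); last first.
  by move=> l _; rewrite ffunE.
rewrite sumrB !E1 /= /bump /= add1n -val_eqE /=; lia.
Qed.

Lemma height_normal j es fs : height j (wt (map E es ++ map Fl fs)) =
  (count_mem j es)%:Z - (count_mem j fs)%:Z.
Proof.
rewrite /wt big_cat heightD /=; congr (_ + _).
  elim: es => [|i es IH]; first by rewrite big_nil height0.
  by rewrite /= big_cons heightD IH height_alpha PoszD.
elim: fs => [|i fs IH]; first by rewrite big_nil height0.
by rewrite /= big_cons heightD IH heightN height_alpha PoszD opprD.
Qed.

(** Move all E to the front: a closed word in normal form has as many E_j as F_j
    for each j, so its last E meets an F with the same index. *)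
Lemma closed_cancels w : wt w = 0 -> w != [::] -> cancels w.
Proof.
move=> w0 wn; case: (normal_form w) => // -[es [fs e]].
have cE j : count_mem j es = count_mem j fs.
  apply/eqP; rewrite -eqz_nat -subr_eq0 -height_normal.
  have <- : wt w = wt (map E es ++ map Fl fs) by apply: perm_big e.1.
  by rewrite w0 height0.
case: (lastP es) e cE => [|es1 j] e cE.
  case: fs e cE => [|j fs] e cE.
    by case: e => /perm_size /eqP; rewrite /= size_eq0 (negbTE wn).
  by have := cE j; rewrite /= eqxx.
have : j \in fs by rewrite -has_pred1 has_count -cE -has_count has_pred1 mem_rcons mem_head.
move=> /first_occurrence[f1 [f2 [fE jf1]]].
exists (map E es1 ++ map Fl f1), (E j), (map Fl f2).
apply: word_eq_trans e _; rewrite map_rcons cat_rcons fE map_cat -!catA.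
have := word_eq_cat (map E es1) [::] (swap_Es (Fl j :: map Fl f2) jf1).
by rewrite !cats0.
Qed.

Section Determination.
Variables (S : L -> Prop) (eps phi eps' phi' : 'I_n -> L -> F).
Hypothesis C : commuting eps phi.
Hypothesis C' : commuting eps' phi'.
Hypothesis epsS : forall i k, eps i k != 0 -> S (k + alpha i).
Hypothesis phiS : forall i k, phi i k != 0 -> S (k - alpha i).
Hypothesis agreeE : forall i k, S k ->
  phi i (k + alpha i) * eps i k = phi' i (k + alpha i) * eps' i k.
Hypothesis agreeF : forall i k, S k ->
  eps i (k - alpha i) * phi i k = eps' i (k - alpha i) * phi' i k.

Lemma value_S u k : S k -> value eps phi u k != 0 -> S (k + wt u).
Proof.
elim: u k => [|[b i] u IH] k Sk; first by rewrite /wt big_nil addr0.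
rewrite /= mulf_eq0 => /norP[c0 v0]; rewrite /wt big_cons addrA.
apply: IH => //; case: b c0 {v0}; [exact: epsS | exact: phiS].
Qed.

(** Closed words only see the products of opposite coefficients. *)
Lemma closed_value_eq w k : wt w = 0 -> S k ->
  value eps phi w k = value eps' phi' w k.
Proof.
move: {2}(size w) (leqnn (size w)) => m; elim: m w k => [|m IH] w k wm w0 Sk.
  by have -> : w = [::] by apply/size0nil/eqP; rewrite -leqn0.
case: (eqVneq w [::]) => [->//|wn].
have [u [x [v e]]] := closed_cancels w0 wn.
have [pe ve] := e; rewrite !ve //.
have sx : step x + step (flipped x) = 0.
  by case: x {e pe ve} => [[] i]; rewrite /step /= ?subrr ?addNr.
have val e1 p1 : value e1 p1 (u ++ [:: x; flipped x] ++ v) k =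
    coef e1 p1 x (k + wt u) * coef e1 p1 (flipped x) (k + wt u + step x) *
    value e1 p1 (u ++ v) k.
  rewrite !value_cat /= /wt !big_cons big_nil addr0 sx addr0; ring.
have w'0 : wt (u ++ v) = 0.
  rewrite -w0 /wt (perm_big _ pe) !big_cat /= !big_cons big_nil addr0.
  by rewrite sx add0r.
have sz : (size (u ++ v) <= m)%N.
  by move: wm; rewrite (perm_size pe) !size_cat /=; lia.
have I := IH _ k sz w'0 Sk; rewrite !val.
case: (pselect (S (k + wt u))) => [Su|nSu].
  rewrite -I; congr (_ * _); case: x {e pe ve sx val} => [[] i];
    rewrite /coef /step /= mulrC; last by rewrite agreeF // mulrC.
  by rewrite agreeE // mulrC.
have u0 : value eps phi u k = 0.
  by apply/eqP; apply: contraT => u0; case: nSu; apply: value_S.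
by rewrite -I value_cat u0 mul0r !mulr0.
Qed.

End Determination.
End Words.

(** * Matrix coefficients of a pointed module *)

Section CoefSystems.
Variables (F : fieldType) (q : F) (n : nat).
Hypotheses (q_neq0 : q != 0) (q_nroot : not_root_of_unity q).
Local Notation L := (lattice n).

(** E_i maps the basis vector of weight k to eps i k times that of weight
    k + alpha_i, and F_i to phi i k times that of weight k - alpha_i. *)
Record coef_system (lam : 'I_n -> F) (S : L -> Prop) (eps phi : 'I_n -> L -> F) :
    Prop := CoefSystem {
  cs_lam : forall i, lam i != 0;
  cs_eps : forall i k, eps i k != 0 -> S k /\ S (k + alpha i);
  cs_phi : forall i k, phi i k != 0 -> S k /\ S (k - alpha i);
  cs_comm : commuting eps phi;
  cs_EF : forall i k, S k ->
    eps i (k - alpha i) * phi i k - phi i (k + alpha i) * eps i k =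
      sh (wtK q lam i k) / sh q;
  cs_far : forall i j k, distant i j ->
    eps i (k + alpha j) * eps j k = eps j (k + alpha i) * eps i k;
  cs_serre : forall i j k, adjacent i j ->
    eps i (k + alpha j + alpha i) * eps i (k + alpha j) * eps j k
    - qtwo q * (eps i (k + alpha i + alpha j) * eps j (k + alpha i) * eps i k)
    + eps j (k + alpha i + alpha i) * eps i (k + alpha i) * eps i k = 0;
  cs_conn : forall k l, S k -> S l ->
    exists2 w, k + wt w = l & value eps phi w k != 0
}.

Variables (lam : 'I_n -> F) (S : L -> Prop) (eps phi : 'I_n -> L -> F).
Hypothesis C : coef_system lam S eps phi.
Implicit Types (i j : 'I_n) (k : L).

(** The coefficients of the transposed operators, with E_i and F_i exchanged. *)
Let epsT i k := phi i (k + alpha i).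
Let phiT i k := eps i (k - alpha i).

Let commT : commuting epsT phiT.
Proof.
move=> i j k ij; have ji : j != i by rewrite eq_sym.
have := cs_comm C (k - alpha j + alpha i) ji; rewrite addrK [_ + alpha j]addrAC subrK.
by rewrite /epsT /phiT mulrC => ->; rewrite mulrC [k - _ + _]addrAC.
Qed.

Let transpose w k : wt w = 0 -> S k -> value eps phi w k = value epsT phiT w k.
Proof.
move=> w0 Sk; apply: (closed_value_eq (cs_comm C) commT _ _ _ _ w0 Sk).
- by move=> i x /(cs_eps C)[].
- by move=> i x /(cs_phi C)[].
- by move=> i x _; rewrite /epsT /phiT addrK mulrC.
- by move=> i x _; rewrite /epsT /phiT subrK mulrC.
Qed.

(** A closed word with nonzero value starting with E_i exists by connectedness;
    the transposed system gives it the same value. *)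
Lemma eps_phi i k : eps i k != 0 -> phi i (k + alpha i) != 0.
Proof.
move=> e0; have [Sk Sk'] := cs_eps C e0.
have [w wk vw] := cs_conn C Sk' Sk.
have w0 : wt ((true, i) :: w) = 0.
  apply: (addrI k); rewrite /wt big_cons -/(wt w) addrA [k + step _]/(_ + alpha i).
  by rewrite wk addr0.
have := transpose w0 Sk; rewrite /= /coef /= => e.
have := mulf_neq0 e0 vw; rewrite [k + alpha i]/(k + step (true, i)) e.
by rewrite mulf_eq0 => /norP[].
Qed.

Lemma phi_eps i k : phi i k != 0 -> eps i (k - alpha i) != 0.
Proof.
move=> e0; have [Sk Sk'] := cs_phi C e0.
have [w wk vw] := cs_conn C Sk' Sk.
have w0 : wt ((false, i) :: w) = 0.
  apply: (addrI k); rewrite /wt big_cons -/(wt w) addrA [k + step _]/(_ - alpha i).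
  by rewrite wk addr0.
have := transpose w0 Sk; rewrite /= /coef /= => e.
have := mulf_neq0 e0 vw; rewrite [k - alpha i]/(k + step (false, i)) e.
by rewrite mulf_eq0 => /norP[].
Qed.

Definition casimir i k :=
  sh q ^+ 2 * (phi i (k + alpha i) * eps i k) + ch (q * wtK q lam i k).
Local Notation up := (raise_coef q lam casimir).
Local Notation dn := (lower_coef q lam casimir).

Let shq : sh q != 0. Proof. exact: sh_q_neq0. Qed.
Let shq2 : sh q ^+ 2 != 0. Proof. exact: expf_neq0. Qed.
Let K0 i k : wtK q lam i k != 0.
Proof. exact: (wtK_neq0 q_neq0 (cs_lam C)). Qed.

Lemma up_casimir i k : up i k = sh q ^+ 2 * (phi i (k + alpha i) * eps i k).
Proof. by rewrite /raise_coef /casimir addrK. Qed.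

Lemma dn_casimir i k : S k ->
  dn i k = sh q ^+ 2 * (eps i (k - alpha i) * phi i k).
Proof.
move=> Sk; rewrite /lower_coef /casimir -addrA [q * _]mulrC -sh_mul //.
have := cs_EF C i Sk => /eqP; rewrite subr_eq => /eqP ->.
by field_nz.
Qed.

Lemma up_eps i k : (up i k != 0) = (eps i k != 0).
Proof.
rewrite up_casimir mulf_eq0 (negbTE shq2) /= mulf_eq0.
case: (eqVneq (eps i k) 0) => [_|e]; first by rewrite orbT.
by rewrite orbF eps_phi.
Qed.

Lemma dn_phi i k : S k -> (dn i k != 0) = (phi i k != 0).
Proof.
move=> Sk; rewrite dn_casimir // mulf_eq0 (negbTE shq2) /= mulf_eq0.
case: (eqVneq (phi i k) 0) => [_|e]; first by rewrite orbT.
by rewrite orbF phi_eps.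
Qed.

Let casimirE i k : casimir i k = up i k + ch (q * wtK q lam i k).
Proof. by rewrite subrK. Qed.
Let casimirE' i k : casimir i k = dn i k + ch (wtK q lam i k / q).
Proof. by rewrite subrK. Qed.

Let comm' i j k : i != j ->
  eps i k * phi j (k + alpha j) = phi j (k + alpha j + alpha i) * eps i (k + alpha j).
Proof. by move=> ij; rewrite -(cs_comm C) // addrK. Qed.

Let up_far' i j k : distant i j -> eps i k != 0 -> up j (k + alpha i) = up j k.
Proof.
move=> d e0; rewrite !up_casimir; congr (_ * _); apply: (mulIf e0).
have ij : i != j by apply: contraTneq d => ->; rewrite /distant; lia.
rewrite -mulrA -(cs_far C) // [k + alpha i + _]addrAC mulrA -comm' //.
by rewrite -mulrA mulrC.
Qed.

Let step_up i j k : i != j ->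
  phi j (k + alpha i + alpha j) * eps i (k + alpha j) = eps i k * phi j (k + alpha j).
Proof. by move=> ij; rewrite comm' // addrAC. Qed.

Let serre_aux (X t P0 P1 P2 a b c0 c1 c2 e0 e1 : F) :
  P1 * b = e0 * P0 -> P2 * a = e1 * P1 ->
  X * P2 * (a * b * c0 - t * (a * c1 * e0) + c2 * e1 * e0) =
  (X * (P0 * c0) - t * (X * (P1 * c1)) + X * (P2 * c2)) * (e1 * e0).
Proof.
move=> s1 s2; transitivity (X * (P2 * a * b * c0 - t * (P2 * a * c1 * e0) +
  P2 * c2 * e1 * e0)); first by ring.
rewrite s2; transitivity (X * (e1 * (P1 * b) * c0 - t * (e1 * P1 * c1 * e0) +
  P2 * c2 * e1 * e0)); first by ring.
by rewrite s1; ring.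
Qed.

(** The value phi i (k + alpha_i) * eps i k of F_i E_i is invariant under rescaling
    of the basis; each relation of the algebra becomes one between these values
    after cancelling nonzero coefficients of E. *)
Lemma coef_pointed_system : pointed_system q lam S casimir.
Proof.
split.
- exact: cs_lam C.
- move=> i k Sk u; have e0 : eps i k != 0 by rewrite -up_eps.
  have [_ Sk'] := cs_eps C e0; split=> //.
  rewrite casimirE' dn_casimir // addrK casimirE up_casimir wtK_alpha //.
  by rewrite [eps i k * _]mulrC; congr (_ + ch _); field_nz.
- move=> i k Sk d; have f0 : phi i k != 0 by rewrite -dn_phi.
  have [_ Sk'] := cs_phi C f0; split=> //.
  rewrite casimirE up_casimir subrK [RHS]casimirE' dn_casimir // wtK_alphaB //.
  by rewrite [phi i k * _]mulrC; congr (_ + ch _); field_nz.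
- move=> i j k d Sk; rewrite up_eps => e0.
  by rewrite !casimirE up_far' // (wtK_far q_neq0) // distantC.
- move=> i j k a Sk; rewrite !up_eps => e0 e1.
  have ij := adjacent_neq a; have aji : adjacent j i by rewrite adjacentC.
  have rec : up j k - qtwo q * up j (k + alpha i) + up j (k + alpha i + alpha i) = 0.
    rewrite !up_casimir; apply: (mulIf (mulf_neq0 e1 e0)); rewrite mul0r.
    have := cs_serre C k a => /(congr1 ( *%R (sh q ^+ 2 *
      phi j (k + alpha i + alpha i + alpha j)))); rewrite mulr0 => <-.
    have s1 := step_up k ij; have s2 := step_up (k + alpha i) ij.
    by rewrite [k + alpha j + alpha i]addrAC; apply/esym/serre_aux.
  rewrite !casimirE !(wtK_adj q_neq0 lam _ aji); move: rec.
  have := K0 j k; move: (wtK q lam j k) => x x0 rec.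
  rewrite -[RHS]rec /qtwo /ch; field_nz.
- move=> i j k a Sk; rewrite !up_eps => e0 e1; have ij := adjacent_neq a.
  have s1 := step_up k ij; have ji : j != i by rewrite eq_sym.
  have s2 := step_up k ji; rewrite !up_casimir.
  rewrite [k + alpha j + alpha i]addrAC in s2 *.
  apply: (mulIf (mulf_neq0 e0 e1)).
  set Pi := phi i (k + alpha i + alpha j) in s2 *.
  set Pj := phi j (k + alpha i + alpha j) in s1 *.
  transitivity (sh q ^+ 2 * sh q ^+ 2 * (eps j k * phi i (k + alpha i)) *
    (eps i k * phi j (k + alpha j)) * eps i k * eps j k); first by ring.
  by rewrite -s1 -s2; ring.
- move=> i j k ij Sk; have e := cs_comm C k ij; split=> -[].
    rewrite dn_phi // !up_eps => f0 e0; have := mulf_neq0 e0 f0; rewrite e.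
    rewrite mulf_eq0 => /norP[f1 e1]; split=> //.
    by rewrite dn_phi //; case: (cs_eps C e1).
  rewrite up_eps => e0; have [_ Sk'] := cs_eps C e0; rewrite dn_phi // => f0.
  have := mulf_neq0 f0 e0; rewrite -e mulf_eq0 => /norP[e1 f1].
  by rewrite dn_phi // up_eps.
- move=> P k0 S0 P0 Pu Pd k Sk; have [w wk vw] := cs_conn C S0 Sk.
  elim: w k0 S0 P0 wk vw => [|[b i] w IH] k0 S0 P0.
    by rewrite /wt big_nil addr0 => <-.
  rewrite /wt big_cons addrA /= mulf_eq0 => wk /norP[c0 v0].
  apply: (IH (k0 + step (b, i))) => //; case: b c0 {wk v0} => /= c0.
  - by have [] := cs_eps C c0.
  - by have [] := cs_phi C c0.
  - by apply: Pu; rewrite ?up_eps.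
  - by apply: Pd; rewrite ?dn_phi.
Qed.

End CoefSystems.

(** * Linear endomorphisms and finitely supported functions *)

Section LinearEndomorphisms.
Variables (F : fieldType) (M : lmodType F).

Record endo := Endo { endo_fun :> M -> M; endo_linear : linear endo_fun }.

Lemma endoP (u v : endo) : (forall x, u x = v x) -> u = v.
Proof.
case: u v => [f fl] [g gl] /= fg; have e : f = g by apply/funext.
by subst g; congr Endo; apply: Prop_irrelevance.
Qed.

HB.instance Definition _ := gen_eqMixin endo.
HB.instance Definition _ := gen_choiceMixin endo.

Lemma endoD (u : endo) x y : u (x + y) = u x + u y.
Proof. by have := endo_linear u 1 x y; rewrite !scale1r. Qed.

Lemma endo0 (u : endo) : u 0 = 0.
Proof. by apply: (addrI (u 0)); rewrite -endoD !addr0. Qed.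

Lemma endoZ (u : endo) c x : u (c *: x) = c *: u x.
Proof. by have := endo_linear u c x 0; rewrite endo0 !addr0. Qed.

Fact endo_add_linear (u v : endo) : linear (fun x => u x + v x).
Proof. by move=> c x y; rewrite !endoD !endoZ scalerDr addrACA. Qed.
Fact endo_opp_linear (u : endo) : linear (fun x => - u x).
Proof. by move=> c x y; rewrite endoD endoZ opprD scalerN. Qed.
Fact endo_zero_linear : linear (fun _ : M => 0 : M).
Proof. by move=> c x y; rewrite scaler0 addr0. Qed.
Fact endo_mul_linear (u v : endo) : linear (fun x => u (v x)).
Proof. by move=> c x y; rewrite !endoD !endoZ. Qed.
Fact endo_scale_linear (c : F) : linear (fun x : M => c *: x).
Proof. by move=> d x y; rewrite scalerDr !scalerA mulrC. Qed.

Definition endo_add u v := Endo (endo_add_linear u v).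
Definition endo_opp u := Endo (endo_opp_linear u).
Definition endo_zero := Endo endo_zero_linear.
Definition endo_mul u v := Endo (endo_mul_linear u v).
Definition endo_scal c := Endo (endo_scale_linear c).

Fact endo_addA : associative endo_add.
Proof. by move=> u v t; apply: endoP => x; exact: addrA. Qed.
Fact endo_addC : commutative endo_add.
Proof. by move=> u v; apply: endoP => x; exact: addrC. Qed.
Fact endo_add0 : left_id endo_zero endo_add.
Proof. by move=> u; apply: endoP => x; exact: add0r. Qed.
Fact endo_addN : left_inverse endo_zero endo_opp endo_add.
Proof. by move=> u; apply: endoP => x; exact: addNr. Qed.

HB.instance Definition _ :=
  GRing.isZmodule.Build endo endo_addA endo_addC endo_add0 endo_addN.

Fact endo_mulA : associative endo_mul.
Proof. by move=> u v t; apply: endoP. Qed.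
Fact endo_mul1l : left_id (endo_scal 1) endo_mul.
Proof. by move=> u; apply: endoP => x; exact: scale1r. Qed.
Fact endo_mul1r : right_id (endo_scal 1) endo_mul.
Proof. by move=> u; apply: endoP => x /=; rewrite scale1r. Qed.
Fact endo_mulDl : left_distributive endo_mul +%R.
Proof. by move=> u v t; apply: endoP. Qed.
Fact endo_mulDr : right_distributive endo_mul +%R.
Proof. by move=> u v t; apply: endoP => x; exact: endoD. Qed.

HB.instance Definition _ := GRing.Zmodule_isPzRing.Build endo
  endo_mulA endo_mul1l endo_mul1r endo_mulDl endo_mulDr.

Fact endo_scal_zmod_morphism : zmod_morphism endo_scal.
Proof. by move=> c d; apply: endoP => x; exact: scalerBl. Qed.
Fact endo_scal_monoid_morphism : monoid_morphism endo_scal.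
Proof. by split=> // c d; apply: endoP => x /=; rewrite scalerA. Qed.
Fact endo_scalC c (u : endo) : endo_scal c * u = u * endo_scal c.
Proof. by apply: endoP => x /=; rewrite endoZ. Qed.

HB.instance Definition _ := hasScalars.Build F endo
  endo_scal_zmod_morphism endo_scal_monoid_morphism endo_scalC.

Lemma endo_mulE (u v : endo) x : (u * v) x = u (v x). Proof. by []. Qed.
Lemma endo_addE (u v : endo) x : (u + v) x = u x + v x. Proof. by []. Qed.
Lemma endo_oppE (u : endo) x : (- u) x = - u x. Proof. by []. Qed.
Lemma endo_oneE x : (1 : endo) x = x. Proof. exact: scale1r. Qed.
Lemma endo_scalE c x : (scal c : endo) x = c *: x. Proof. by []. Qed.

Definition endo_module : Type := M.
HB.instance Definition _ := GRing.Zmodule.on endo_module.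

Definition endo_act (u : endo) (x : endo_module) : endo_module := u x.

Fact endo_actA u v x : endo_act u (endo_act v x) = endo_act (u * v) x.
Proof. by []. Qed.
Fact endo_act1 : left_id 1 endo_act.
Proof. by move=> x; exact: scale1r. Qed.
Fact endo_actDr : right_distributive endo_act +%R.
Proof. by move=> u x y; exact: endoD. Qed.
Fact endo_actDl x : {morph endo_act^~ x : u v / u + v}.
Proof. by []. Qed.

HB.instance Definition _ := GRing.Zmodule_isLmodule.Build endo endo_module
  endo_actA endo_act1 endo_actDr endo_actDl.

End LinearEndomorphisms.

Section FiniteSupport.
Variables (F : fieldType) (T : choiceType) (box : T -> Prop).

(** Finitely supported functions, extended by zero outside box. *)
Record fsupp := Fsupp {
  fs_val :> T -> F;
  fs_finite : exists s : seq T, forall k, k \notin s -> fs_val k = 0;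
  fs_box : forall k, fs_val k != 0 -> box k
}.

Lemma fsuppP (f g : fsupp) : (forall k, f k = g k) -> f = g.
Proof.
case: f g => [f ff fb] [g gf gb] /= fg; have e : f = g by apply/funext.
by subst g; congr Fsupp; apply: Prop_irrelevance.
Qed.

HB.instance Definition _ := gen_eqMixin fsupp.
HB.instance Definition _ := gen_choiceMixin fsupp.

Lemma fs_out (f : fsupp) k : ~ box k -> f k = 0.
Proof. by move=> nb; apply/eqP; apply: contraT => /fs_box. Qed.

Fact fs_add_finite (f g : fsupp) :
  exists s : seq T, forall k, k \notin s -> f k + g k = 0.
Proof.
have [s sf] := fs_finite f; have [t tg] := fs_finite g.
exists (s ++ t) => k; rewrite mem_cat negb_or => /andP[ks kt].
by rewrite sf // tg // addr0.
Qed.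
Fact fs_add_box (f g : fsupp) k : f k + g k != 0 -> box k.
Proof.
by case: (pselect (box k)) => // nb; rewrite !fs_out // addr0 eqxx.
Qed.
Definition fs_add f g := Fsupp (fs_add_finite f g) (@fs_add_box f g).

Fact fs_zero_finite : exists s : seq T, forall k, k \notin s -> 0 = 0 :> F.
Proof. by exists [::]. Qed.
Fact fs_zero_box k : 0 != 0 :> F -> box k. Proof. by rewrite eqxx. Qed.
Definition fs_zero := Fsupp fs_zero_finite fs_zero_box.

Fact fs_scale_finite c (f : fsupp) :
  exists s : seq T, forall k, k \notin s -> c * f k = 0.
Proof. by have [s sf] := fs_finite f; exists s => k /sf->; rewrite mulr0. Qed.
Fact fs_scale_box c (f : fsupp) k : c * f k != 0 -> box k.
Proof. by rewrite mulf_eq0 => /norP[_ /fs_box]. Qed.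
Definition fs_scale c f := Fsupp (fs_scale_finite c f) (@fs_scale_box c f).

Fact fs_addA : associative fs_add.
Proof. by move=> f g h; apply: fsuppP => k; exact: addrA. Qed.
Fact fs_addC : commutative fs_add.
Proof. by move=> f g; apply: fsuppP => k; exact: addrC. Qed.
Fact fs_add0 : left_id fs_zero fs_add.
Proof. by move=> f; apply: fsuppP => k; exact: add0r. Qed.
Fact fs_addN : left_inverse fs_zero (fs_scale (- 1)) fs_add.
Proof. by move=> f; apply: fsuppP => k /=; rewrite mulN1r addNr. Qed.

HB.instance Definition _ :=
  GRing.isZmodule.Build fsupp fs_addA fs_addC fs_add0 fs_addN.

Fact fs_scaleA c d f : fs_scale c (fs_scale d f) = fs_scale (c * d) f.
Proof. by apply: fsuppP => k /=; rewrite mulrA. Qed.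
Fact fs_scale1 : left_id 1 fs_scale.
Proof. by move=> f; apply: fsuppP => k /=; rewrite mul1r. Qed.
Fact fs_scaleDr : right_distributive fs_scale +%R.
Proof. by move=> c f g; apply: fsuppP => k /=; rewrite mulrDr. Qed.
Fact fs_scaleDl f : {morph fs_scale^~ f : c d / c + d}.
Proof. by move=> c d; apply: fsuppP => k /=; rewrite mulrDl. Qed.

HB.instance Definition _ := GRing.Zmodule_isLmodule.Build F fsupp
  fs_scaleA fs_scale1 fs_scaleDr fs_scaleDl.

Lemma fsD (f g : fsupp) k : (f + g) k = f k + g k. Proof. by []. Qed.
Lemma fsZ c (f : fsupp) k : (c *: f) k = c * f k. Proof. by []. Qed.
Lemma fsN (f : fsupp) k : (- f) k = - f k. Proof. by exact: mulN1r. Qed.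

Fact fs_restrict_finite (A : T -> Prop) (f : fsupp) :
  exists s : seq T, forall k, k \notin s -> (if `[< A k >] then f k else 0) = 0.
Proof. by have [s sf] := fs_finite f; exists s => k /sf->; rewrite if_same. Qed.
Fact fs_restrict_box (A : T -> Prop) (f : fsupp) k :
  (if `[< A k >] then f k else 0) != 0 -> box k.
Proof. by case: ifP => [_ /fs_box|]; rewrite ?eqxx. Qed.
Definition fs_restrict A f :=
  Fsupp (fs_restrict_finite A f) (@fs_restrict_box A f).

Fact fs_delta_finite (k0 : T) :
  exists s : seq T, forall k, k \notin s -> (k == k0)%:R = 0 :> F.
Proof. by exists [:: k0] => k; rewrite inE => /negbTE->. Qed.
Fact fs_delta_box (k0 : T) (b : box k0) k : (k == k0)%:R != 0 :> F -> box k.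
Proof. by case: (eqVneq k k0) => [->|]; rewrite ?eqxx. Qed.
Definition fs_delta k0 (b : box k0) :=
  Fsupp (fs_delta_finite k0) (@fs_delta_box k0 b).

End FiniteSupport.

(** * Weight modules of the quantized Weyl algebra *)

Section WeylBox.
Import Order.TTheory Num.Theory.
Variables (F : fieldType) (q : F) (n : nat).
Hypotheses (q_neq0 : q != 0) (q_nroot : not_root_of_unity q).
Local Notation L := (lattice n).
Local Notation I := 'I_n.+1.
Variable w : I -> F.
Hypothesis w_neq0 : forall l, w l != 0.
Local Notation O := (wtO q w).

Definition unit_vec (m : I) : L := [ffun l => (l == m)%:Z].

Lemma alpha_unit (i : 'I_n) : alpha i = unit_vec (lo i) - unit_vec (hi i).
Proof. by apply/ffunP=> l; rewrite !ffunE. Qed.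

Lemma wtO_unit l m (k : L) : O l (k + unit_vec m) = q ^+ (l == m) * O l k.
Proof. by rewrite wtOD // ffunE. Qed.

Lemma wtO_unitB l m (k : L) : O l (k - unit_vec m) = q ^- (l == m) * O l k.
Proof. by rewrite wtOD // !ffunE -exprnN. Qed.

(** The weights that x_l and y_l reach from weight zero without crossing a zero
    of w_l - w_l^-1. *)
Definition in_box (k : L) := forall (l : I) (z : int),
  (0 < z <= k l) || (k l < z <= 0) -> sh (w l * q ^ z) != 0.

Lemma in_box0 : in_box 0.
Proof. by move=> l z; rewrite ffunE; clear; lia. Qed.

Lemma in_box_up l k : sh (O l k) != 0 -> in_box (k - unit_vec l) -> in_box k.
Proof.
move=> nz b m z h; case: (eqVneq m l) => [e|ml].
  subst m; case: (eqVneq z (k l)) => [->|zk]; first by rewrite wtO.unlock in nz.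
  apply: b; rewrite !ffunE eqxx /=; move/eqP: zk; move: h; lia.
by apply: b; rewrite !ffunE (negbTE ml) subr0.
Qed.

Lemma in_box_dn l k : sh (q * O l k) != 0 -> in_box (k + unit_vec l) -> in_box k.
Proof.
move=> nz b m z h; case: (eqVneq m l) => [e|ml].
  subst m; case: (eqVneq z (k l + 1)) => [->|zk].
    by move: nz; rewrite wtO.unlock expfzDr // mulrCA [q * _]mulrC expr1z.
  apply: b; rewrite !ffunE eqxx /=; move/eqP: zk; move: h; lia.
by apply: b; rewrite !ffunE (negbTE ml) addr0.
Qed.

Definition box_space := fsupp F in_box.

Section Shift.
Variables (a : L -> F) (d : L).
Hypothesis ab : forall k, a k != 0 -> in_box (k - d) -> in_box k.

Fact shift_finite (f : box_space) :
  exists s : seq L, forall k, k \notin s -> a k * f (k - d) = 0.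
Proof.
have [s sf] := fs_finite f; exists [seq k + d | k <- s] => k ks.
rewrite sf ?mulr0 //; apply: contra ks => kd.
by apply/mapP; exists (k - d); rewrite ?subrK.
Qed.

Fact shift_box (f : box_space) k : a k * f (k - d) != 0 -> in_box k.
Proof. by rewrite mulf_eq0 => /norP[a0 /fs_box]; apply: ab. Qed.

Definition shift_fun (f : box_space) : box_space :=
  Fsupp (shift_finite f) (@shift_box f).

Fact shift_linear : linear shift_fun.
Proof.
by move=> c f g; apply: fsuppP => k; rewrite /= mulrDr mulrCA.
Qed.

Definition shift := Endo shift_linear.

Lemma shiftE f k : shift f k = a k * f (k - d).
Proof. by []. Qed.

End Shift.

(** The relations prescribe sh (q w_l) / sh q as the value of y_l x_l and sh w_l / sh q
    as that of x_l y_l. The factor is put into y_l; x_l is a shift, cut where the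
    opposite y_l vanishes. *)
Definition x_coef l k : F := (sh (O l k) != 0)%:R.
Definition y_coef l k : F := sh (q * O l k) / sh q.

Fact x_coef_box l k : x_coef l k != 0 -> in_box (k - unit_vec l) -> in_box k.
Proof.
rewrite /x_coef; case: (eqVneq (sh (O l k)) 0) => [_|nz _]; first by rewrite eqxx.
exact: in_box_up.
Qed.

Fact y_coef_box l k : y_coef l k != 0 -> in_box (k - - unit_vec l) -> in_box k.
Proof.
rewrite /y_coef mulf_eq0 => /norP[nz _]; rewrite opprK; exact: in_box_dn.
Qed.

Fact coefO_box (a : L -> F) k : a k != 0 -> in_box (k - 0) -> in_box k.
Proof. by rewrite subr0. Qed.

Definition opX l := shift (@x_coef_box l).
Definition opY l := shift (@y_coef_box l).
Definition opO l := shift (@coefO_box (O l)).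
Definition opOV l := shift (@coefO_box (fun k => (O l k)^-1)).

Lemma opXE l (f : box_space) k : opX l f k = x_coef l k * f (k - unit_vec l).
Proof. by []. Qed.
Lemma opYE l (f : box_space) k : opY l f k = y_coef l k * f (k + unit_vec l).
Proof. by rewrite shiftE opprK. Qed.
Lemma opOE l (f : box_space) k : opO l f k = O l k * f k.
Proof. by rewrite shiftE subr0. Qed.
Lemma opOVE l (f : box_space) k : opOV l f k = (O l k)^-1 * f k.
Proof. by rewrite shiftE subr0. Qed.

Let opE := (opXE, opYE, opOE, opOVE).

Definition weyl_op (g : weylgen n.+1) : endo box_space :=
  match g with
  | WeylO l => opO l | WeylOV l => opOV l | WeylX l => opX l | WeylY l => opY l
  end.

Let ev := free_eval weyl_op.
Let evE := (free_evalZ weyl_op, free_eval_gen weyl_op).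
Let O0 l k : O l k != 0. Proof. exact: wtO_neq0. Qed.
Let shq : sh q != 0. Proof. exact: sh_q_neq0. Qed.

Let addC (k : L) x y : k + x + y = k + y + x. Proof. exact: addrAC. Qed.

Let x_coef_id l m k x : l != m -> x = unit_vec m \/ x = - unit_vec m ->
  x_coef l (k + x) = x_coef l k.
Proof.
move=> lm [->|->]; rewrite /x_coef ?wtO_unit ?wtO_unitB (negbTE lm) ?invr1 mul1r //.
Qed.

Let y_coef_id l m k x : l != m -> x = unit_vec m \/ x = - unit_vec m ->
  y_coef l (k + x) = y_coef l k.
Proof.
move=> lm [->|->]; rewrite /y_coef ?wtO_unit ?wtO_unitB (negbTE lm) ?invr1 mul1r //.
Qed.

Let YX_diag l (f : box_space) k : opY l (opX l f) k = sh (q * O l k) / sh q * f k.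
Proof.
rewrite !opE addrK /x_coef wtO_unit eqxx expr1 /y_coef.
by case: eqVneq => [->|_]; rewrite ?mul1r // !mul0r.
Qed.

Let XY_diag l (f : box_space) k : opX l (opY l f) k = sh (O l k) / sh q * f k.
Proof.
rewrite !opE subrK /x_coef /y_coef wtO_unitB eqxx expr1 mulVKf //.
by case: eqVneq => [->|_]; rewrite ?mul1r // !mul0r.
Qed.

Fact weyl_op_rel l r : weyl_rel q l r -> ev l = ev r.
Proof.
pose mE := (endo_mulE, endo_addE, endo_oppE, endo_oneE, endo_scalE, fsD, fsN, fsZ).
case=> {l r}.
- move=> i; rewrite /ev rmorphM /= rmorph1 !evE /=; apply: endoP => f; apply: fsuppP => k.
  by rewrite !mE !opE mul1r mulVKf.
- move=> i; rewrite /ev rmorphM /= rmorph1 !evE /=; apply: endoP => f; apply: fsuppP => k.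
  by rewrite !mE !opE mul1r mulKf.
- move=> i j; rewrite /ev !rmorphM /= !evE /=; apply: endoP => f; apply: fsuppP => k.
  by rewrite !mE !opE mulrCA.
- move=> i j; rewrite /ev !rmorphM /= !evE /= ; apply: endoP => f; apply: fsuppP => k.
  rewrite !mE !opE wtO_unitB invfM invrK; field_nz.
- move=> i j; rewrite /ev !rmorphM /= !evE /= ; apply: endoP => f; apply: fsuppP => k.
  rewrite !mE !opE wtO_unit invfM; field_nz.
- move=> i j; rewrite /ev !rmorphM /= !evE /=; apply: endoP => f; apply: fsuppP => k.
  rewrite !mE !opE; case: (eqVneq i j) => [->//|ij].
  have ji : j != i by rewrite eq_sym.
  rewrite (x_coef_id _ ij) ?(x_coef_id _ ji); [|by right|by right].
  by rewrite mulrCA addC.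
- move=> i j; rewrite /ev !rmorphM /= !evE /=; apply: endoP => f; apply: fsuppP => k.
  rewrite !mE !opE; case: (eqVneq i j) => [->//|ij].
  have ji : j != i by rewrite eq_sym.
  rewrite (y_coef_id _ ij) ?(y_coef_id _ ji); [|by left|by left].
  by rewrite mulrCA addC.
- move=> i j ij; rewrite /ev !rmorphM /= !evE /=; apply: endoP => f; apply: fsuppP => k.
  have ji : j != i by rewrite eq_sym.
  rewrite !mE !opE (x_coef_id _ ji) ?(y_coef_id _ ij); [|by right|by left].
  by rewrite mulrCA addC.
- move=> i; rewrite /ev rmorphB /= free_evalZ !rmorphM /= !evE /=.
  apply: endoP => f; apply: fsuppP => k.
  rewrite !mE YX_diag XY_diag opE.
  have -> : sh (q * O i k) = q^-1 * sh (O i k) + sh q * O i k.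
    by rewrite /sh; field_nz.
  by field_nz.
- move=> i; rewrite /ev rmorphB /= free_evalZ !rmorphM /= !evE /=.
  apply: endoP => f; apply: fsuppP => k.
  rewrite !mE YX_diag XY_diag opE.
  have -> : sh (q * O i k) = q * sh (O i k) + sh q * (O i k)^-1.
    by rewrite /sh; field_nz.
  by field_nz.
Qed.

Definition weyl_module : lmodType (qWeyl q n.+1) :=
  pullback (presented_lift weyl_op_rel) (endo_module box_space).

End WeylBox.

(** * Irreducibility of the Weyl modules *)

Section WeylModuleTheory.
Import Order.TTheory Num.Theory.
Variables (F : fieldType) (q : F) (n : nat).
Hypotheses (q_neq0 : q != 0) (q_nroot : not_root_of_unity q).
Local Notation L := (lattice n).
Local Notation I := 'I_n.+1.
Variable w : I -> F.
Hypothesis w_neq0 : forall l, w l != 0.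
Local Notation O := (wtO q w).
Local Notation W := (weyl_module q_neq0 q_nroot w_neq0).
Local Notation A := (qWeyl q n.+1).
Local Notation box := (in_box q w).

Definition weyl_coef (f : W) : L -> F := @fs_val F L box f.
Definition delta k (b : box k) : W := fs_delta F b.

Lemma weyl_coefP (f g : W) : (forall k, weyl_coef f k = weyl_coef g k) -> f = g.
Proof. exact: fsuppP. Qed.

Lemma weyl_coefD (f g : W) k : weyl_coef (f + g) k = weyl_coef f k + weyl_coef g k.
Proof. by []. Qed.
Lemma weyl_coef0 k : weyl_coef 0 k = 0. Proof. by []. Qed.
Lemma weyl_coefN (f : W) k : weyl_coef (- f) k = - weyl_coef f k.
Proof. exact: mulN1r. Qed.
Lemma weyl_coef_sum (T : Type) (r : seq T) (P : pred T) (G : T -> W) k :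
  weyl_coef (\sum_(i <- r | P i) G i) k = \sum_(i <- r | P i) weyl_coef (G i) k.
Proof. by elim/big_rec2: _ => // i x y _ <-. Qed.
Lemma weyl_coef_delta k (b : box k) x : weyl_coef (delta b) x = (x == k)%:R.
Proof. by []. Qed.

Let actE (a : A) (f : W) :
  a *: f = (presented_lift (weyl_op_rel q_neq0 q_nroot w_neq0) a : endo _) f.
Proof. by []. Qed.

Lemma weyl_coefZ c (f : W) k : weyl_coef (fscale c f) k = c * weyl_coef f k.
Proof. by rewrite /fscale actE presented_lift_scal. Qed.

Lemma weyl_coefX l (f : W) k :
  weyl_coef (weylX q l *: f) k = x_coef q w l k * weyl_coef f (k - unit_vec l).
Proof. by rewrite actE presented_lift_gen. Qed.

Lemma weyl_coefY l (f : W) k :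
  weyl_coef (weylY q l *: f) k = y_coef q w l k * weyl_coef f (k + unit_vec l).
Proof. by rewrite actE presented_lift_gen /= /weyl_coef /= opprK. Qed.

Lemma weyl_coefO l (f : W) k : weyl_coef (weylO q l *: f) k = O l k * weyl_coef f k.
Proof. by rewrite actE presented_lift_gen /= /weyl_coef /= subr0. Qed.

Lemma weyl_coefOV l (f : W) k :
  weyl_coef (weylOV q l *: f) k = (O l k)^-1 * weyl_coef f k.
Proof. by rewrite actE presented_lift_gen /= /weyl_coef /= subr0. Qed.

Lemma weyl_box (f : W) k : weyl_coef f k != 0 -> box k.
Proof. exact: fs_box. Qed.

Lemma weyl_finite (f : W) : exists s : seq L, forall k, k \notin s -> weyl_coef f k = 0.
Proof. exact: fs_finite. Qed.

Definition weyl_restrict (P : L -> Prop) (f : W) : W := fs_restrict P f.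
Lemma weyl_coef_restrict P (f : W) k :
  weyl_coef (weyl_restrict P f) k = if `[< P k >] then weyl_coef f k else 0.
Proof. by []. Qed.

Lemma wtO_inj l (k k' : L) : O l k = O l k' -> k l = k' l.
Proof. by rewrite wtO.unlock => /(mulfI (w_neq0 l))/(expz_inj q_neq0 q_nroot). Qed.

Lemma lattice_neq (k k' : L) : k != k' -> exists l, O l k != O l k'.
Proof.
move=> kk; case: (pselect (exists l, O l k != O l k')) => // no; case/negP: kk.
apply/eqP/ffunP=> l; apply: wtO_inj; apply/eqP; apply: contraT => h.
by case: no; exists l.
Qed.

(** Inside the box no step has a vanishing coefficient. *)
Lemma box_edge l (k : L) : box k -> box (k + unit_vec l) ->
  sh (O l (k + unit_vec l)) != 0.
Proof.
move=> b b'; rewrite wtO.unlock !ffunE eqxx /=.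
case: (lerP 0 (k l)) => h; last by apply: b; lia.
by apply: b'; rewrite !ffunE eqxx /=; lia.
Qed.

Section Submodule.
Variable Sm : W -> Prop.
Hypothesis subm : is_submodule (A := A) Sm.

Let SmZ c f : Sm f -> Sm (fscale c f).
Proof. by case: subm => _ _; apply. Qed.
Let SmD f g : Sm f -> Sm g -> Sm (f + g).
Proof. by case: subm => _ h _; apply: h. Qed.
Let SmA a f : Sm f -> Sm (a *: f).
Proof. by case: subm => _ _; apply. Qed.
Let SmB f g : Sm f -> Sm g -> Sm (f - g).
Proof. by move=> Sf Sg; apply: SmD => //; rewrite -scaleN1r; apply: SmA. Qed.

(** The w_l separate the weights, so a submodule contains the components of its
    elements. *)
Lemma submodule_component f k (b : box k) :
  Sm f -> weyl_coef f k != 0 -> Sm (delta b).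
Proof.
have [s sf] := weyl_finite f.
have {sf} : forall x, weyl_coef f x != 0 -> x = k \/ x \in s.
  by move=> x; case: (boolP (x \in s)) => [|/sf->]; [right | rewrite eqxx].
elim: s f => [|k1 s IH] f fs Sf fk.
  have -> : delta b = fscale (weyl_coef f k)^-1 f; last exact: SmZ.
  apply: weyl_coefP => x; rewrite weyl_coefZ weyl_coef_delta.
  case: (eqVneq x k) => [->|xk]; first by rewrite mulVf.
  case: (eqVneq (weyl_coef f x) 0) => [->|/fs[]//]; first by rewrite mulr0.
  by move=> e; rewrite e eqxx in xk.
case: (eqVneq k1 k) => [e|kk].
  apply: (IH f) => // x /fs[->|]; first by left.
  by rewrite inE e => /orP[/eqP->|]; [left | right].
have [l ol] := lattice_neq kk.
apply: (IH (weylO q l *: f - fscale (O l k1) f)).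
- move=> x; rewrite weyl_coefD weyl_coefN weyl_coefO weyl_coefZ -mulrBl.
  rewrite mulf_eq0 => /norP[ne /fs[|]]; first by left.
  rewrite inE => /orP[/eqP e|]; last by right.
  by rewrite e subrr eqxx in ne.
- by apply: SmB; [apply: SmA | apply: SmZ].
rewrite weyl_coefD weyl_coefN weyl_coefO weyl_coefZ -mulrBl mulf_neq0 //.
by rewrite subr_eq0 eq_sym.
Qed.

Lemma submodule_step l k (b : box k) (b' : box (k + unit_vec l)) :
  Sm (delta b) <-> Sm (delta b').
Proof.
have nz := box_edge b b'.
split=> [/(SmA (weylX q l))|/(SmA (weylY q l))] h; apply: submodule_component h _.
  rewrite weyl_coefX weyl_coef_delta addrK eqxx /x_coef nz mulr1.
  exact: oner_neq0.
rewrite weyl_coefY weyl_coef_delta eqxx /y_coef mulr1.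
move: nz; rewrite wtO_unit // eqxx => nz.
by rewrite mulf_neq0 // invr_neq0 // sh_q_neq0.
Qed.

Lemma box_toward0 l k : box k -> k l != 0 ->
  (0 < k l -> box (k - unit_vec l)) /\ (k l < 0 -> box (k + unit_vec l)).
Proof.
move=> b kl; split=> h m z; rewrite !ffunE => hz; apply: b;
  case: (eqVneq m l) hz => [->|_] /=; lia.
Qed.

(** The box is a product of intervals containing 0, so 0 can be reached inside it. *)
Lemma submodule_delta k (b : box k) : Sm (delta b) <-> Sm (delta (in_box0 q w)).
Proof.
have [m] : exists m : nat, \sum_l `|k l| <= m%:Z.
  by exists (absz (\sum_l `|k l|)); rewrite gez0_abs // sumr_ge0.
elim: m k b => [|m IH] k b km.
  have k0 : k = 0.
    apply/ffunP=> l; rewrite ffunE; apply/eqP; rewrite -normr_le0.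
    by apply: le_trans km; rewrite (bigD1 l) //= lerDl sumr_ge0.
  by subst k; rewrite (Prop_irrelevance b (in_box0 q w)).
case: (pselect (exists l, k l != 0)) => [[l kl]|no]; last first.
  have k0 : k = 0.
    apply/ffunP=> l; rewrite ffunE; apply/eqP; apply: contraT => h.
    by case: no; exists l.
  by subst k; rewrite (Prop_irrelevance b (in_box0 q w)).
have [dn up] := box_toward0 b kl.
have norm (x : L) : (forall m, m != l -> x m = k m) -> `|x l| + 1 <= `|k l| ->
    \sum_l `|x l| <= m%:Z.
  move=> xk h; have e1 : \sum_m `|k m| = `|k l| + \sum_(m | m != l) `|k m|.
    by rewrite (bigD1 l).
  have e2 : \sum_m `|x m| = `|x l| + \sum_(m | m != l) `|k m|.
    by rewrite (bigD1 l) //=; congr (_ + _); apply: eq_bigr => a /xk->.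
  move: km h; rewrite e1 e2; move: (\sum_(_ | _) _) (`|k l|) (`|x l|) => z a c'.
  by lia.
case: (ltrP 0 (k l)) => h.
  have b' := dn h; have b2 : box (k - unit_vec l + unit_vec l) by rewrite subrK.
  have e : Sm (delta b') <-> Sm (delta b).
    rewrite (submodule_step b' b2); move: b2; rewrite subrK => b2.
    by rewrite (Prop_irrelevance b b2).
  rewrite -e; apply: IH; apply: norm; first by move=> a al; rewrite !ffunE (negbTE al) subr0.
  by rewrite !ffunE eqxx /= (gtr0_norm h) ger0_norm; move: h; lia.
have h' : k l < 0 by rewrite lt_neqAle kl.
rewrite (submodule_step b (up h')); apply: IH; apply: norm.
  by move=> a al; rewrite !ffunE (negbTE al) addr0.
by rewrite !ffunE eqxx /= (ltr0_norm h') ler0_norm; move: h'; lia.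
Qed.

Lemma submodule_full : Sm (delta (in_box0 q w)) -> forall f, Sm f.
Proof.
move=> S0 f; have [s sf] := weyl_finite f.
have {sf} : forall x, weyl_coef f x != 0 -> x \in s.
  by move=> x; apply: contraR => /sf->.
elim: s f => [|k s IH] f fs.
  have -> : f = 0; last by case: subm.
  apply: weyl_coefP => x; rewrite weyl_coef0; apply/eqP; apply: contraT.
  by move/fs.
case: (eqVneq (weyl_coef f k) 0) => [fk|fk].
  apply: IH => x xf; have := fs _ xf; rewrite inE => /orP[/eqP e|//].
  by rewrite e fk eqxx in xf.
have b := weyl_box fk.
rewrite -[f](subrK (fscale (weyl_coef f k) (delta b))); apply: SmD; last first.
  by apply: SmZ; apply/submodule_delta.
apply: IH => x; rewrite weyl_coefD weyl_coefN weyl_coefZ weyl_coef_delta.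
case: (eqVneq x k) => [->|xk]; first by rewrite mulr1 subrr eqxx.
by rewrite mulr0 subr0 => /fs; rewrite inE (negbTE xk).
Qed.

End Submodule.

Lemma weyl_irreducible : irreducible_module W.
Proof.
split.
  exists (delta (in_box0 q w)); apply/eqP => /(congr1 (weyl_coef^~ 0)).
  by rewrite weyl_coef_delta eqxx weyl_coef0 => /eqP; rewrite oner_eq0.
move=> Sm subm; case: (pselect (exists2 f, Sm f & f != 0)) => [[f Sf fn]|no].
  right; apply: submodule_full => //.
  case: (pselect (exists k, weyl_coef f k != 0)) => [[k fk]|no].
    by apply/(submodule_delta subm (weyl_box fk)); apply: (submodule_component subm) fk.
  case/eqP: fn; apply: weyl_coefP => k; rewrite weyl_coef0; apply/eqP.
  by apply: contraT => fk; case: no; exists k.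
left=> v Sv; apply/eqP; apply: contraT => vn; case: no; by exists v.
Qed.

End WeylModuleTheory.

(** * Weight spaces of the Weyl modules *)

Section WeylPointed.
Variables (F : fieldType) (q : F) (n : nat).
Hypotheses (q_neq0 : q != 0) (q_nroot : not_root_of_unity q).
Local Notation L := (lattice n).
Local Notation I := 'I_n.+1.
Variable w : I -> F.
Hypothesis w_neq0 : forall l, w l != 0.
Local Notation O := (wtO q w).
Local Notation W := (weyl_module q_neq0 q_nroot w_neq0).
Local Notation box := (in_box q w).
Local Notation R := (weyl_torus q n.+1).
Local Notation wc := (@weyl_coef F q n q_neq0 q_nroot w w_neq0).
Local Notation delta := (@delta F q n q_neq0 q_nroot w w_neq0).

Lemma torus_diagonal (r : R) :
  exists chi : L -> F, forall (f : W) k, wc (subalg_val r *: f) k = chi k * wc f k.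
Proof.
case: r => a /= /asboolP; elim=> {a} [a [l|l]|c|a b _ [x xE] _ [y yE]|a b _ [x xE] _ [y yE]].
- by exists (O l) => f k; rewrite weyl_coefO.
- by exists (fun k => (O l k)^-1) => f k; rewrite weyl_coefOV.
- by exists (fun _ => c) => f k; exact: (weyl_coefZ c (f : W)).
- by exists (fun k => x k + y k) => f k; rewrite scalerDl weyl_coefD xE yE mulrDl.
- by exists (fun k => x k * y k) => f k; rewrite -scalerA xE yE mulrA.
Qed.

(** The kernel of the character by which the torus acts at k. *)
Definition weight_ideal (k : L) : classical_sets.set R :=
  fun r => forall f : W, wc (subalg_val r *: f) k = 0.

Lemma weight_idealP r k (chi : L -> F) (b : box k) :
  (forall (f : W) k, wc (subalg_val r *: f) k = chi k * wc f k) ->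
  weight_ideal k r <-> chi k = 0.
Proof.
move=> chiE; split=> [/(_ (delta b))|e f]; last by rewrite chiE e mul0r.
by rewrite chiE weyl_coef_delta eqxx mulr1.
Qed.

Lemma weight_ideal_ideal k : is_ideal (weight_ideal k).
Proof.
split.
- by move=> f; rewrite /= scale0r.
- by move=> x y Ix Iy f; rewrite /= scalerDl weyl_coefD Ix Iy addr0.
- move=> a x b Ix f; rewrite /= -!scalerA; have [chi chiE] := torus_diagonal a.
  by rewrite chiE Ix mulr0.
Qed.

Lemma weight_ideal_maximal k : box k -> is_maximal_ideal (weight_ideal k).
Proof.
move=> b; split; first exact: weight_ideal_ideal.
  move=> /(_ (delta b)); rewrite /= scale1r weyl_coef_delta eqxx => /eqP.
  by rewrite oner_eq0.
move=> J [J0 JD JM] J1 IJ x Jx; have [chi chiE] := torus_diagonal x.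
apply/(weight_idealP b chiE); apply/eqP; apply: contraT => c0; case: J1.
pose y : R := scal (chi k) - x.
have Jy : J y.
  apply: IJ => f; rewrite /= scalerBl weyl_coefD weyl_coefN chiE.
  by have := weyl_coefZ (chi k) (f : W) k; rewrite /fscale => ->; rewrite subrr.
have Jc : J (scal (chi k)) by rewrite -[scal _](subrK x); apply: JD.
have -> : 1 = 1 * scal (chi k) * scal (chi k)^-1 :> R.
  by rewrite mul1r -rmorphM /= mulfV // rmorph1.
exact: JM.
Qed.

Lemma weight_ideal_inj k k' : box k -> box k' ->
  weight_ideal k = weight_ideal k' -> k = k'.
Proof.
move=> b b' e; apply/eqP; apply: contraT => kk.
have [l ol] := lattice_neq q_neq0 q_nroot w_neq0 kk.
pose r : R := subalg_gen (TorusO q l) - scal (O l k).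
have rE (f : W) x : wc (subalg_val r *: f) x = (O l x - O l k) * wc f x.
  rewrite /= scalerBl weyl_coefD weyl_coefN weyl_coefO mulrBl; congr (_ - _).
  exact: (weyl_coefZ (O l k) f x).
have : weight_ideal k' r.
  by rewrite -e; apply/(weight_idealP (chi := fun x => O l x - O l k) b rE); rewrite subrr.
move/(weight_idealP (chi := fun x => O l x - O l k) b' rE)/eqP.
by rewrite subr_eq0 eq_sym (negbTE ol).
Qed.

(** A maximal ideal is determined by one weight that occurs in its weight space. *)
Lemma weight_space_ideal (J : classical_sets.set R) (f : W) k :
  is_maximal_ideal J -> weyl_weight_space J f -> wc f k != 0 ->
  J = weight_ideal k.
Proof.
move=> [_ _ Jmax] Jf fk; have b := weyl_box fk.
have JI x : J x -> weight_ideal k x.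
  move=> Jx; have [chi chiE] := torus_diagonal x.
  apply/(weight_idealP b chiE); have := congr1 (wc^~ k) (Jf _ Jx).
  by rewrite chiE weyl_coef0 => /eqP; rewrite mulf_eq0 (negbTE fk) orbF => /eqP.
have [_ I1 _] := weight_ideal_maximal b.
apply/funext => x; apply/propext; split; first exact: JI.
by apply: Jmax => //; exact: weight_ideal_ideal.
Qed.

Lemma delta_weight k (b : box k) : weyl_weight_space (weight_ideal k) (delta b).
Proof.
move=> r Ir; have [chi chiE] := torus_diagonal r.
apply: weyl_coefP => x; rewrite chiE weyl_coef0 weyl_coef_delta.
case: (eqVneq x k) => [->|_]; last by rewrite mulr0.
by rewrite (proj1 (weight_idealP b chiE) Ir) mul0r.
Qed.

Lemma weyl_module_pointed : weyl_completely_pointed W.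
Proof.
split; first split.
- move=> f; have [s sf] := weyl_finite f.
  pose t := undup [seq k <- s | wc f k != 0].
  have tf k : wc f k != 0 -> k \in t.
    by move=> fk; rewrite mem_undup mem_filter fk /=; apply: contraR fk => /sf->.
  have tb k : k \in t -> box k.
    by rewrite mem_undup mem_filter => /andP[fk _]; exact: weyl_box fk.
  exists (map weight_ideal t).
  exists (fun J => weyl_restrict (fun k => weight_ideal k = J) f); split.
  + rewrite map_inj_in_uniq ?undup_uniq // => k k1 kt kt1.
    by apply: weight_ideal_inj; apply: tb.
  + move=> J /mapP[k kt ->]; have b := tb k kt; split; first exact: weight_ideal_maximal.
    move=> r Ir; have [chi chiE] := torus_diagonal r.
    apply: weyl_coefP => x; rewrite chiE weyl_coef0 weyl_coef_restrict.
    case: asboolP => [e|_]; last by rewrite mulr0.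
    by rewrite -chiE; move: Ir; rewrite -e; apply.
  apply: weyl_coefP => x; rewrite weyl_coef_sum big_map.
  case: (eqVneq (wc f x) 0) => [fx|fx].
    by rewrite big1_seq // => k _; rewrite weyl_coef_restrict fx if_same.
  rewrite (bigD1_seq x) ?undup_uniq ?tf // weyl_coef_restrict asboolT //.
  rewrite [RHS]addrC big1_seq ?add0r // => k /andP[kx kt]; have bk := tb k kt; rewrite weyl_coef_restrict.
  case: asboolP => // e; case/eqP: kx; apply/esym.
  by apply: weight_ideal_inj e => //; apply: weyl_box fx.
- move=> s f us sf sum0 J Js; apply: weyl_coefP => k; rewrite weyl_coef0.
  apply/eqP; apply: contraT => fk; have [mJ wJ] := sf J Js.
  have JE := weight_space_ideal mJ wJ fk.
  move: (congr1 (wc^~ k) sum0); rewrite weyl_coef_sum (bigD1_seq J) //=.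
  rewrite big1_seq ?addr0 => [/eqP|J' /andP[JJ' Js']]; first by rewrite (negbTE fk).
  apply/eqP; apply: contraT => fk'; have [mJ' wJ'] := sf J' Js'.
  by rewrite (weight_space_ideal mJ' wJ' fk') JE eqxx in JJ'.
move=> J mJ [v Jv vn].
have [k vk] : exists k, wc v k != 0.
  case: (pselect (exists k, wc v k != 0)) => // no; case/eqP: vn.
  apply: weyl_coefP => k; rewrite weyl_coef0; apply/eqP.
  by apply: contraT => vk; case: no; exists k.
have b := weyl_box vk; have JE := weight_space_ideal mJ Jv vk.
exists (delta b); rewrite JE; split; first exact: delta_weight.
  apply/eqP => /(congr1 (wc^~ k)); rewrite weyl_coef_delta eqxx weyl_coef0.
  by move/eqP; rewrite oner_eq0.
move=> f; split=> [If|[c ->] r Ir]; last first.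
  rewrite /fscale scalerA -(scalC c) -scalerA (delta_weight b Ir).
  by rewrite scaler0.
exists (wc f k); apply: weyl_coefP => x; rewrite weyl_coefZ weyl_coef_delta.
case: (eqVneq x k) => [->|xk]; first by rewrite mulr1.
rewrite mulr0; apply/eqP; apply: contraT => fx.
have e := weight_space_ideal (weight_ideal_maximal b) If fx.
by rewrite (weight_ideal_inj b (weyl_box fx) e) eqxx in xk.
Qed.

End WeylPointed.

(** * Generators of the quantum sl_(n+1) *)

Section SlGenerators.
Variables (F : fieldType) (q : F) (n : nat).
Local Notation U := (Uqsl q n).
Local Notation rel := (@gl_rel F q n).
Implicit Types (i j : 'I_n).

Definition slE i : U := subalg_gen (SlE q i).
Definition slF i : U := subalg_gen (SlF q i).
Definition slKV i : U := subalg_gen (SlKV q i).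

Lemma Uqsl_ind (P : U -> Prop) :
  (forall i, P (slE i)) -> (forall i, P (slF i)) ->
  (forall i, P (slK q i)) -> (forall i, P (slKV i)) ->
  (forall c, P (scal c)) -> (forall a b, P a -> P b -> P (a + b)) ->
  (forall a b, P a -> P b -> P (a * b)) -> forall u, P u.
Proof.
move=> PE PF PK PKV Ps PD PM.
suff all a : in_subalgebra (@sl_gen F q n) a -> forall u : U, subalg_val u = a -> P u.
  by case=> a /[dup] /asboolP /all Pa ain; apply: Pa.
elim=> {a} [a g|c|a b Sa IHa Sb IHb|a b Sa IHa Sb IHb] u ua.
- by case: g u ua => i u ua; [have -> : u = slE i | have -> : u = slF i |
    have -> : u = slK q i | have -> : u = slKV i] => //; apply: val_inj.
- by have -> : u = scal c by apply: val_inj.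
- have ain : a \in subalgebra_pred (@sl_gen F q n) by apply/asboolP.
  have bin : b \in subalgebra_pred (@sl_gen F q n) by apply/asboolP.
  have -> : u = (Subalg ain : U) + (Subalg bin : U) by apply: val_inj.
  by apply: PD; [apply: IHa | apply: IHb].
- have ain : a \in subalgebra_pred (@sl_gen F q n) by apply/asboolP.
  have bin : b \in subalgebra_pred (@sl_gen F q n) by apply/asboolP.
  have -> : u = (Subalg ain : U) * (Subalg bin : U) by apply: val_inj.
  by apply: PM; [apply: IHa | apply: IHb].
Qed.

Let projZ c x :
  presented_proj rel (c *: x) = scal c * presented_proj rel x.
Proof. by rewrite free_scaleE rmorphM. Qed.

Let projE := (rmorphD (presented_proj rel), rmorphB (presented_proj rel),
  rmorphM (presented_proj rel), rmorph1 (presented_proj rel), rmorph0 (presented_proj rel)).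

Lemma glK_V l : glK q l * glKV q l = 1 :> Uqgl q n.
Proof. by have /presented_rel := GlRel_KKV q l; rewrite !projE. Qed.

Lemma glK_VK l : glKV q l * glK q l = 1 :> Uqgl q n.
Proof. by have /presented_rel := GlRel_KVK q l; rewrite !projE. Qed.

Lemma glKK l m : glK q l * glK q m = glK q m * glK q l :> Uqgl q n.
Proof. by have /presented_rel := GlRel_KK q l m; rewrite !projE. Qed.

Lemma glK_E l i : glK q l * glE q i = scal (q ^ glwt l i) * glE q i * glK q l.
Proof.
have /presented_rel := GlRel_KE q i l; rewrite projZ !rmorphM /= => e.
by rewrite -[glE q i in RHS]/(presented_proj _ _) -e -!mulrA glK_VK mulr1.
Qed.

Lemma glK_F l i : glK q l * glF q i = scal (q ^ (- glwt l i)) * glF q i * glK q l.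
Proof.
have /presented_rel := GlRel_KF q i l; rewrite projZ !rmorphM /= => e.
by rewrite -[glF q i in RHS]/(presented_proj _ _) -e -!mulrA glK_VK mulr1.
Qed.

Lemma slKV_K i : slKV i * slK q i = 1.
Proof.
apply: val_inj => /=; rewrite -!mulrA [glK q (hi i) * _]mulrA -glKK.
by rewrite -[_ * glK q (hi i) * _]mulrA glK_V mulr1 glK_VK.
Qed.

Lemma glKV_E l i : q != 0 -> glKV q l * glE q i = scal (q ^ (- glwt l i)) * glE q i * glKV q l.
Proof.
move=> q0; transitivity (glKV q l * (scal (q ^ (- glwt l i)) * (glK q l * glE q i)) * glKV q l).
  rewrite glK_E 2![scal _ * (_ * _)]mulrA -(rmorphM (@scal F (Uqgl q n))) -expfzDr // addNr expr0z rmorph1.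
  by rewrite mul1r -!mulrA glK_V mulr1.
by rewrite [_ * (scal _ * _)]mulrA -scalC -!mulrA [glKV q l * (_ * _)]mulrA glK_VK mul1r.
Qed.

Lemma glKV_F l i : q != 0 -> glKV q l * glF q i = scal (q ^ glwt l i) * glF q i * glKV q l.
Proof.
move=> q0; transitivity (glKV q l * (scal (q ^ glwt l i) * (glK q l * glF q i)) * glKV q l).
  rewrite glK_F 2![scal _ * (_ * _)]mulrA -(rmorphM (@scal F (Uqgl q n))) -expfzDr // subrr expr0z rmorph1.
  by rewrite mul1r -!mulrA glK_V mulr1.
by rewrite [_ * (scal _ * _)]mulrA -scalC -!mulrA [glKV q l * (_ * _)]mulrA glK_VK mul1r.
Qed.

Lemma slK_E i j : q != 0 -> slK q i * slE j =
  scal (q ^ (alpha j (lo i) - alpha j (hi i))) * (slE j * slK q i).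
Proof.
move=> q0; apply: val_inj => /=.
transitivity (scal (q ^ (- glwt (hi i) j)) * (glK q (lo i) * glE q j) * glKV q (hi i)).
  by rewrite -[LHS]mulrA glKV_E // !mulrA scalC.
by rewrite glK_E !mulrA -(rmorphM (@scal F (Uqgl q n))) -expfzDr // !ffunE addrC.
Qed.

Lemma slK_F i j : q != 0 -> slK q i * slF j =
  scal (q ^ ((- alpha j : lattice n) (lo i) - (- alpha j : lattice n) (hi i))) *
    (slF j * slK q i).
Proof.
move=> q0; apply: val_inj => /=.
transitivity (scal (q ^ (glwt (hi i) j)) * (glK q (lo i) * glF q j) * glKV q (hi i)).
  by rewrite -[LHS]mulrA glKV_F // !mulrA scalC.
by rewrite glK_F !mulrA -(rmorphM (@scal F (Uqgl q n))) -expfzDr // !ffunE opprK addrC.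
Qed.

Lemma slE_F i j : slE i * slF j - slF j * slE i =
  scal ((i == j)%:R / sh q) * (slK q i - slKV i).
Proof.
apply: val_inj => /=; have /presented_rel := GlRel_EF q i j.
by rewrite projZ !rmorphB !rmorphM.
Qed.

Lemma slEE i j : distant i j -> slE i * slE j = slE j * slE i.
Proof.
move=> d; apply: val_inj => /=; have /presented_rel := GlRel_EE q d.
by rewrite !rmorphM.
Qed.

Lemma sl_serre i j : adjacent i j ->
  slE i * (slE i * slE j) - scal (qtwo q) * (slE i * (slE j * slE i))
    + slE j * (slE i * slE i) = 0.
Proof.
move=> a; apply: val_inj => /=; have /presented_rel := GlRel_serreE q a.
by rewrite rmorphD rmorphB /= projZ !rmorphM /= rmorph0 -!mulrA.
Qed.

End SlGenerators.

Section ScalarAction.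
Variables (F : fieldType) (A : pzAlgType F) (V : lmodType A).
Implicit Types (u v : V) (c d : F) (a : A).

Lemma fscaleDl c d v : fscale (c + d) v = fscale c v + fscale d v.
Proof. by rewrite /fscale rmorphD scalerDl. Qed.
Lemma fscaleBl c d v : fscale (c - d) v = fscale c v - fscale d v.
Proof. by rewrite /fscale rmorphB scalerBl. Qed.
Lemma fscaleA c d v : fscale c (fscale d v) = fscale (c * d) v.
Proof. by rewrite /fscale scalerA rmorphM. Qed.
Lemma fscale1 v : fscale 1 v = v.
Proof. by rewrite /fscale rmorph1 scale1r. Qed.
Lemma fscale0l v : fscale 0 v = 0.
Proof. by rewrite /fscale rmorph0 scale0r. Qed.
Lemma fscale0r c : fscale c 0 = 0 :> V.
Proof. exact: scaler0. Qed.
Lemma act_fscale a c v : a *: fscale c v = fscale c (a *: v).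
Proof. by rewrite /fscale !scalerA scalC. Qed.
Lemma actM a b v : (a * b) *: v = a *: (b *: v).
Proof. by rewrite scalerA. Qed.
Lemma act_scal a c v : (scal c * a) *: v = fscale c (a *: v).
Proof. by rewrite actM. Qed.

Lemma fscale_eq0 c v : v != 0 -> fscale c v = 0 -> c = 0.
Proof.
move=> v0 e; apply/eqP; apply: contraT => c0; case/eqP: v0.
by rewrite -[v]fscale1 -(mulVf c0) -fscaleA e fscale0r.
Qed.

End ScalarAction.

(** * A weight basis *)

Lemma choice_fun (X Y : Type) (P : X -> Y -> Prop) :
  (forall x, exists y, P x y) -> exists f : X -> Y, forall x, P x (f x).
Proof. by move=> /choice[f fP]; exists f. Qed.

Section WeightBasis.
Variables (F : fieldType) (q : F) (n : nat) (V : lmodType (Uqsl q n)).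
Hypotheses (q_neq0 : q != 0) (q_nroot : not_root_of_unity q).
Local Notation L := (lattice n).
Local Notation U := (Uqsl q n).
Implicit Types (i j : 'I_n) (k x : L) (u v : V).

(** S is the support, and e k = 0 outside S, so that no case distinction is needed in
    the formulas for the action. *)
Record weight_basis (lam : 'I_n -> F) (S : L -> Prop) (e : L -> V)
    (eps phi : 'I_n -> L -> F) : Prop := WeightBasis {
  wb_lam : forall i, lam i != 0;
  wb_S0 : S 0;
  wb_sum : forall k, S k -> \sum_l k l = 0;
  wb_out : forall k, ~ S k -> e k = 0;
  wb_K : forall i k, slK q i *: e k = fscale (wtK q lam i k) (e k);
  wb_E : forall i k, slE q i *: e k = fscale (eps i k) (e (k + alpha i));
  wb_F : forall i k, slF q i *: e k = fscale (phi i k) (e (k - alpha i));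
  wb_eps : forall i k, eps i k != 0 -> S k /\ S (k + alpha i);
  wb_phi : forall i k, phi i k != 0 -> S k /\ S (k - alpha i);
  wb_free : forall (s : seq L) (c : L -> F), uniq s -> (forall k, k \in s -> S k) ->
    \sum_(k <- s) fscale (c k) (e k) = 0 -> forall k, k \in s -> c k = 0
}.

Definition weight (lam : 'I_n -> F) k : {ffun 'I_n -> F} := [ffun i => wtK q lam i k].

Lemma sum_D (k x : L) : \sum_l (k + x) l = \sum_l k l + \sum_l x l.
Proof. by rewrite -big_split; apply: eq_bigr => l _; rewrite ffunE. Qed.

Lemma sum_N (k : L) : \sum_l (- k) l = - \sum_l k l.
Proof. by rewrite -sumrN; apply: eq_bigr => l _; rewrite ffunE. Qed.

(** The K_i give the differences of consecutive coordinates of k. *)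
Lemma weight_inj lam k x : (forall i, lam i != 0) ->
  \sum_l k l = 0 -> \sum_l x l = 0 -> weight lam k = weight lam x -> k = x.
Proof.
move=> lam0 k0 x0 kx.
have d i : k (lo i) - k (hi i) = x (lo i) - x (hi i).
  have := congr1 (fun f : {ffun _ -> _} => f i) kx.
  by rewrite !ffunE wtK.unlock => /(mulfI (lam0 i))/(expz_inj q_neq0 q_nroot).
have [z zE] : exists z : int, forall l, k l = x l + z.
  exists (k ord0 - x ord0) => -[m]; elim: m => [|m IH] mn.
    have -> : Ordinal mn = ord0 by apply: val_inj.
    by rewrite addrC subrK.
  have mn' : (m < n)%N by [].
  have := d (Ordinal mn'); have := IH (ltnW mn).
  have -> : Ordinal (ltnW mn) = lo (Ordinal mn') by apply: val_inj.
  have -> : Ordinal mn = hi (Ordinal mn') by apply: val_inj.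
  by move: (k _) (k _) (x _) (x _) (k ord0 - x ord0) => a b c d' z; lia.
apply/ffunP=> l; rewrite zE; suff -> : z = 0 by rewrite addr0.
move: k0; rewrite (eq_bigr _ (fun l _ => zE l)) big_split /= x0 add0r.
by rewrite sumr_const card_ord -mulr_natr => /eqP; rewrite mulf_eq0 Num.Theory.pnatr_eq0 orbF => /eqP.
Qed.

Let actC (a b : U) c v : a * b = scal c * (b * a) ->
  a *: (b *: v) = fscale c (b *: (a *: v)).
Proof. by move=> e; rewrite -!actM e act_scal. Qed.

(** Take a nonzero weight vector and label by k the translates of its weight; E_i and
    F_i map each weight space into a translate of dimension at most one. *)
Lemma weight_basis_exists : (exists v : V, v != 0) -> sl_completely_pointed V ->
  exists lam S e eps phi, weight_basis lam S e eps phi.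
Proof.
move=> [v0 v0n] [[gen free] one].
have [lam [u [lam0 lamu un]]] : exists (lam : {ffun 'I_n -> F}) u,
    [/\ is_sl_weight lam, sl_weight_space lam u & u != 0].
  have [s [f [_ sf sE]]] := gen v0.
  case: (pselect (exists2 j, j \in s & f j != 0)) => [[j /sf[lj fj] jn]|no].
    by exists j, (f j).
  case/eqP: v0n; rewrite sE big1_seq // => j /andP[_ js]; apply/eqP.
  by apply: contraT => fj; case: no; exists j.
pose X k := @sl_weight_space F q n V (weight lam k).
pose S k := \sum_l k l = 0 /\ exists2 v, X k v & v != 0.
have wt0 k : is_sl_weight (weight lam k).
  by move=> i; rewrite ffunE wtK_neq0.
have XK k v : X k v -> forall i, slK q i *: v = fscale (wtK q lam i k) v.
  by move=> Xv i; have := Xv i; rewrite ffunE.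
have X0 k : X k 0 by move=> i; rewrite scaler0 fscale0r.
have XE i k v : X k v -> X (k + alpha i) (slE q i *: v).
  move=> /XK Xv j; rewrite ffunE (actC _ (slK_E _ _ q_neq0)) Xv act_fscale.
  by rewrite fscaleA wtKD.
have XF i k v : X k v -> X (k - alpha i) (slF q i *: v).
  move=> /XK Xv j; rewrite ffunE (actC _ (slK_F _ _ q_neq0)) Xv act_fscale.
  by rewrite fscaleA wtKD.
have /choice_fun[e eP] : forall k, exists y : V,
    (S k -> [/\ X k y, y != 0 & forall v, X k v -> exists c, v = fscale c y])
    /\ (~ S k -> y = 0).
  move=> k; case: (pselect (S k)) => [Sk|nS]; last by exists 0.
  have [_ ex] := Sk; have [v [Xv vn vP]] := one _ (wt0 k) ex.
  by exists v; split=> // _; split=> // x /vP.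
have eX k : X k (e k).
  by case: (pselect (S k)) => [/(proj1 (eP k))[]|/(proj2 (eP k))->].
have coef_ex k v : X k v -> \sum_l k l = 0 ->
    exists c, v = fscale c (e k) /\ (c != 0 -> S k).
  move=> Xv k0; case: (pselect (S k)) => [Sk|nS].
    by have [_ _ /(_ _ Xv)[c]] := proj1 (eP k) Sk; exists c.
  exists 0; rewrite fscale0l eqxx; split=> //.
  by apply/eqP; apply: contraT => vn; case: nS; split=> //; exists v.
have /choice_fun[eps epsP] : forall i, exists a : L -> F, forall k,
    slE q i *: e k = fscale (a k) (e (k + alpha i)) /\
    (a k != 0 -> S k /\ S (k + alpha i)).
  move=> i; apply: (choice_fun (P := fun k a => slE q i *: e k =
    fscale a (e (k + alpha i)) /\ (a != 0 -> S k /\ S (k + alpha i)))) => k.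
  case: (pselect (S k)) => [Sk|nS]; last first.
    by exists 0; rewrite fscale0l (proj2 (eP k)) // scaler0 eqxx.
  have k0 : \sum_l (k + alpha i) l = 0 by rewrite sum_D sum_alpha addr0; case: Sk.
  have [c [cE cS]] := coef_ex _ _ (XE i _ _ (eX k)) k0.
  by exists c; split=> // /cS.
have /choice_fun[phi phiP] : forall i, exists a : L -> F, forall k,
    slF q i *: e k = fscale (a k) (e (k - alpha i)) /\
    (a k != 0 -> S k /\ S (k - alpha i)).
  move=> i; apply: (choice_fun (P := fun k a => slF q i *: e k =
    fscale a (e (k - alpha i)) /\ (a != 0 -> S k /\ S (k - alpha i)))) => k.
  case: (pselect (S k)) => [Sk|nS]; last first.
    by exists 0; rewrite fscale0l (proj2 (eP k)) // scaler0 eqxx.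
  have k0 : \sum_l (k - alpha i) l = 0.
    by rewrite sum_D sum_N sum_alpha subr0; case: Sk.
  have [c [cE cS]] := coef_ex _ _ (XF i _ _ (eX k)) k0.
  by exists c; split=> // /cS.
exists lam, S, e, eps, phi; split=> //.
- split; first by rewrite big1 // => l _; rewrite ffunE.
  exists u => // i; rewrite lamu ffunE wtK.unlock !ffunE subrr expr0z mulr1.
  by [].
- by move=> k [].
- by move=> k /(proj2 (eP k)).
- by move=> i k; apply: XK.
- by move=> i k; case: (epsP i k).
- by move=> i k; case: (phiP i k).
- by move=> i k; case: (epsP i k).
- by move=> i k; case: (phiP i k).
move=> s c us sS sum0 k ks.
pose f m := \sum_(x <- s | weight lam x == m) fscale (c x) (e x).
have winj : {in s &, injective (weight lam)}.
  by move=> x y /sS[x0 _] /sS[y0 _]; apply: weight_inj.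
have fE x : x \in s -> f (weight lam x) = fscale (c x) (e x).
  move=> xs; rewrite /f big_mkcond (bigD1_seq x) //= eqxx big1_seq ?addr0 // => y.
  move=> /andP[yx ys]; case: eqP => // /(winj _ _ ys xs) e1.
  by rewrite e1 eqxx in yx.
have := free (map (weight lam) s) f _ _ _ (weight lam k) (map_f _ ks).
rewrite fE // => h; apply: (@fscale_eq0 _ _ _ _ (e k)).
  by case: (proj1 (eP k) (sS k ks)).
apply: h.
- by rewrite map_inj_in_uniq.
- move=> _ /mapP[x xs ->]; split; first exact: wt0.
  by rewrite fE // => i; rewrite act_fscale eX !fscaleA mulrC.
by rewrite big_map big_seq (eq_bigr (fun x => fscale (c x) (e x))) -?big_seq.
Qed.

End WeightBasis.

(** * Coordinates in the weight basis *)

Section Coordinates.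
Variables (F : fieldType) (q : F) (n : nat) (V : lmodType (Uqsl q n)).
Hypotheses (q_neq0 : q != 0) (q_nroot : not_root_of_unity q).
Hypothesis irr : irreducible_module V.
Local Notation L := (lattice n).
Local Notation U := (Uqsl q n).
Implicit Types (i j : 'I_n) (k x : L) (u v : V) (s : seq L) (f g : L -> F).
Variables (lam : 'I_n -> F) (S : L -> Prop) (e : L -> V) (eps phi : 'I_n -> L -> F).
Hypothesis B : weight_basis lam S e eps phi.

Definition is_coord v f := exists s, [/\ uniq s, forall k, k \notin s -> f k = 0,
  forall k, f k != 0 -> S k & v = \sum_(k <- s) fscale (f k) (e k)].

Lemma e_neq0 k : S k -> e k != 0.
Proof.
move=> Sk; apply/eqP=> e0; have := wb_free B (s := [:: k]) (c := fun _ => 1) isT.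
have Sx x : x \in [:: k] -> S x by rewrite inE => /eqP->.
rewrite big_seq1 e0 fscale0r => /(_ Sx erefl k (mem_head _ _))/eqP.
by rewrite oner_eq0.
Qed.

Lemma wcoord_sum v f s : is_coord v f -> uniq s -> (forall k, k \notin s -> f k = 0) ->
  v = \sum_(k <- s) fscale (f k) (e k).
Proof.
move=> [t [ut tf _ ->]] us sf; rewrite (bigID (mem s)) [RHS](bigID (mem t)) /=.
rewrite [X in _ + X]big1 ?addr0 => [|k /sf->]; last exact: fscale0l.
rewrite [X in _ = _ + X]big1 ?addr0 => [|k /tf->]; last exact: fscale0l.
rewrite -big_filter -[RHS]big_filter; apply/perm_big/uniq_perm; rewrite ?filter_uniq //.
by move=> k; rewrite !mem_filter andbC.
Qed.

Lemma wcoord_uniq v f g : is_coord v f -> is_coord v g -> forall k, f k = g k.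
Proof.
move=> cf cg k; have [s [us sf fS _]] := cf; have [t [ut tg gS _]] := cg.
pose r := [seq x <- undup (s ++ t) | (f x != 0) || (g x != 0)].
have ur : uniq r by rewrite filter_uniq ?undup_uniq.
have rf x : x \notin r -> (f x = 0) * (g x = 0).
  rewrite mem_filter mem_undup mem_cat negb_and !negb_or !negbK.
  by case/orP=> [/andP[/eqP-> /eqP->]|/andP[/sf-> /tg->]].
case: (boolP (k \in r)) => [kr|/rf[-> ->] //].
apply/eqP; rewrite -subr_eq0; apply/eqP.
apply: (wb_free B (s := r) (c := fun k => f k - g k)) => // [x|].
  by rewrite mem_filter => /andP[/orP[/fS|/gS]].
rewrite (eq_bigr _ (fun x _ => fscaleBl _ _ (e x))) sumrB.
rewrite -(wcoord_sum cf) // -?(wcoord_sum cg) ?subrr // => x /rf[] //.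
Qed.

Lemma wcoord0 : is_coord 0 (fun _ => 0).
Proof. by exists [::]; split=> // [k|]; rewrite ?eqxx ?big_nil. Qed.

Lemma wcoordD u v f g : is_coord u f -> is_coord v g ->
  is_coord (u + v) (fun k => f k + g k).
Proof.
move=> cf cg; have [s [us sf fS _]] := cf; have [t [ut tg gS _]] := cg.
have rf x : x \notin undup (s ++ t) -> (f x = 0) * (g x = 0).
  by rewrite mem_undup mem_cat negb_or => /andP[/sf-> /tg->].
exists (undup (s ++ t)); split; first exact: undup_uniq.
- by move=> k /rf[-> ->]; rewrite addr0.
- move=> k; case: (eqVneq (f k) 0) => [->|/fS //]; rewrite add0r; exact: gS.
rewrite (wcoord_sum cf (undup_uniq _) (fun x h => (rf x h).1)).
rewrite (wcoord_sum cg (undup_uniq _) (fun x h => (rf x h).2)).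
by rewrite -big_split; apply: eq_bigr => k _; rewrite fscaleDl.
Qed.

Lemma wcoordZ c v f : is_coord v f -> is_coord (fscale c v) (fun k => c * f k).
Proof.
move=> [s [us sf fS ->]]; exists s; split=> // [k /sf->|k|]; first by rewrite mulr0.
  by rewrite mulf_eq0 => /norP[_ /fS].
by rewrite [LHS]scaler_sumr; apply: eq_bigr => k _; rewrite -fscaleA.
Qed.

Lemma wcoord_e k : S k -> is_coord (e k) (fun x => (x == k)%:R).
Proof.
move=> Sk; exists [:: k]; split=> // [x|x|]; rewrite ?inE; first by move/negbTE->.
  by case: (eqVneq x k) => [->|_]; rewrite ?eqxx.
by rewrite big_seq1 eqxx fscale1.
Qed.

Lemma is_submodule_gen (P : V -> Prop) : P 0 -> (forall u v, P u -> P v -> P (u + v)) ->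
  (forall c v, P v -> P (fscale c v)) -> (forall i v, P v -> P (slE q i *: v)) ->
  (forall i v, P v -> P (slF q i *: v)) -> (forall i v, P v -> P (slK q i *: v)) ->
  (forall i v, P v -> P (slKV q i *: v)) -> is_submodule (A := U) P.
Proof.
move=> P0 PD Pc PE PF PK PKV; split=> // a.
elim/(@Uqsl_ind F q n): a => // [a b Pa Pb v Pv|a b Pa Pb v Pv].
  by rewrite scalerDl; apply: PD; [apply: Pa | apply: Pb].
by rewrite actM; apply/Pa/Pb.
Qed.

Let spans v := exists f, is_coord v f.

Let spans_e k : spans (e k).
Proof.
case: (pselect (S k)) => [/wcoord_e|nS]; first by exists (fun x => (x == k)%:R).
by rewrite (wb_out B nS); exists (fun _ => 0); apply: wcoord0.
Qed.

Let spans_act (a : U) : (forall k, spans (a *: e k)) -> forall v, spans v -> spans (a *: v).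
Proof.
move=> ae v [f [s [_ _ _ ->]]]; rewrite scaler_sumr.
apply: big_ind => [|u u' [g cg] [g' cg']|k _].
- by exists (fun _ => 0); apply: wcoord0.
- by exists (fun k => g k + g' k); apply: wcoordD.
by rewrite act_fscale; have [g cg] := ae k; exists (fun x => f k * g x); apply: wcoordZ.
Qed.

Lemma slKV_e i k : slKV q i *: e k = fscale (wtK q lam i k)^-1 (e k).
Proof.
have K0 : wtK q lam i k != 0 by apply: wtK_neq0 => //; exact: wb_lam B.
have := congr1 (fun v => fscale (wtK q lam i k)^-1 (slKV q i *: v)) (wb_K B i k).
by rewrite -actM slKV_K scale1r act_fscale fscaleA mulVf // fscale1.
Qed.

(** The vectors with coordinates form a nonzero submodule. *)
Lemma wcoord_ex v : spans v.
Proof.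
have spZ c u : spans u -> spans (fscale c u).
  by move=> [f cf]; exists (fun k => c * f k); apply: wcoordZ.
have subm : is_submodule (A := U) spans.
  apply: is_submodule_gen => //.
  - by exists (fun _ => 0); apply: wcoord0.
  - by move=> u u' [g cg] [g' cg']; exists (fun k => g k + g' k); apply: wcoordD.
  - by move=> i; apply: spans_act => k; rewrite (wb_E B); apply: spZ.
  - by move=> i; apply: spans_act => k; rewrite (wb_F B); apply: spZ.
  - by move=> i; apply: spans_act => k; rewrite (wb_K B); apply: spZ.
  - by move=> i; apply: spans_act => k; rewrite slKV_e; apply: spZ.
have [_ /(_ _ subm)[/(_ _ (spans_e 0))/eqP|]] := irr; last exact.
by rewrite (negbTE (e_neq0 (wb_S0 B))).
Qed.

Definition wcoord v : L -> F := projT1 (cid (wcoord_ex v)).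

Lemma wcoordP v : is_coord v (wcoord v). Proof. exact: projT2 (cid (wcoord_ex v)). Qed.

Lemma wcoord_finite v : exists s, forall k, k \notin s -> wcoord v k = 0.
Proof. by have [s [_ sf _ _]] := wcoordP v; exists s. Qed.

Lemma wcoord_out v k : ~ S k -> wcoord v k = 0.
Proof.
move=> nS; have [s [_ _ fS _]] := wcoordP v; apply/eqP; apply: contraT => /fS.
by [].
Qed.

Lemma wcoord_0 k : wcoord 0 k = 0. Proof. exact: (wcoord_uniq (wcoordP _) wcoord0). Qed.
Lemma wcoord_D u v k : wcoord (u + v) k = wcoord u k + wcoord v k.
Proof. exact: (wcoord_uniq (wcoordP _) (wcoordD (wcoordP u) (wcoordP v))). Qed.
Lemma wcoord_Z c v k : wcoord (fscale c v) k = c * wcoord v k.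
Proof. exact: (wcoord_uniq (wcoordP _) (wcoordZ c (wcoordP v))). Qed.
Lemma wcoord_sumE (T : Type) (r : seq T) (G : T -> V) k :
  wcoord (\sum_(t <- r) G t) k = \sum_(t <- r) wcoord (G t) k.
Proof.
by elim/big_rec2: _ => [|t x y _ <-]; [exact: wcoord_0 | rewrite wcoord_D].
Qed.
Lemma wcoord_E k x : S k -> wcoord (e k) x = (x == k)%:R.
Proof. by move=> Sk; exact: (wcoord_uniq (wcoordP _) (wcoord_e Sk)). Qed.

Lemma wcoord_inj u v : (forall k, wcoord u k = wcoord v k) -> u = v.
Proof.
move=> uv; have [s [us sf _ vE]] := wcoordP v; rewrite vE.
rewrite (wcoord_sum (wcoordP u) us) => [|k /sf]; last by rewrite uv.
by apply: eq_bigr => k _; rewrite uv.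
Qed.

(** An element acts as a weighted shift once it does so on the basis. *)
Lemma wcoord_shift (a : U) (c : L -> F) (d : L) :
  (forall k, a *: e k = fscale (c k) (e (k + d))) ->
  (forall k, c k != 0 -> S (k + d)) ->
  forall v x, wcoord (a *: v) x = c (x - d) * wcoord v (x - d).
Proof.
move=> ae cS v x; have [s [us sf fS vE]] := wcoordP v.
rewrite {1}vE scaler_sumr wcoord_sumE.
have term k : wcoord (a *: fscale (wcoord v k) (e k)) x =
    wcoord v k * c k * (x == k + d)%:R.
  rewrite act_fscale ae fscaleA wcoord_Z; case: (eqVneq (c k) 0) => [->|/cS Skd].
    by rewrite mulr0 !mul0r.
  by rewrite wcoord_E.
rewrite (eq_bigr _ (fun k _ => term k)).
case: (boolP (x - d \in s)) => [xs|xs].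
  rewrite (bigD1_seq _ xs us) /= subrK eqxx mulr1 big1 ?addr0 1?mulrC // => k kx.
  have -> : x == k + d = false; last by rewrite mulr0.
  by apply/negbTE; apply: contra kx => /eqP->; rewrite addrK.
rewrite (sf _ xs) mulr0 big1_seq // => k /andP[_ ks].
have -> : x == k + d = false; last by rewrite mulr0.
by apply/negbTE; apply: contra xs => /eqP->; rewrite addrK.
Qed.

Lemma wcoord_slE i v x : wcoord (slE q i *: v) x = eps i (x - alpha i) * wcoord v (x - alpha i).
Proof. by apply: wcoord_shift => k; [exact: (wb_E B) | case/(wb_eps B)]. Qed.

Lemma wcoord_slF i v x : wcoord (slF q i *: v) x = phi i (x + alpha i) * wcoord v (x + alpha i).
Proof.
rewrite -{1 2}[alpha i]opprK; apply: wcoord_shift => k; first exact: (wb_F B).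
by case/(wb_phi B).
Qed.

Let wcoord_diag (a : U) (c : L -> F) : (forall k, a *: e k = fscale (c k) (e k)) ->
  forall v x, wcoord (a *: v) x = c x * wcoord v x.
Proof.
move=> ae v x; have [s [us sf fS vE]] := wcoordP v.
have c' : is_coord (a *: v) (fun k => c k * wcoord v k).
  exists s; split=> // [k /sf->|k|]; first by rewrite mulr0.
    by rewrite mulf_eq0 => /norP[_ /fS].
  by rewrite {1}vE scaler_sumr; apply: eq_bigr => k _; rewrite act_fscale ae fscaleA mulrC.
exact: (wcoord_uniq (wcoordP _) c').
Qed.

Lemma wcoord_slK i v x : wcoord (slK q i *: v) x = wtK q lam i x * wcoord v x.
Proof. by apply: wcoord_diag => k; apply: (wb_K B). Qed.

Lemma wcoord_slKV i v x : wcoord (slKV q i *: v) x = (wtK q lam i x)^-1 * wcoord v x.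
Proof. by apply: (wcoord_diag (c := fun x => (wtK q lam i x)^-1)) => k; apply: slKV_e. Qed.

(** The span of the weight vectors reached from e k is a submodule. *)
Lemma wcoord_conn k l : S k -> S l ->
  exists2 w, k + wt w = l & value eps phi w k != 0.
Proof.
move=> Sk Sl; pose R (m : L) := exists2 w, k + wt w = m & value eps phi w k != 0.
pose P v := forall m, wcoord v m != 0 -> R m.
have Rstep t m : R m -> coef eps phi t m != 0 -> R (m + step t).
  move=> [w wm vw] c0; exists (rcons w t).
    by rewrite /wt -cats1 big_cat big_seq1 /= -[\sum_(_ <- w) _]/(wt w) addrA wm.
  by rewrite -cats1 value_cat mulf_neq0 //= mulr1 wm.
have subm : is_submodule (A := U) P.
  apply: is_submodule_gen.
  - by move=> m; rewrite wcoord_0 eqxx.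
  - move=> u v Pu Pv m; rewrite wcoord_D; case: (eqVneq (wcoord u m) 0) => [->|/Pu//].
    by rewrite add0r; apply: Pv.
  - by move=> c v Pv m; rewrite wcoord_Z mulf_eq0 => /norP[_ /Pv].
  - move=> i v Pv m; rewrite wcoord_slE mulf_eq0 => /norP[c0 /Pv Rm].
    by have := Rstep (true, i) _ Rm c0; rewrite /step /= subrK.
  - move=> i v Pv m; rewrite wcoord_slF mulf_eq0 => /norP[c0 /Pv Rm].
    by have := Rstep (false, i) _ Rm c0; rewrite /step /= addrK.
  - by move=> i v Pv m; rewrite wcoord_slK mulf_eq0 => /norP[_ /Pv].
  - move=> i v Pv m; rewrite wcoord_slKV mulf_eq0 => /norP[_ /Pv].
    by [].
have [_ /(_ _ subm)[all0|allP]] := irr.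
  suff /all0/eqP : P (e k) by rewrite (negbTE (e_neq0 Sk)).
  move=> m; rewrite wcoord_E //; case: (eqVneq m k) => [->|_]; last by rewrite eqxx.
  by exists [::]; rewrite /wt ?big_nil ?addr0 ?oner_neq0.
by apply: (allP (e l)); rewrite wcoord_E // eqxx oner_neq0.
Qed.

Lemma coef_unique (a b : F) m : (~ S m -> a = b) ->
  fscale a (e m) = fscale b (e m) -> a = b.
Proof.
case: (pselect (S m)) => [Sm _ ab|nS /(_ nS)//].
by have := congr1 (wcoord^~ m) ab; rewrite !wcoord_Z wcoord_E // eqxx !mulr1.
Qed.

Let eps_out i k : ~ S (k + alpha i) -> eps i k = 0.
Proof. by move=> nS; apply/eqP; apply: contraT => /(wb_eps B)[]. Qed.
Let phi_out i k : ~ S (k - alpha i) -> phi i k = 0.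
Proof. by move=> nS; apply/eqP; apply: contraT => /(wb_phi B)[]. Qed.

Let EF_e i j k : slE q i *: (slF q j *: e k) =
  fscale (eps i (k - alpha j) * phi j k) (e (k - alpha j + alpha i)).
Proof. by rewrite (wb_F B) act_fscale (wb_E B) fscaleA mulrC. Qed.
Let FE_e i j k : slF q j *: (slE q i *: e k) =
  fscale (phi j (k + alpha i) * eps i k) (e (k + alpha i - alpha j)).
Proof. by rewrite (wb_E B) act_fscale (wb_F B) fscaleA mulrC. Qed.
Let EE_e i j k : slE q i *: (slE q j *: e k) =
  fscale (eps i (k + alpha j) * eps j k) (e (k + alpha j + alpha i)).
Proof. by rewrite (wb_E B) act_fscale (wb_E B) fscaleA mulrC. Qed.
Let EEE_e i j l k : slE q i *: (slE q j *: (slE q l *: e k)) =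
  fscale (eps i (k + alpha l + alpha j) * eps j (k + alpha l) * eps l k)
    (e (k + alpha l + alpha j + alpha i)).
Proof. by rewrite EE_e act_fscale (wb_E B) fscaleA; congr fscale; ring. Qed.

Lemma weight_basis_coef_system : coef_system q lam S eps phi.
Proof.
split.
- exact: wb_lam B.
- exact: wb_eps B.
- exact: wb_phi B.
- move=> i j k ij; apply: (@coef_unique _ _ (k - alpha j + alpha i)).
    by move=> nS; rewrite eps_out // [phi j _ in RHS]phi_out ?mul0r // addrAC.
  rewrite -EF_e [_ - _ + _]addrAC -FE_e; apply/eqP; rewrite -subr_eq0 -!actM -scalerBl.
  by rewrite slE_F (negbTE ij) mul0r rmorph0 mul0r scale0r.
- move=> i k Sk; apply: (@coef_unique _ _ k) => //.
  have /eqP := congr1 (fun a : U => a *: e k) (slE_F q i i).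
  rewrite scalerBl !actM EF_e FE_e subrK addrK -fscaleBl eqxx mul1r => /eqP ->.
  rewrite scalerBl (wb_K B) slKV_e -fscaleBl.
  by rewrite -/(fscale _ _) fscaleA mulrC.
- move=> i j k d; apply: (@coef_unique _ _ (k + alpha j + alpha i)).
    by move=> nS; rewrite [eps i _]eps_out // [eps j (_ + _)]eps_out ?mul0r // addrAC.
  by rewrite -EE_e addrAC -EE_e -!actM slEE.
- move=> i j k a; pose m := k + alpha i + alpha i + alpha j.
  have m1 : k + alpha j + alpha i + alpha i = m.
    by rewrite /m [k + alpha j + alpha i]addrAC [LHS]addrAC.
  have m2 : k + alpha i + alpha j + alpha i = m by rewrite /m [LHS]addrAC.
  apply: (@coef_unique _ _ m) => [nS|].
    rewrite (@eps_out i (k + alpha j + alpha i)) ?m1 //.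
    rewrite (@eps_out i (k + alpha i + alpha j)) ?m2 //.
    by rewrite (@eps_out j (k + alpha i + alpha i)) // !mul0r mulr0 subrr addr0.
  have t1 := EEE_e i i j k; have t2 := EEE_e i j i k.
  rewrite m1 in t1; rewrite m2 in t2.
  rewrite fscaleDl fscaleBl -(fscaleA (qtwo q)) -t1 -t2 -[fscale _ (e m)](EEE_e j i i k) fscale0l.
  have := congr1 (fun a : U => a *: e k) (sl_serre q a).
  by rewrite scale0r scalerDl scalerBl act_scal !actM.
exact: wcoord_conn.
Qed.

(** A bounded support would be finite. *)
Lemma support_unbounded : infinite_dimensional V ->
  forall M, exists2 k, S k & exists l, large M (k l).
Proof.
move=> inf M; case: (pselect (exists2 k, S k & exists l, large M (k l))) => // no.
case: inf; have small k : S k -> forall l, (`|k l| < absz M)%N.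
  move=> Sk l; have : ~~ large M (k l).
    by apply/negP=> lk; case: no; exists k => //; exists l.
  by rewrite /large; lia.
pose T := {ffun 'I_n.+1 -> 'I_(absz M + absz M)}.
pose t := undup [seq ([ffun l => (h l : nat)%:Z - (absz M)%:Z] : L) | h : T].
have St k : S k -> k \in t.
  move=> Sk; rewrite mem_undup; apply/mapP.
  have b l : (absz (k l + (absz M)%:Z)%R < absz M + absz M)%N by have := small k Sk l; lia.
  exists [ffun l => Ordinal (b l)]; first by rewrite mem_enum.
  by apply/ffunP=> l; rewrite !ffunE /=; have := small k Sk l; lia.
exists (map e t) => v; exists (fun m => wcoord v (nth 0 t m)).
have out k : k \notin t -> wcoord v k = 0.
  by move=> kt; apply: wcoord_out => /St; apply/negP.
rewrite {1}(wcoord_sum (wcoordP v) (undup_uniq _) out) (big_nth 0) big_mkord size_map.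
by apply: eq_bigr => m _; rewrite (nth_map 0).
Qed.

End Coordinates.

(** * The quantum sl_(n+1) acting on a Weyl module *)

Section WeylCoefficients.
Variables (F : fieldType) (q : F) (n : nat).
Hypotheses (q_neq0 : q != 0) (q_nroot : not_root_of_unity q).
Local Notation L := (lattice n).
Variable w : 'I_n.+1 -> F.
Hypothesis w_neq0 : forall l, w l != 0.
Local Notation O := (wtO q w).
Local Notation W := (weyl_module q_neq0 q_nroot w_neq0).
Local Notation wc := (@weyl_coef F q n q_neq0 q_nroot w w_neq0).
Implicit Types (i j : 'I_n) (k x : L).

Let charge (t : F) : F := (sh (q * t) != 0)%:R.

(** The coefficients of E_i = x_i y_(i+1) and F_i = x_(i+1) y_i on the basis. *)
Definition weyl_eps i k := charge (O (lo i) k) * (sh (O (hi i) k) / sh q).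
Definition weyl_phi i k := charge (O (hi i) k) * (sh (O (lo i) k) / sh q).

Let shq : sh q != 0. Proof. exact: sh_q_neq0. Qed.

Let lo_hi i : (lo i == hi i) = false. Proof. exact/negbTE/lo_neq_hi. Qed.
Let hi_lo i : (hi i == lo i) = false. Proof. by rewrite eq_sym lo_hi. Qed.

Lemma weyl_coef_E i (f : W) x :
  wc (gl_to_weyl n q_neq0 q_nroot (glE q i) *: f) x =
    weyl_eps i (x - alpha i) * wc f (x - alpha i).
Proof.
rewrite gl_to_weylE -scalerA weyl_coefX weyl_coefY /x_coef /y_coef /weyl_eps /charge.
rewrite wtO_unitB // hi_lo expr0 invr1 mul1r wtO_loB // wtO_hiB // mulVKf //.
rewrite mulrA alpha_unit; congr (_ * wc f _).
by rewrite opprB addrA addrAC.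
Qed.

Lemma weyl_coef_F i (f : W) x :
  wc (gl_to_weyl n q_neq0 q_nroot (glF q i) *: f) x =
    weyl_phi i (x + alpha i) * wc f (x + alpha i).
Proof.
rewrite gl_to_weylF -scalerA weyl_coefX weyl_coefY /x_coef /y_coef /weyl_phi /charge.
rewrite wtO_unitB // lo_hi expr0 invr1 mul1r wtO_lo // wtO_hi // mulVKf //.
rewrite mulrA alpha_unit; congr (_ * wc f _).
by rewrite addrA addrAC.
Qed.

Lemma weyl_coef_K i (f : W) x :
  wc (gl_to_weyl n q_neq0 q_nroot (glK q (lo i) * glKV q (hi i)) *: f) x =
    O (lo i) x / O (hi i) x * wc f x.
Proof.
by rewrite rmorphM /= gl_to_weylK gl_to_weylKV -scalerA weyl_coefO weyl_coefOV mulrA.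
Qed.

Lemma weyl_coef_KV i (f : W) x :
  wc (gl_to_weyl n q_neq0 q_nroot (glKV q (lo i) * glK q (hi i)) *: f) x =
    (O (lo i) x / O (hi i) x)^-1 * wc f x.
Proof.
rewrite rmorphM /= gl_to_weylK gl_to_weylKV -scalerA weyl_coefOV weyl_coefO mulrA.
by rewrite invfM invrK.
Qed.

Lemma weyl_commuting : commuting weyl_eps weyl_phi.
Proof.
move=> i j k ij.
have eq_lo : (lo i == lo j) = false by apply: negbTE; apply: contra ij; rewrite -!val_eqE.
have eq_hi : (hi i == hi j) = false.
  by apply: negbTE; apply: contra ij; rewrite -!val_eqE /= /bump !add1n.
have OB l : O l (k - alpha j) = q ^ ((l == hi j)%:Z - (l == lo j)%:Z) * O l k.
  by rewrite wtOD // !ffunE opprB.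
have OD l : O l (k + alpha i) = q ^ ((l == lo i)%:Z - (l == hi i)%:Z) * O l k.
  by rewrite wtOD // !ffunE.
rewrite /weyl_eps /weyl_phi !OB !OD eq_lo eq_hi [lo j == lo i]eq_sym [hi j == hi i]eq_sym.
rewrite eq_lo eq_hi [hi j == lo i]eq_sym [lo j == hi i]eq_sym !subr0 !sub0r.
case: (eqVneq (lo i) (hi j)) => [->|_]; case: (eqVneq (hi i) (lo j)) => [->|_];
  rewrite ?expr0z ?mul1r; ring.
Qed.

Lemma weyl_eps_neq0 i k :
  (weyl_eps i k != 0) = (sh (q * O (lo i) k) != 0) && (sh (O (hi i) k) != 0).
Proof.
rewrite /weyl_eps /charge mulf_eq0 mulf_eq0 invr_eq0 (negbTE shq) orbF negb_or.
by case: (sh (q * _) == 0); rewrite ?eqxx // oner_eq0.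
Qed.

Lemma weyl_phi_neq0 i k :
  (weyl_phi i k != 0) = (sh (q * O (hi i) k) != 0) && (sh (O (lo i) k) != 0).
Proof.
rewrite /weyl_phi /charge mulf_eq0 mulf_eq0 invr_eq0 (negbTE shq) orbF negb_or.
by case: (sh (q * _) == 0); rewrite ?eqxx // oner_eq0.
Qed.

Lemma weyl_phi_up i k : (weyl_phi i (k + alpha i) != 0) = (weyl_eps i k != 0).
Proof.
by rewrite weyl_phi_neq0 weyl_eps_neq0 wtO_lo // wtO_hi // mulVKf // andbC.
Qed.

Lemma weyl_phi_eps i k :
  weyl_phi i (k + alpha i) * weyl_eps i k =
    sh (q * O (lo i) k) * sh (O (hi i) k) / sh q ^+ 2.
Proof.
rewrite /weyl_phi /weyl_eps /charge wtO_lo // wtO_hi // mulVKf //.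
set a := sh (q * _); set b := sh (O _ _).
case: (eqVneq a 0) => [->|_]; first by rewrite !mul0r !mulr0.
case: (eqVneq b 0) => [->|_]; first by rewrite !mul0r !mulr0 mul0r.
by rewrite !mul1r; field_nz.
Qed.

Lemma weyl_eps_box i k : weyl_eps i k != 0 -> in_box q w k -> in_box q w (k + alpha i).
Proof.
rewrite weyl_eps_neq0 alpha_unit => /andP[a b] bk.
have b1 : in_box q w (k - unit_vec (hi i)).
  apply: (@in_box_dn _ _ _ _ _ (hi i)); rewrite ?subrK //.
  by rewrite wtO_unitB // eqxx mulVKf.
have -> : k + (unit_vec (lo i) - unit_vec (hi i)) =
    k - unit_vec (hi i) + unit_vec (lo i) by rewrite addrA addrAC.
apply: (@in_box_up _ _ _ _ _ (lo i)); rewrite ?addrK //.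
by rewrite wtO_unit // eqxx wtO_unitB // lo_hi expr0 invr1 mul1r.
Qed.

Lemma weyl_phi_box i k : weyl_phi i k != 0 -> in_box q w k -> in_box q w (k - alpha i).
Proof.
rewrite weyl_phi_neq0 alpha_unit => /andP[a b] bk.
have b1 : in_box q w (k - unit_vec (lo i)).
  apply: (@in_box_dn _ _ _ _ _ (lo i)); rewrite ?subrK //.
  by rewrite wtO_unitB // eqxx mulVKf.
have -> : k - (unit_vec (lo i) - unit_vec (hi i)) =
    k - unit_vec (lo i) + unit_vec (hi i) by rewrite opprB addrA addrAC.
apply: (@in_box_up _ _ _ _ _ (hi i)); rewrite ?addrK //.
by rewrite wtO_unit // eqxx wtO_unitB // hi_lo expr0 invr1 mul1r.
Qed.

End WeylCoefficients.

(** * The embedding *)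

Section LinearPacking.
Variables (R : pzRingType) (V W : lmodType R).

Definition linear_fun (f : V -> W) (_ : linear f) : V -> W := f.
HB.instance Definition _ f (lf : linear f) :=
  GRing.isLinear.Build R V W *:%R (linear_fun lf) lf.

Lemma ex_linear (f : V -> W) : linear f ->
  exists h : {linear V -> W}, forall v, h v = f v.
Proof. by move=> lf; exists (linear_fun lf : {linear V -> W}). Qed.

End LinearPacking.

Section Embedding.
Variables (F : fieldType) (q : F) (n : nat) (V : lmodType (Uqsl q n)).
Hypotheses (q_neq0 : q != 0) (q_nroot : not_root_of_unity q).
Hypothesis irr : irreducible_module V.
Local Notation L := (lattice n).
Local Notation U := (Uqsl q n).
Implicit Types (i j : 'I_n) (k x : L) (u v : V).
Variables (lam : 'I_n -> F) (S : L -> Prop) (e : L -> V) (eps phi : 'I_n -> L -> F).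
Hypothesis B : weight_basis lam S e eps phi.
Let C := weight_basis_coef_system q_neq0 irr B.

Variable w : 'I_n.+1 -> F.
Hypothesis w_neq0 : forall l, w l != 0.
Hypothesis lamE : forall i, lam i = w (lo i) / w (hi i).
Hypothesis fits : forall i k, S k -> fits_at q w (casimir q lam eps phi) i k.

Local Notation O := (wtO q w).
Local Notation W := (weyl_module q_neq0 q_nroot w_neq0).
Local Notation wc := (@weyl_coef F q n q_neq0 q_nroot w w_neq0).
Local Notation eps' := (weyl_eps q w).
Local Notation phi' := (weyl_phi q w).
Local Notation co := (wcoord q_neq0 irr B).
Local Notation pi := (gl_to_weyl n q_neq0 q_nroot).

Let shq : sh q != 0. Proof. exact: sh_q_neq0. Qed.
Let shq2 : sh q ^+ 2 != 0. Proof. exact: expf_neq0. Qed.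
Let C' : commuting eps' phi'. Proof. exact: weyl_commuting. Qed.

Let agreeE i k : S k ->
  phi i (k + alpha i) * eps i k = phi' i (k + alpha i) * eps' i k.
Proof.
move=> Sk; rewrite weyl_phi_eps // -(fits_up q_neq0 w_neq0 lamE (fits i Sk)).
by rewrite up_casimir [RHS]mulrC mulKf.
Qed.

(** A coefficient vanishes in V exactly if it does in W, by the Casimir values. *)
Let eps_live i k : S k -> (eps i k != 0) = (eps' i k != 0).
Proof.
move=> Sk; rewrite -(up_eps q_neq0 q_nroot C) // (fits_up q_neq0 w_neq0 lamE (fits i Sk)).
by rewrite weyl_eps_neq0 // mulf_eq0 negb_or.
Qed.

Let phi_live i k : S k -> (phi i k != 0) = (phi' i k != 0).
Proof.
move=> Sk; rewrite -(dn_phi q_neq0 q_nroot C) // (fits_dn q_neq0 w_neq0 lamE (fits i Sk)).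
by rewrite weyl_phi_neq0 // mulf_eq0 negb_or andbC.
Qed.

Let agreeF i k : S k ->
  eps i (k - alpha i) * phi i k = eps' i (k - alpha i) * phi' i k.
Proof.
move=> Sk; case: (pselect (S (k - alpha i))) => [Sk'|nS].
  by have := agreeE i Sk'; rewrite subrK mulrC => ->; rewrite mulrC.
have -> : phi i k = 0 by apply/eqP; apply: contraT => /(wb_phi B)[].
have -> : phi' i k = 0; last by rewrite !mulr0.
by apply/eqP; apply: contraT; rewrite -phi_live // => /(wb_phi B)[].
Qed.

Let valE t k : wt t = 0 -> S k -> value eps phi t k = value eps' phi' t k.
Proof.
move=> t0 Sk; apply: (closed_value_eq (cs_comm C) C' _ _ agreeE agreeF t0 Sk).
  by move=> i x /(wb_eps B)[].
by move=> i x /(wb_phi B)[].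
Qed.

(** Words from 0 to k have proportional values in V and W, because closing them with
    a fixed word from k back to 0 makes the values equal. *)
Let ratio_ex : exists g : L -> F, forall k, S k -> g k != 0 /\
  forall t, wt t = k -> value eps' phi' t 0 = value eps phi t 0 * g k.
Proof.
apply: (choice_fun (P := fun k y => S k -> y != 0 /\
  forall t, wt t = k -> value eps' phi' t 0 = value eps phi t 0 * y)) => k.
case: (pselect (S k)) => [Sk|nS]; last by exists 0.
have S0 := wb_S0 B; have [r rk vr] := cs_conn C Sk S0.
have [p pk vp] := cs_conn C S0 Sk; rewrite add0r in pk.
have key t : wt t = k ->
    value eps phi t 0 * value eps phi r k = value eps' phi' t 0 * value eps' phi' r k.
  move=> tk; have tr : wt (t ++ r) = 0.
    by rewrite /wt big_cat /= -/(wt t) -/(wt r) tk.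
  by have := valE tr S0; rewrite !value_cat add0r tk.
have vr' : value eps' phi' r k != 0.
  by have := mulf_neq0 vp vr; rewrite (key p pk) mulf_eq0 => /norP[].
exists (value eps phi r k / value eps' phi' r k) => _; split.
  by rewrite mulf_neq0 // invr_eq0.
by move=> t tk; rewrite mulrA (key t tk) mulfK.
Qed.

Let g := projT1 (cid ratio_ex).
Let gP : forall k, S k -> g k != 0 /\
  forall t, wt t = k -> value eps' phi' t 0 = value eps phi t 0 * g k.
Proof. exact: projT2 (cid ratio_ex). Qed.
Let g_neq0 k : S k -> g k != 0. Proof. by case/gP. Qed.

(** The rescaling intertwines the coefficients: extend a path to k by one letter. *)
Let g_step t k : S k -> S (k + step t) ->
  g (k + step t) * coef eps phi t k = g k * coef eps' phi' t k.
Proof.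
move=> Sk Sk'; have [p pk vp] := cs_conn C (wb_S0 B) Sk; rewrite add0r in pk.
have := (gP Sk').2 (rcons p t); have := (gP Sk).2 p pk.
rewrite -cats1 !value_cat /= !mulr1 add0r pk => -> h; apply: (mulfI vp).
rewrite [g _ * _]mulrC mulrA -h ?mulrA //.
by rewrite /wt big_cat /= big_seq1 -/(wt p) pk.
Qed.

Let g_eps i k : S k -> g (k + alpha i) * eps i k = g k * eps' i k.
Proof.
move=> Sk; case: (pselect (S (k + alpha i))) => [Sk'|nS].
  exact: (g_step (t := (true, i)) Sk Sk').
have -> : eps i k = 0 by apply/eqP; apply: contraT => /(wb_eps B)[].
have -> : eps' i k = 0; last by rewrite !mulr0.
by apply/eqP; apply: contraT; rewrite -eps_live // => /(wb_eps B)[].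
Qed.

Let g_phi i k : S k -> g (k - alpha i) * phi i k = g k * phi' i k.
Proof.
move=> Sk; case: (pselect (S (k - alpha i))) => [Sk'|nS].
  exact: (g_step (t := (false, i)) Sk Sk').
have -> : phi i k = 0 by apply/eqP; apply: contraT => /(wb_phi B)[].
have -> : phi' i k = 0; last by rewrite !mulr0.
by apply/eqP; apply: contraT; rewrite -phi_live // => /(wb_phi B)[].
Qed.

Let S_box k : S k -> in_box q w k.
Proof.
move=> Sk; have [p pk vp] := cs_conn C (wb_S0 B) Sk; rewrite add0r in pk.
have vp' : value eps' phi' p 0 != 0 by rewrite (gP Sk).2 // mulf_neq0 // g_neq0.
rewrite -pk -[wt p]add0r; move: (0 : L) (in_box0 q w) vp' {vp pk} => k0 b0.
elim: p k0 b0 => [|[b i] p IH] k0 b0 /=; first by rewrite /wt big_nil addr0.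
rewrite mulf_eq0 => /norP[c0 v0]; rewrite /wt big_cons addrA; apply: IH => //.
by case: b c0 {v0} => /= c0; [apply: weyl_eps_box | apply: weyl_phi_box].
Qed.

Let img_finite v : exists s : seq L, forall k, k \notin s -> co v k * g k = 0.
Proof. by have [s sf] := wcoord_finite q_neq0 irr B v; exists s => k /sf->; rewrite mul0r. Qed.

Let img_box v k : co v k * g k != 0 -> in_box q w k.
Proof.
move=> nz; apply: S_box; case: (pselect (S k)) => // nS; case/eqP: nz.
by rewrite wcoord_out // mul0r.
Qed.

Let img v : W := Fsupp (img_finite v) (@img_box v).

Let imgE v k : wc (img v) k = co v k * g k. Proof. by []. Qed.

Local Notation pW := (pullback (@sl_to_gl F q n) (pullback pi W)).

Let imgA (a : U) v : img (a *: v) = pi (sl_to_gl q n a) *: img v.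
Proof.
elim/(@Uqsl_ind F q n): a v => [i|i|i|i|c|a b IHa IHb|a b IHa IHb] v.
- apply: weyl_coefP => k; rewrite weyl_coef_E !imgE wcoord_slE //.
  case: (pselect (S (k - alpha i))) => [Sk|nS]; last by rewrite wcoord_out // !(mulr0, mul0r).
  by have := g_eps i Sk; rewrite subrK => h; rewrite mulrAC [eps i _ * _]mulrC h; ring.
- apply: weyl_coefP => k; rewrite weyl_coef_F !imgE wcoord_slF //.
  case: (pselect (S (k + alpha i))) => [Sk|nS]; last by rewrite wcoord_out // !(mulr0, mul0r).
  by have := g_phi i Sk; rewrite addrK => h; rewrite mulrAC [phi i _ * _]mulrC h; ring.
- apply: weyl_coefP => k; rewrite weyl_coef_K !imgE wcoord_slK //.
  by rewrite (wtK_O q_neq0 lamE) mulrA.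
- apply: weyl_coefP => k; rewrite weyl_coef_KV !imgE wcoord_slKV //.
  by rewrite (wtK_O q_neq0 lamE) mulrA.
- apply: weyl_coefP => k; have -> : pi (sl_to_gl q n (scal c)) = scal c.
    exact: gl_to_weyl_scal.
  by rewrite (weyl_coefZ c (img v)) !imgE (wcoord_Z q_neq0 irr B c v) mulrA.
- rewrite scalerDl !rmorphD scalerDl -IHa -IHb; apply: weyl_coefP => k.
  by rewrite weyl_coefD !imgE wcoord_D mulrDl.
- by rewrite actM IHa IHb !rmorphM scalerA.
Qed.

Let img_linear : linear (img : V -> pW).
Proof.
move=> a u v; apply: (etrans (y := img (a *: u) + img v)).
  by apply: weyl_coefP => k; rewrite weyl_coefD !imgE wcoord_D mulrDl.
by rewrite imgA.
Qed.

Let img_inj : injective img.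
Proof.
move=> u v uv; apply: (@wcoord_inj _ _ _ _ q_neq0 irr _ _ _ _ _ B) => k.
case: (pselect (S k)) => [Sk|nS]; last by rewrite !wcoord_out.
by have := congr1 (wc^~ k) uv; rewrite !imgE => /(mulIf (g_neq0 Sk)).
Qed.

Let img_onto (f : W) : (forall k, wc f k != 0 -> S k) -> exists v, img v = f.
Proof.
move=> fS; have [s sf] := weyl_finite f.
exists (\sum_(k <- undup s) fscale (wc f k / g k) (e k)); apply: weyl_coefP => x.
rewrite imgE wcoord_sumE mulr_suml.
have term k : co (fscale (wc f k / g k) (e k)) x * g x = wc f k * (x == k)%:R.
  rewrite wcoord_Z; case: (eqVneq (wc f k) 0) => [->|/fS Sk]; first by rewrite !mul0r.
  rewrite wcoord_E //; case: (eqVneq x k) => [->|_]; last by rewrite !mulr0 mul0r.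
  by rewrite !mulr1 divfK // g_neq0.
rewrite (eq_bigr _ (fun k _ => term k)); case: (boolP (x \in s)) => [xs|xs].
  rewrite (bigD1_seq x) ?undup_uniq ?mem_undup //= eqxx mulr1 big1 ?addr0 // => k kx.
  by rewrite eq_sym (negbTE kx) mulr0.
rewrite (sf _ xs) big1_seq // => k /andP[_]; rewrite mem_undup => ks.
case: (eqVneq x k) => [xk|_]; last by rewrite mulr0.
by rewrite xk ks in xs.
Qed.

(** No nonzero coefficient of W joins S to its complement: the range of the
    embedding is spanned by the weight vectors of W with weights in S, and the
    other weight vectors span a complement. *)
Lemma embed_summand : iso_to_direct_summand V pW.
Proof.
have [h hE] := ex_linear img_linear.
exists h; split=> [u v|]; first by rewrite !hE; apply: img_inj.
have im0 (y : pW) : classical_sets.range h y -> forall k, ~ S k -> wc y k = 0.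
  by case=> v _ <- k nS; rewrite hE imgE wcoord_out // mul0r.
split.
  split.
  - by exists 0; rewrite ?linear0.
  - by move=> _ _ [u _ <-] [v _ <-]; exists (u + v); rewrite ?linearD.
  - by move=> a _ [v _ <-]; exists (a *: v); rewrite ?linearZ.
exists (fun f : pW => forall k, S k -> wc f k = 0); split.
- apply: is_submodule_gen => //.
  + by move=> f f1 Pf Pf1 k Sk; rewrite weyl_coefD Pf // Pf1 // addr0.
  + move=> c f Pf k Sk; have -> : wc (fscale c f : pW) k = c * wc f k.
      rewrite -(weyl_coefZ c (f : W)); congr (wc _ k).
      exact: (congr1 (fun a => a *: (f : W)) (gl_to_weyl_scal n q_neq0 q_nroot c)).
    by rewrite Pf // mulr0.
  + move=> i f Pf k Sk; rewrite (@weyl_coef_E F q n q_neq0 q_nroot w w_neq0 i f k).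
    case: (pselect (S (k - alpha i))) => [/Pf->|nS]; first by rewrite mulr0.
    case: (eqVneq (eps' i (k - alpha i)) 0) => [->|]; first by rewrite mul0r.
    by rewrite -weyl_phi_up // subrK -phi_live // => /(wb_phi B)[].
  + move=> i f Pf k Sk; rewrite (@weyl_coef_F F q n q_neq0 q_nroot w w_neq0 i f k).
    case: (pselect (S (k + alpha i))) => [/Pf->|nS]; first by rewrite mulr0.
    case: (eqVneq (phi' i (k + alpha i)) 0) => [->|]; first by rewrite mul0r.
    by rewrite weyl_phi_up // -eps_live // => /(wb_eps B)[].
  + move=> i f Pf k Sk; rewrite (@weyl_coef_K F q n q_neq0 q_nroot w w_neq0 i f k).
    by rewrite Pf // mulr0.
  + move=> i f Pf k Sk; rewrite (@weyl_coef_KV F q n q_neq0 q_nroot w w_neq0 i f k).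
    by rewrite Pf // mulr0.
- move=> f; exists (weyl_restrict S f), (weyl_restrict (fun k => ~ S k) f); split.
  + have [v <-] : exists v, img v = weyl_restrict S f; last by exists v; rewrite ?hE.
    apply: img_onto => k; rewrite weyl_coef_restrict; case: asboolP => //.
    by rewrite eqxx.
  + by move=> k Sk; rewrite weyl_coef_restrict; case: asboolP.
  apply: weyl_coefP => k; rewrite weyl_coefD !weyl_coef_restrict.
  case: (asboolP (S k)) => Sk; first by rewrite asboolF ?addr0.
  by rewrite asboolT // add0r.
move=> f /im0 f0 f1; apply: weyl_coefP => k.
by case: (pselect (S k)) => [/f1|/f0].
Qed.

End Embedding.

Theorem mainTheorem3 (F : fieldType) (q : F) (n : nat)
    (F_pchar0 : [pchar F] =i pred0)
    (F_quadratic : forall p : {poly F}, size p = 3%N -> exists x, root p x)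
    (q_neq0 : q != 0) (q_nroot : not_root_of_unity q) (n_gt0 : (0 < n)%N)
    (V : lmodType (Uqsl q n)) :
  infinite_dimensional V -> irreducible_module V -> sl_completely_pointed V ->
  exists W : lmodType (qWeyl q n.+1),
    [/\ irreducible_module W, weyl_completely_pointed W
      & iso_to_direct_summand V
          (pullback (@sl_to_gl F q n)
             (pullback (gl_to_weyl n q_neq0 q_nroot) W))].
Proof.
move=> V_inf V_irr V_pointed.
have [lam [S [e [eps [phi B]]]]] :=
  weight_basis_exists q_neq0 q_nroot (proj1 V_irr) V_pointed.
have H := coef_pointed_system q_neq0 q_nroot (weight_basis_coef_system q_neq0 V_irr B).
have [w [w_neq0 lamE fits]] := pointed_system_weyl_type F_quadratic q_neq0 q_nroot
  n_gt0 H (wb_S0 B) (wb_sum B) (support_unbounded q_neq0 V_irr B V_inf).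
exists (weyl_module q_neq0 q_nroot w_neq0); split.
- exact: weyl_irreducible.
- exact: weyl_module_pointed.
exact: (embed_summand q_neq0 q_nroot V_irr B w_neq0 lamE fits).
Qed.
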